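(* Let $b\in\mathbb{K}_{d,1}$ and $M>0$. There are constants $C=C(d,\alpha,M)$ and $C'=C'(d,\alpha,M,b)$ such that for all $a\in(0,M]$, $$|p^{a,b}(t,x,y)|\le C\,e^{C't}\,p^a\!\left(2\beta_Lt/\beta_U,x,y\right),\qquad t>0,\ x,y\in\mathbb{R}^d.$$ Consequently, for any $T>0$ there is a constant $C''=C''(d,\alpha,M,T)$ such that $$|p^{a,b}(t,x,y)|\le C''e^{C't}\,q^a_{d,\beta_U^2/(2\beta_L)}(t,x-y),\qquad t\in(0,T],\ x,y\in\mathbb{R}^d.$$
   Context: Standing assumption: $d\ge2$, $\alpha\in(0,2)$. $M_f(r)=\sup_x\int_{|x-y|<r}|f(y)||x-y|^{1-d}dy$ and $f\in\mathbb{K}_{d,1}$ iff $M_f(r)\to0$ as $r\downarrow0$. For $a>0$, $p^a(t,x,y)=p^a(t,x-y)$ with $\int p^a(t,z)e^{iz\cdot\xi}dz=e^{-t(|\xi|^2+a^\alpha|\xi|^\alpha)}$. $q^a_{d,\beta}(t,z)=t^{-d/2}e^{-\beta|z|^2/t}+t^{-d/2}\wedge\frac{a^\alpha t}{|z|^{d+\alpha}}$. $\beta_L,\beta_U>0$ are constants (independent of $M,T$) such that for all $M,T>0$ there exist $C_L,C_U>0$ with $C_Lq^a_{d,\beta_L}(t,z)\le p^a(t,z)\le C_Uq^a_{d,\beta_U}(t,z)$ for $a\in(0,M]$, $t\in(0,T]$, $z\in\mathbb{R}^d$. Define $p_0^{a,b}=p^a$, $p_k^{a,b}(t,x,y)=\int_0^t\int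 p_{k-1}^{a,b}(t-s,x,z)b(z)\cdot\nabla_zp^a(s,z,y)dzds$. $p^{a,b}$ is the jointly continuous function on $(0,\infty)\times\mathbb{R}^d\times\mathbb{R}^d$ which equals $\sum_{k\ge0}p_k^{a,b}$ (absolutely convergent) on $(0,t_*]\times\mathbb{R}^d\times\mathbb{R}^d$ for a suitable $t_*>0$ and satisfies the Chapman–Kolmogorov equation $p^{a,b}(t+s,x,y)=\int p^{a,b}(t,x,z)p^{a,b}(s,z,y)dz$ for all $t,s>0$ (the fundamental solution of $\Delta+a^\alpha\Delta^{\alpha/2}+b\cdot\nabla$). *)

(* Defs.v *)
From HB Require Import structures.
From mathcomp Require Import all_boot all_order all_algebra.
From mathcomp Require Import all_classical all_reals all_analysis.
Set Implicit Arguments. Unset Strict Implicit. Unset Printing Implicit Defensive.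
Import Order.TTheory GRing.Theory Num.Theory.
Import numFieldNormedType.Exports.
Local Open Scope classical_set_scope.
Local Open Scope ring_scope.

Section Defs.
Variable R : realType.

(* Euclidean inner product and norm on R^d (the library norm on matrices is the sup norm) *)
Definition dotRd (d : nat) (u v : 'rV[R]_d) : R := \sum_(i < d) u 0 i * v 0 i.
Definition euclid (d : nat) (u : 'rV[R]_d) : R := Num.sqrt (dotRd u u).

(* Lebesgue integral on R^d, written as the iterated (Fubini) integral over the
   coordinates, nonnegative / extended-real version ... *)
Fixpoint intRdE (n : nat) : ('rV[R]_n -> \bar R) -> \bar R :=
  match n return ('rV[R]_n -> \bar R) -> \bar R with
  | 0 => fun f => f 0
  | n'.+1 => fun f =>
      (\int[@lebesgue_measure R]_x intRdE (fun v : 'rV[R]_n' =>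
          f (row_mx (\row_(_ < 1) x) v)))%E
  end.

Fixpoint intRd (n : nat) : ('rV[R]_n -> R) -> R :=
  match n return ('rV[R]_n -> R) -> R with
  | 0 => fun f => f 0
  | n'.+1 => fun f =>
      \int[@lebesgue_measure R]_x intRd (fun v : 'rV[R]_n' =>
          f (row_mx (\row_(_ < 1) x) v))
  end.

Definition borel_Rd (d : nat) (b : 'rV[R]_d -> 'rV[R]_d) : Prop :=
  forall (i : 'I_d) (U : set R), open U ->
    <<s (@open 'rV[R]_d)>> ((fun z => b z 0 i) @^-1` U).

Definition Kato_M (d : nat) (b : 'rV[R]_d -> 'rV[R]_d) (r : R) : \bar R :=
  ereal_sup [set intRdE (fun y : 'rV[R]_d =>
       if euclid (x - y) < r
       then (euclid (b y) * euclid (x - y) `^ (1 - d%:R))%:E else 0%E) | x in setT].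

Definition Kato_d1 (d : nat) (b : 'rV[R]_d -> 'rV[R]_d) : Prop :=
  Kato_M b r @[r --> 0^'+] --> 0%E.

(* q^a_{d,beta}(t,z) = t^{-d/2} e^{-beta|z|^2/t} + (t^{-d/2} /\ a^alpha t / |z|^{d+alpha})
   (the second term is t^{-d/2} at z = 0, where a^alpha t/|z|^{d+alpha} = +oo) *)
Definition qfun (d : nat) (alpha a beta t : R) (z : 'rV[R]_d) : R :=
  t `^ (- (d%:R / 2)) * expR (- beta * euclid z ^+ 2 / t) +
  (if z == 0 then t `^ (- (d%:R / 2))
   else Num.min (t `^ (- (d%:R / 2)))
                (a `^ alpha * t / euclid z `^ (d%:R + alpha))).

(* p^a is the function of (a, t, z): characterised by its Fourier transform
   \int p^a(t,z) e^{i z.xi} dz = exp(-t(|xi|^2 + a^alpha |xi|^alpha)),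
   split into real and imaginary parts; p^a(t,.) is taken integrable and continuous
   (the canonical continuous density). *)
Definition is_pa (d : nat) (alpha : R) (pa : R -> R -> 'rV[R]_d -> R) : Prop :=
  forall a t, 0 < a -> 0 < t ->
    [/\ continuous (pa a t),
        (intRdE (fun z => (`|pa a t z|)%:E) < +oo)%E,
        forall xi : 'rV[R]_d,
          intRd (fun z => pa a t z * cos (dotRd z xi)) =
            expR (- t * (euclid xi ^+ 2 + a `^ alpha * euclid xi `^ alpha)) &
        forall xi : 'rV[R]_d, intRd (fun z => pa a t z * sin (dotRd z xi)) = 0].

Fixpoint pk (d : nat) (pa : R -> R -> 'rV[R]_d -> R) (a : R)
    (b : 'rV[R]_d -> 'rV[R]_d) (k : nat) : R -> 'rV[R]_d -> 'rV[R]_d -> R :=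
  match k with
  | 0 => fun t x y => pa a t (x - y)
  | k'.+1 => fun t x y =>
      \int[@lebesgue_measure R]_(s in `]0, t[)
        intRd (fun z : 'rV[R]_d =>
          pk pa a b k' (t - s) x z *
          \sum_(i < d) b z 0 i * derive (fun w : 'rV[R]_d => pa a s (w - y)) z
                                        (delta_mx 0 i))
  end.

Definition is_pab (d : nat) (pa : R -> R -> 'rV[R]_d -> R) (a : R)
    (b : 'rV[R]_d -> 'rV[R]_d) (pab : R -> 'rV[R]_d -> 'rV[R]_d -> R) : Prop :=
  [/\ {within [set u : R * ('rV[R]_d * 'rV[R]_d) | 0 < u.1],
        continuous (fun u : R * ('rV[R]_d * 'rV[R]_d) => pab u.1 u.2.1 u.2.2)},
      exists2 ts : R, 0 < ts &
        forall t x y, 0 < t -> t <= ts ->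
          (exists l : R,
             (\sum_(0 <= k < n) `|pk pa a b k t x y|) @[n --> \oo] --> l) /\
          (\sum_(0 <= k < n) pk pa a b k t x y) @[n --> \oo] --> pab t x y &
      forall t s x y, 0 < t -> 0 < s ->
        pab (t + s) x y = intRd (fun z => pab t x z * pab s z y)].

End Defs.

(* Main.v *)
(* Put Q(t,z) = t^(-d/2) exp(-beta |z|^2/t) + theta(t) H(t,z) with beta = betaU / 2,
   H(t,z) = t^(alpha/2) (sqrt t + |z|)^(-d-alpha) and theta(t) = a^alpha t^(1-alpha/2); while
   theta <= 1, Q is comparable to q^a_{d,beta}.

   Gradient bound. Writing exp(-t a^alpha |xi|^alpha) as a limit of polynomials with nonnegative
   coefficients in exp(-v |xi|^2), the bound for the Gaussian passes to
   |grad p^a(t,z)| <= C t^(-1/2) p^a(t, 9z/10) <= C t^(-1/2) Q'(t,z), where Q' has a Gaussian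
   exponent beta' > beta.

   Since beta < beta', Q(t-s,u) Q'(s,v) <= C Q(t,u+v) (H(t-s,u) + H(s,v)). The integral over s < t
   of s^(-1/2) H(s,z) is at most C |z|^(1-d) (sqrt t / (sqrt t + |z|))^(1+alpha), and integrating
   this against |b| costs at most C M_b(sqrt t). So, for t <= t1, the Duhamel operator maps
   functions bounded by B Q to functions bounded by (B/2) Q.

   Hence |p_k| <= A 2^(-k) Q, and p^{a,b} satisfies Duhamel's equation for t <= min(t_*, t1). As t_*
   depends on a, the equation is propagated to 2t by Chapman-Kolmogorov and the semigroup property
   of p^a; the a priori bound by a multiple of Q which comes with it then improves to 2 A Q by
   contraction. Thus |p^{a,b}(t)| <= 2 A Q <= A' p^a(2 betaL t / betaU) for t <= t1, and iterating
   Chapman-Kolmogorov gives the factor A' exp(C' t) with C' = ln A' / t1. *)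
Require Import Defs.
From HB Require Import structures.
From mathcomp Require Import all_boot all_order all_algebra.
From mathcomp Require Import all_classical all_reals all_analysis.
From mathcomp Require Import measurable_realfun ring lra.
Import Order.TTheory GRing.Theory Num.Theory.
Import numFieldNormedType.Exports.
Set Implicit Arguments. Unset Strict Implicit. Unset Printing Implicit Defensive.
Local Open Scope classical_set_scope.
Local Open Scope ring_scope.

(** * Lebesgue measure on row vectors *)

(** The order of the constants shapes the proof: C must not see the drift, and C' must not see a.
    The first holds because the contraction factor 1/2 is bought by shrinking t1, never by enlarging
    the bound 2 A Q. The second is why Duhamel's equation has to be propagated: no lower bound on
    t_* uniform in a is given, so iterating Chapman-Kolmogorov from t_* on would give a rate that
    depends on a.

    The gap beta < beta' is forced. If u/r = v/s, the Gaussian exponents of both sides of the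
    three-point inequality agree for beta' = beta, while H decays, so the inequality fails. The
    gradient is therefore compared with p^a at 9z/10, close enough to z to keep a Gaussian exponent
    above betaU / 2.

    The Fourier transform determines p^a separately at each time. Joint measurability in (t, z), the
    derivatives and the semigroup property are all read off from Fourier inversion; positivity and
    boundedness come from the two-sided heat kernel bounds. *)

Section ProductSigmaFinite.
Local Open Scope ereal_scope.
Context d1 d2 (T1 : measurableType d1) (T2 : measurableType d2) (R : realType).
Variable m1 : {sigma_finite_measure set T1 -> \bar R}.
Variable m2 : {sigma_finite_measure set T2 -> \bar R}.

(* The library declares a sigma-finite instance on [m1 \x m2] that unification
   cannot reach (it is shadowed by the one for subprobabilities); hence an alias. *)
Definition sprod : set (T1 * T2) -> \bar R := m1 \x m2.

HB.instance Definition _ := Measure.on sprod.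

Let sprod_sigma_finite : sigma_finite setT sprod.
Proof.
have /sigma_finiteP[F [TF ndF Foo]] := sigma_finiteT m1.
have /sigma_finiteP[G [TG ndG Goo]] := sigma_finiteT m2.
exists (fun n => F n `*` G n).
  rewrite -setXTT TF TG predeqE => -[x y]; split; last first.
    by move=> [n _ []/= ? ?]; split; exists n.
  move=> [/= [n _ Fnx] [k _ Gky]]; exists (maxn n k) => //; split.
  - by move: x Fnx; exact/subsetPset/ndF/leq_maxl.
  - by move: y Gky; exact/subsetPset/ndG/leq_maxr.
move=> k; have [? ?] := Foo k; have [? ?] := Goo k.
split; first exact: measurableX.
by rewrite /sprod product_measure1E// lte_mul_pinfty// ge0_fin_numE.
Qed.

HB.instance Definition _ := Measure_isSigmaFinite.Build _ _ _ sprod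
  sprod_sigma_finite.

End ProductSigmaFinite.

Section BorelRow.
Variable R : realType.

Definition rowB (n : nat) := g_sigma_algebraType (@open 'rV[R]_n).

Lemma continuous_rowB n (f : 'rV[R]_n -> R) : continuous f ->
  measurable_fun setT (f : rowB n -> R).
Proof.
move=> /continuousP cf; apply: (measurability _ (RGenOpens.measurableE R)) => _ [_ [a [b ->] <-]].
rewrite setTI; apply: sub_sigma_algebra; apply: cf; exact: interval_open.
Qed.

Lemma measurable_coord n (i : 'I_n) :
  measurable_fun setT (fun v : rowB n => v 0 i).
Proof. apply: continuous_rowB; exact: coord_continuous. Qed.

(** An open set is a countable union of sup-norm boxes with rational centres and radii 1/(m+1), and
    the preimage of a box is described coordinate by coordinate. *)
Lemma measurable_rowP d (T : measurableType d) n (f : T -> rowB n) :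
  (forall i, measurable_fun setT (fun x => f x 0 i)) ->
  measurable_fun setT f.
Proof.
move=> mf.
pose box (q : 'rV[rat]_n) (m : nat) : set 'rV[R]_n :=
  [set v | forall i, `|v 0 i - ratr (q 0 i)| < m.+1%:R^-1].
apply: (measurability _ (erefl (@measurable _ (rowB n)))).
move=> _ [U oU <-]; rewrite setTI.
pose F (p : 'rV[rat]_n * nat) :=
  if `[< box p.1 p.2 `<=` U >] then f @^-1` (box p.1 p.2) else set0.
have -> : f @^-1` U = \bigcup_p F p.
  apply/seteqP; split => x /=; last first.
    by move=> [p _]; rewrite /F; case: asboolP => // pU; exact: pU.
  move=> Ux; have : nbhs (f x : 'rV[R]_n) U by exact: open_nbhs_nbhs.
  move/(@nbhs_ballP _ 'rV[R]_n) => -[e /= e0 eU].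
  (* The centre of the box is within 1/(m+1) of [f x], so twice this radius must fit into the ball
     around [f x]. *)
  have [m em] : exists m : nat, m.+1%:R^-1 * 2 < e.
    exists (Num.truncn (2 / e)).
    have := truncnS_gt (2 / e); rewrite ltr_pdivrMr// => h.
    by rewrite mulrC ltr_pdivrMr// mulrC.
  have m0 : (0 : R) < m.+1%:R^-1 by rewrite invr_gt0.
  have /choice[q qP] : forall i, exists q : rat, `|f x 0 i - ratr q| < m.+1%:R^-1.
    move=> i; have [|q] := @rat_in_itvoo R (f x 0 i - m.+1%:R^-1) (f x 0 i + m.+1%:R^-1).
      by rewrite ltrD2l gtrN.
    rewrite in_itv/= => /andP[q1 q2]; exists q.
    by rewrite ltr_distlC q1.
  exists (\row_i q i, m) => //=; rewrite /F/= asboolT; last first.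
    move=> v /= vq; apply: eU; split => // i j; rewrite ord1 /ball/=.
    have := vq j; have := qP j; rewrite !mxE => h1 h2.
    have -> : f x 0 j - v 0 j = (f x 0 j - ratr (q j)) - (v 0 j - ratr (q j)) by ring.
    rewrite (le_lt_trans (ler_normB _ _))//; apply: lt_trans em.
    by rewrite mulr_natr mulr2n ltrD.
  by move=> i; rewrite mxE.
apply: countable_bigcupT_measurable => // p; rewrite /F; case: ifPn => // _.
rewrite -[X in measurable X]setCK; apply: measurableC.
have -> : ~` (f @^-1` box p.1 p.2) =
    \bigcup_i ~` ((fun x => `|f x 0 i - ratr (p.1 0 i)|) @^-1` `]-oo, p.2.+1%:R^-1[).
  apply/seteqP; split => x /=.
    by move=> /existsNP[i hi]; exists i => //=; rewrite in_itv/=; exact/negP.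
  by move=> [i _] /= hi h; apply: hi; rewrite in_itv/=; exact: h.
apply: countable_bigcupT_measurable => // i; apply: measurableC.
rewrite -[X in measurable X]setTI.
have mg : measurable_fun setT (fun x => `|f x 0 i - ratr (p.1 0 i)|).
  by apply: measurableT_comp => //; exact: measurable_funB.
by apply: mg => //; exact: measurable_itv.
Qed.

(** The same splitting of the first coordinate as in [intRdE] and [intRd]. *)
Definition rcons1 n (p : R * rowB n) : rowB n.+1 := row_mx (\row_(_ < 1) p.1) p.2.
Definition runcons n (v : rowB n.+1) : R * rowB n := (v 0 0, rsubmx (v : 'rV_(1 + n))).

Lemma rcons1_0 n p : @rcons1 n p 0 0 = p.1.
Proof.
rewrite /rcons1; have -> : (0 : 'I_n.+1) = lshift n (0 : 'I_1) by apply: val_inj.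
by apply: (etrans (row_mxEl _ _ _ _)); rewrite mxE.
Qed.

Lemma rcons1_lift n p (i : 'I_n) : @rcons1 n p 0 (lift 0 i) = p.2 0 i.
Proof.
rewrite /rcons1; have -> : lift 0 i = rshift 1 i :> 'I_(1 + n) by apply: val_inj.
exact: row_mxEr.
Qed.

Lemma rcons1K n : cancel (@rcons1 n) (@runcons n).
Proof.
move=> [x v]; rewrite /runcons rcons1_0; congr pair.
by rewrite /rcons1 row_mxKr.
Qed.

Lemma measurable_rcons1 n : measurable_fun setT (@rcons1 n).
Proof.
apply: measurable_rowP => i; case: (unliftP 0 i) => [j ->|->].
  under eq_fun do rewrite rcons1_lift.
  exact: (measurableT_comp (measurable_coord _) (@measurable_snd _ _ _ _)).
under eq_fun do rewrite rcons1_0.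
exact: measurable_fst.
Qed.

Lemma measurable_runcons n : measurable_fun setT (@runcons n).
Proof.
apply/measurable_fun_pairP; split; first exact: measurable_coord.
apply: measurable_rowP => i /=.
under eq_fun do rewrite mxE.
exact: measurable_coord.
Qed.

Section step.
Variables (n : nat) (m : {sigma_finite_measure set (rowB n) -> \bar R}).
Local Open Scope ereal_scope.
Definition muS : set (rowB n.+1) -> \bar R :=
  pushforward (sprod (@lebesgue_measure R) m) (@rcons1 n).

Let muS0 : muS set0 = 0.
Proof. by rewrite /muS /pushforward preimage_set0 measure0. Qed.
Let muS_ge0 A : 0 <= muS A.
Proof. by rewrite /muS /pushforward; exact: measure_ge0. Qed.
Let muS_sigma_additive : semi_sigma_additive muS.
Proof.
move=> F mF tF mUF; rewrite /muS /pushforward preimage_bigcup.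
apply: measure_semi_sigma_additive.
- by move=> k; rewrite -[X in measurable X]setTI; exact: measurable_rcons1.
- apply/trivIsetP => /= i j _ _ ij; rewrite -preimage_setI.
  by move/trivIsetP : tF => /(_ _ _ _ _ ij) ->//; rewrite preimage_set0.
- by rewrite -preimage_bigcup -[X in measurable X]setTI; exact: measurable_rcons1.
Qed.

HB.instance Definition _ := isMeasure.Build _ _ _ muS
  muS0 muS_ge0 muS_sigma_additive.

Let muS_sigma_finite : sigma_finite setT muS.
Proof.
have [F FT Ffin] := sigma_finiteT (sprod (@lebesgue_measure R) m).
exists (fun k => @runcons n @^-1` F k).
  by rewrite -preimage_bigcup -FT preimage_setT.
move=> k; have [mFk Fk] := Ffin k; split.
  by rewrite -[X in measurable X]setTI; exact: measurable_runcons.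
rewrite /muS /pushforward -comp_preimage.
by have -> : @runcons n \o @rcons1 n = id by apply/funext => x /=; rewrite rcons1K.
Qed.

HB.instance Definition _ := Measure_isSigmaFinite.Build _ _ _ muS muS_sigma_finite.
End step.

(** Lebesgue measure, built by the recursion of [intRdE] and [intRd]. It turns the iterated
    integrals of the statement into integrals against one sigma-finite measure, where Fubini and
    dominated convergence apply. *)
Fixpoint leb n : {sigma_finite_measure set (rowB n) -> \bar R} :=
  match n with
  | 0 => [the {sigma_finite_measure set (rowB 0) -> \bar R} of dirac ((0 : 'rV[R]_0) : rowB 0)]
  | n'.+1 => [the {sigma_finite_measure set (rowB n'.+1) -> \bar R} of muS (leb n')]
  end.

Lemma ge0_integral_leb0 (f : rowB 0 -> \bar R) : measurable_fun setT f ->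
  (\int[leb 0]_v f v = f (0%R : 'rV[R]_0))%E.
Proof. by move=> mf; rewrite /= integral_dirac// diracT mul1e. Qed.

Lemma ge0_integral_lebS n (f : rowB n.+1 -> \bar R) :
  measurable_fun setT f -> (forall v, 0 <= f v)%E ->
  (\int[leb n.+1]_v f v = \int[@lebesgue_measure R]_x \int[leb n]_v f (rcons1 (x, v)))%E.
Proof.
move=> mf f0; rewrite [LHS]ge0_integral_pushforward//=; last exact: measurable_rcons1.
rewrite preimage_setT.
apply: (@fubini_tonelli1 _ _ (measurableTypeR R) _ R (@lebesgue_measure R)
  (leb n) (f \o @rcons1 n)) => //.
  by apply: measurableT_comp => //; exact: measurable_rcons1.
by move=> x; exact: f0.
Qed.

Lemma intRdE_leb n (f : rowB n -> \bar R) :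
  measurable_fun setT f -> (forall v, 0 <= f v)%E ->
  intRdE f = (\int[leb n]_v f v)%E.
Proof.
elim: n f => [|n ih] f mf f0; first by rewrite ge0_integral_leb0.
rewrite ge0_integral_lebS//=; apply: eq_integral => x _.
apply: (ih (fun v => f (rcons1 (x, v)))) => //.
apply: measurableT_comp => //.
exact: (measurableT_comp (@measurable_rcons1 n) (@measurable_pair1 _ _ _ _ x)).
Qed.

End BorelRow.

Section RintegralProduct.
Context d1 d2 (T1 : measurableType d1) (T2 : measurableType d2) (R : realType).

(** The extended integral is a difference of two Tonelli integrals, each measurable in the
    parameter, and [fine] is measurable. The values at parameters where the slice is not integrable
    are thus covered as well. *)
Lemma measurable_Rintegral (m2 : {sigma_finite_measure set T2 -> \bar R})
    (f : T1 * T2 -> R) : measurable_fun setT f ->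
  measurable_fun setT (fun x => \int[m2]_y f (x, y)).
Proof.
move=> mf.
have mg : measurable_fun setT (fun x => \int[m2]_y (f (x, y))%:E)%E.
  rewrite (_ : (fun x => _) = (fun x => \int[m2]_y ((EFin \o f)^\+ (x, y)) -
      \int[m2]_y ((EFin \o f)^\- (x, y)))%E); last first.
    apply/funext => x; rewrite integralE; congr (_ - _)%E.
      by apply: eq_integral => y _; rewrite !funeposE.
    by apply: eq_integral => y _; rewrite !funenegE.
  apply: emeasurable_funB.
    apply: (@measurable_fun_fubini_tonelli_F _ _ T1 T2 R m2 ((EFin \o f)^\+)%E) => //.
    by apply: measurable_funepos; exact/measurable_EFinP.
  apply: (@measurable_fun_fubini_tonelli_F _ _ T1 T2 R m2 ((EFin \o f)^\-)%E) => //.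
  by apply: measurable_funeneg; exact/measurable_EFinP.
exact: (measurableT_comp (fine_measurable measurableT) mg).
Qed.

Variable m1 : {sigma_finite_measure set T1 -> \bar R}.
Variable m2 : {sigma_finite_measure set T2 -> \bar R}.

(** [fine] sends infinite values to 0; for an integrable function this changes it on a null set
    only. *)
Lemma Rintegral_fine (f : T1 -> \bar R) : m1.-integrable setT f ->
  \int[m1]_x fine (f x) = fine (\int[m1]_x f x).
Proof.
move=> intf; congr fine; apply: ae_eq_integral => //.
- apply/measurable_EFinP; apply: (measurableT_comp (fine_measurable measurableT)).
  exact: measurable_int intf.
- exact: measurable_int intf.
- have := integrable_ae measurableT intf; apply: filterS => x /= h _.
  by rewrite fineK// h.
Qed.

Lemma Rintegral_sprod1 (f : T1 * T2 -> R) :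
  (sprod m1 m2).-integrable setT (EFin \o f) ->
  \int[m1]_x \int[m2]_y f (x, y) = \int[sprod m1 m2]_z f z.
Proof.
move=> intf.
have -> := Rintegral_fine (integrable_fubini_F intf).
by congr fine; exact: (integral12_prod_meas1 intf).
Qed.

End RintegralProduct.

Lemma Rintegral_sprod2 d1 d2 (T1 : measurableType d1) (T2 : measurableType d2)
    (R : realType) (m1 : {sigma_finite_measure set T1 -> \bar R})
    (m2 : {sigma_finite_measure set T2 -> \bar R}) (f : T1 * T2 -> R) :
  (sprod m1 m2).-integrable setT (EFin \o f) ->
  \int[m2]_y \int[m1]_x f (x, y) = \int[sprod m1 m2]_z f z.
Proof.
move=> intf.
have mf := measurable_int _ intf.
pose sf := f \o (fun z : T2 * T1 => (z.2, z.1)).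
have intsf : (sprod m2 m1).-integrable setT (EFin \o sf).
  apply/integrable12ltyP.
    apply: (@measurableT_comp _ _ _ _ _ _ (EFin \o f)) => //.
    by apply: measurable_fun_pair.
  by move/integrable21ltyP : intf; exact.
have -> := Rintegral_fine (integrable_fubini_F intsf).
by congr fine; exact: (integral21_prod_meas1 intf).
Qed.

Section intRd_leb.
Variable R : realType.

(** The parameter space varies in the induction on [n]: the coordinate split off joins it. *)
Lemma measurable_intRd n d (T : measurableType d) (f : T * rowB R n -> R) :
  measurable_fun setT f ->
  measurable_fun setT (fun t => intRd (fun v => f (t, v))).
Proof.
elim: n d T f => [|n ih] d T f mf /=.
  exact: (@measurable_fun_pair1 _ _ _ T (rowB R 0)).
apply: (@measurable_Rintegral _ _ T (measurableTypeR R) R (@lebesgue_measure R)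
  (fun z => intRd (fun v => f (z.1, rcons1 (z.2, v))))).
apply: (ih _ _ (fun w : (T * measurableTypeR R) * rowB R n =>
  f (w.1.1, rcons1 (w.1.2, w.2)))).
apply: measurableT_comp => //; apply: measurable_fun_pair.
  exact: measurableT_comp.
apply: measurableT_comp; first exact: measurable_rcons1.
apply: measurable_fun_pair => //.
exact: measurableT_comp.
Qed.

Lemma integrable_rcons1 n (f : rowB R n.+1 -> R) :
  (leb R n.+1).-integrable setT (EFin \o f) ->
  (sprod (@lebesgue_measure R) (leb R n)).-integrable setT (EFin \o (f \o @rcons1 R n)).
Proof.
move=> /integrableP[mf fin]; apply/integrableP; split.
  exact: (measurableT_comp mf (@measurable_rcons1 R n)).
move: fin; rewrite [X in (X < _)%E -> _]ge0_integral_pushforward//=.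
- exact: measurable_rcons1.
exact: (measurableT_comp (@abse_measurable R setT) mf).
Qed.

Lemma Rintegral_lebS n (f : rowB R n.+1 -> R) :
  (leb R n.+1).-integrable setT (EFin \o f) ->
  \int[leb R n.+1]_v f v =
  \int[sprod (@lebesgue_measure R) (leb R n)]_z f (rcons1 z).
Proof.
move=> intf; congr fine; have intf' := integrable_rcons1 intf.
case/integrableP: (intf) => mf _.
by rewrite [LHS]integral_pushforward//=; exact: measurable_rcons1.
Qed.

(** Only almost every slice is integrable. On the others the inner [intRd] may differ from the
    integral, so the two functions of the first coordinate are compared almost everywhere, which is
    why their measurability is established first. *)
Lemma intRd_leb n (f : rowB R n -> R) :
  (leb R n).-integrable setT (EFin \o f) ->
  intRd f = \int[leb R n]_v f v.
Proof.
elim: n f => [|n ih] f intf.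
  case/integrableP: (intf) => mf _.
  by rewrite /Rintegral/= integral_dirac//= ?indicT/= ?mul1r; rewrite ?diracE ?in_setT ?mul1e.
rewrite Rintegral_lebS// -(Rintegral_sprod1 (integrable_rcons1 intf)) /=.
congr fine; apply: ae_eq_integral => //.
- apply/measurable_EFinP.
  apply: (@measurable_intRd _ _ (measurableTypeR R) (fun z => f (rcons1 z))).
  case/integrableP: (integrable_rcons1 intf) => mf _; exact/measurable_EFinP.
- apply/measurable_EFinP.
  apply: (@measurable_Rintegral _ _ (measurableTypeR R) _ _ (leb R n) (fun z => f (rcons1 z))).
  case/integrableP: (integrable_rcons1 intf) => mf _; exact/measurable_EFinP.
- have := ae_integrable1 (integrable_rcons1 intf).
  by apply: filterS => x /= h _; congr EFin; exact: (ih (fun v => f (rcons1 (x, v)))).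
Qed.

End intRd_leb.

Section Lebesgue1.
Variable R : realType.
Local Notation leb1 := (@lebesgue_measure R).

Lemma lebesgue_measure_shift (c : R) (A : set R) : measurable A ->
  pushforward leb1 ((fun x => x + c) : _ -> measurableTypeR R) A = leb1 A.
Proof.
have mc : measurable_fun setT ((fun x => x + c) : R -> measurableTypeR R).
  exact: measurable_funD.
move=> mA; apply/esym/lebesgue_measure_unique => //= _ [[a b]] _ <-.
rewrite /pushforward.
have -> : (fun x : R => x + c) @^-1` `]a, b]%classic = `](a - c), (b - c)]%classic.
  apply/seteqP; split => x /=; rewrite !in_itv/= ltrBlDr lerBrDr//.
rewrite !lebesgue_measure_itv/= !lte_fin ltrD2r; case: ifPn => // _.
by rewrite -!EFinD; congr EFin; ring.
Qed.

Lemma ge0_integral_shift1 (f : R -> \bar R) (c : R) :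
  measurable_fun setT f -> (forall x, 0 <= f x)%E ->
  (\int[leb1]_x f (x + c)%R = \int[leb1]_x f x)%E.
Proof.
move=> mf f0.
have mc : measurable_fun setT ((fun x => x + c) : R -> measurableTypeR R).
  exact: measurable_funD.
rewrite -(preimage_setT (fun x => x + c)).
rewrite -[LHS](@ge0_integral_pushforward _ _ (measurableTypeR R) (measurableTypeR R) R _ mc leb1 setT f)//.
by apply: eq_measure_integral => //= A mA AS; exact: lebesgue_measure_shift.
Qed.

Lemma ge0_integral_opp1 (f : R -> \bar R) :
  measurable_fun setT f -> (forall x, 0 <= f x)%E ->
  (\int[leb1]_x f (- x)%R = \int[leb1]_x f x)%E.
Proof.
move=> mf f0.
have mc : measurable_fun setT (-%R : R -> measurableTypeR R) by [].
rewrite -(preimage_setT (fun x => - x)).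
rewrite -[LHS](@ge0_integral_pushforward _ _ (measurableTypeR R) (measurableTypeR R) R _ mc leb1 setT f)//.
by apply: eq_measure_integral => //= A mA AS; exact: lebesgue_measureN.
Qed.

End Lebesgue1.

Section LebesgueRow.
Variable R : realType.
Local Notation leb1 := (@lebesgue_measure R).
Local Notation rowB := (rowB R).
Local Notation leb := (leb R).

Definition rshift n (x : 'rV[R]_n) (z : rowB n) : rowB n := (z : 'rV[R]_n) + x.
Definition ropp n (z : rowB n) : rowB n := - (z : 'rV[R]_n).

Lemma rshiftE n x (z : rowB n) i : rshift x z 0 i = z 0 i + x 0 i.
Proof. by rewrite /rshift mxE. Qed.

Lemma roppE n (z : rowB n) i : ropp z 0 i = - z 0 i.
Proof. by rewrite /ropp mxE. Qed.

Lemma measurable_rshift n x : measurable_fun setT (@rshift n x).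
Proof.
apply: measurable_rowP => i; under eq_fun do rewrite rshiftE.
by apply: measurable_funD => //; exact: measurable_coord.
Qed.

Lemma measurable_ropp n : measurable_fun setT (@ropp n).
Proof.
apply: measurable_rowP => i; under eq_fun do rewrite roppE.
by apply: measurableT_comp => //; exact: measurable_coord.
Qed.

Lemma rcons1E n (v w : rowB n.+1) : v 0 0 = w 0 0 ->
  (forall i, v 0 (lift 0 i) = w 0 (lift 0 i)) -> v = w.
Proof. by move=> h0 hS; apply/rowP => i; case: (unliftP 0 i) => [j ->|->]. Qed.

Lemma measurable_rcons1_slice n (x : R) :
  measurable_fun setT (fun v : rowB n => rcons1 (x, v)).
Proof.
exact: (@measurable_fun_pair2 _ _ _ (measurableTypeR R) (rowB n) (rowB n.+1)
  (@rcons1 R n) x (@measurable_rcons1 R n)).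
Qed.

Lemma ge0_integral_rshift n (f : rowB n -> \bar R) x :
  measurable_fun setT f -> (forall z, 0 <= f z)%E ->
  (\int[leb n]_z f (rshift x z) = \int[leb n]_z f z)%E.
Proof.
elim: n f x => [|n ih] f x mf f0.
  rewrite !ge0_integral_leb0//; last exact: (measurableT_comp mf (measurable_rshift x)).
  by congr f; apply/rowP => -[].
rewrite !ge0_integral_lebS//; last first.
  exact: (measurableT_comp mf (measurable_rshift x)).
transitivity (\int[leb1]_u \int[leb n]_v f (rcons1 ((u + x 0 0)%R, v)))%E; last first.
  apply: (ge0_integral_shift1 (f := fun u => \int[leb n]_v f (rcons1 (u, v)))%E).
    apply: (@measurable_fun_fubini_tonelli_F _ _ (measurableTypeR R) _ R (leb n)
      (fun z => f (rcons1 z))) => //.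
    exact: (measurableT_comp mf (@measurable_rcons1 R n)).
  by move=> u; apply: integral_ge0.
apply: eq_integral => u _.
rewrite -[RHS](ih (fun v => f (rcons1 ((u + x 0 0)%R, v))) (\row_i x 0 (lift 0 i)))//.
  apply: eq_integral => v _; congr f; apply: rcons1E => [|i].
    by rewrite rshiftE !rcons1_0.
  by rewrite rshiftE !rcons1_lift/= rshiftE mxE.
exact: (measurableT_comp mf (@measurable_rcons1_slice n _)).
Qed.

Lemma ge0_integral_ropp n (f : rowB n -> \bar R) :
  measurable_fun setT f -> (forall z, 0 <= f z)%E ->
  (\int[leb n]_z f (ropp z) = \int[leb n]_z f z)%E.
Proof.
elim: n f => [|n ih] f mf f0.
  rewrite !ge0_integral_leb0//; last exact: (measurableT_comp mf (@measurable_ropp _)).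
  by congr f; apply/rowP => -[].
rewrite !ge0_integral_lebS//; last first.
  exact: (measurableT_comp mf (@measurable_ropp _)).
transitivity (\int[leb1]_u \int[leb n]_v f (rcons1 ((- u)%R, v)))%E; last first.
  apply: (ge0_integral_opp1 (f := fun u => \int[leb n]_v f (rcons1 (u, v)))%E).
    apply: (@measurable_fun_fubini_tonelli_F _ _ (measurableTypeR R) _ R (leb n)
      (fun z => f (rcons1 z))) => //.
    exact: (measurableT_comp mf (@measurable_rcons1 R n)).
  by move=> u; apply: integral_ge0.
apply: eq_integral => u _.
rewrite -[RHS](ih (fun v => f (rcons1 ((- u)%R, v))))//.
  apply: eq_integral => v _; congr f; apply: rcons1E => [|i].
    by rewrite roppE !rcons1_0.
  by rewrite roppE !rcons1_lift/= roppE.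
exact: (measurableT_comp mf (@measurable_rcons1_slice n _)).
Qed.

Lemma integral_rsub n (f : rowB n -> \bar R) (x : 'rV[R]_n) : measurable_fun setT f ->
  (\int[leb n]_z f (x - (z : 'rV[R]_n))%R = \int[leb n]_z f z)%E.
Proof.
move=> mf.
have key (g : rowB n -> \bar R) : measurable_fun setT g -> (forall z, 0 <= g z)%E ->
    (\int[leb n]_z g (x - (z : 'rV[R]_n))%R = \int[leb n]_z g z)%E.
  move=> mg g0; rewrite -(ge0_integral_rshift x mg)//.
  rewrite -(@ge0_integral_ropp _ (fun z => g (rshift x z)))//.
    by apply: eq_integral => z _; rewrite /rshift /ropp addrC.
  exact: (measurableT_comp mg (measurable_rshift x)).
rewrite integralE [RHS]integralE; congr (_ - _)%E.
  rewrite -[RHS]key//; last exact: measurable_funepos.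
  by apply: eq_integral => z _; rewrite !funeposE.
rewrite -[RHS]key//; last exact: measurable_funeneg.
by apply: eq_integral => z _; rewrite !funenegE.
Qed.

Lemma integral_prod n (g : R -> R) (c : R) : measurable_fun setT g ->
  (forall x, 0 <= g x) -> (\int[leb1]_x (g x)%:E = c%:E)%E ->
  (\int[leb n]_z (\prod_(i < n) g (z 0 i))%:E = (c ^+ n)%:E)%E.
Proof.
move=> mg g0 gc.
have mP m : measurable_fun setT (fun z : rowB m => (\prod_(i < m) g (z 0 i))).
  by apply: measurable_prod => i _; apply: measurableT_comp => //; exact: measurable_coord.
elim: n => [|n ih].
  rewrite ge0_integral_leb0 ?big_ord0//; exact/measurable_EFinP.
rewrite ge0_integral_lebS//; last 2 first.
- exact/measurable_EFinP.
- by move=> v; rewrite lee_fin prodr_ge0.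
transitivity (\int[leb1]_x ((g x)%:E * (c ^+ n)%:E))%E.
  apply: eq_integral => x _; rewrite -ih -ge0_integralZl//.
  - apply: eq_integral => v _; rewrite big_ord_recl rcons1_0 EFinM; congr (_ * _)%E.
    by congr EFin; apply: eq_bigr => i _; rewrite rcons1_lift.
  - exact/measurable_EFinP.
  - by move=> v _; rewrite lee_fin prodr_ge0.
  - by rewrite lee_fin.
rewrite ge0_integralZr//; last 3 first.
- exact/measurable_EFinP.
- by move=> x _; rewrite lee_fin.
- by rewrite lee_fin exprn_ge0// -lee_fin -gc integral_ge0// => x _; rewrite lee_fin.
by rewrite gc -EFinM exprS.
Qed.

(** The point lies in the null hyperplane fixed by its first coordinate. In dimension 0, [leb] is a
    Dirac mass. *)
Lemma ae_neq0 n (y : 'rV[R]_n) : (0 < n)%N -> {ae leb n, forall z : rowB n, z != y}.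
Proof.
case: n y => // n y _.
pose A := [set z : rowB n.+1 | z 0 0 = y 0 0].
have mA : measurable A.
  by rewrite -[A]setTI; exact: (@measurable_coord R n.+1 0 measurableT [set y 0 0]).
exists A; split => //.
  have -> : leb n.+1 A = sprod leb1 (leb n) ([set y 0 0] `*` setT).
    rewrite /= /muS /pushforward; congr (sprod _ _ _).
    by apply/seteqP; split => -[u v]; rewrite /A/= rcons1_0 //= => -[].
  rewrite /sprod product_measure1E//.
  apply: (etrans (congr1 (fun w => w * leb n setT)%E (lebesgue_measure_set1 (y 0 0)))); exact: mul0e.
by move=> z /= /negP; rewrite negbK => /eqP ->.
Qed.

End LebesgueRow.

(** * Integration and Fourier transform of Gaussians *)

Section Tools.
Context d (T : measurableType d) (R : realType).

(** The formula x^-1 = x (x^2)^-1 reduces inversion to a power of a nonnegative number, and remains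
    true at 0. *)
Lemma measurable_invr (D : set R) : measurable_fun D (@GRing.inv R).
Proof.
apply: measurable_funTS.
rewrite (_ : GRing.inv = fun x : R => x * (x ^+ 2) `^ (-1)).
  apply: measurable_funM => //.
  by apply: (measurableT_comp (@measurable_powR R (-1))); exact: measurable_funX.
apply/funext => x; rewrite powR_inv1 ?sqr_ge0//.
have [->|x0] := eqVneq x 0; first by rewrite invr0 mul0r.
by rewrite -exprVn expr2 mulrA divff// mul1r.
Qed.

Lemma measurable_sqrt (D : set R) : measurable_fun D (@Num.sqrt R).
Proof. by apply: measurable_funTS; apply: continuous_measurable_fun; exact: sqrt_continuous. Qed.

Lemma measurable_cos (D : set R) : measurable_fun D (@cos R).
Proof. by apply: measurable_funTS; apply: continuous_measurable_fun; exact: continuous_cos. Qed.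

Lemma measurable_sin (D : set R) : measurable_fun D (@sin R).
Proof. by apply: measurable_funTS; apply: continuous_measurable_fun; exact: continuous_sin. Qed.

End Tools.

Ltac mfun := repeat match goal with
  | |- is_true true => exact: isT
  | H : measurable_fun _ _ |- _ => exact: H
  | |- measurable_fun _ (fun x => x) => exact: measurable_id
  | |- measurable_fun _ (fun x => ?c) => exact: measurable_cst
  | |- measurable_fun _ (fun x => fst x) => exact: measurable_fst
  | |- measurable_fun _ (fun x => snd x) => exact: measurable_snd
  | |- measurable_fun _ (fun x => (@?f x) + (@?g x)) => apply: measurable_funD
  | |- measurable_fun _ (fun x => (@?f x) * (@?g x)) => apply: measurable_funM
  | |- measurable_fun _ (fun x => - (@?f x)) => apply: (measurableT_comp (@oppr_measurable _ setT))
  | |- measurable_fun _ (fun x => (@?f x) ^-1) => apply: (measurableT_comp (@measurable_invr _ setT))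
  | |- measurable_fun _ (fun x => `|@?f x|) => apply: (measurableT_comp (@normr_measurable _ setT))
  | |- measurable_fun _ (fun x => (@?f x) ^+ _) => apply: measurable_funX
  | |- measurable_fun _ (fun x => expR (@?f x)) => apply: (measurableT_comp (@measurable_expR _))
  | |- measurable_fun _ (fun x => cos (@?f x)) => apply: (measurableT_comp (@measurable_cos _ setT))
  | |- measurable_fun _ (fun x => sin (@?f x)) => apply: (measurableT_comp (@measurable_sin _ setT))
  | |- measurable_fun _ (fun x => Num.sqrt (@?f x)) => apply: (measurableT_comp (@measurable_sqrt _ setT))
  | |- measurable_fun _ (fun x => (@?f x) `^ _) => apply: (measurableT_comp (@measurable_powR _ _))
  | |- measurable_fun _ snd => exact: measurable_snd
  | |- measurable_fun _ fst => exact: measurable_fst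
  | |- measurable_fun _ (GRing.mul _) => exact: mulrl_measurable
  | |- measurable_fun _ (fun x => (@?f x, @?g x)) => apply: measurable_fun_pair
  | |- measurable_fun _ (fun x => \sum_(i <- _) @?f i x) => apply: measurable_sum => ?
  | |- measurable_fun _ (fun x => \prod_(i <- _) @?f i x) => apply: measurable_prod => ? ?
  | |- measurable_fun _ (fun x => fst (@?f x)) => apply: (measurableT_comp (@measurable_fst _ _ _ _))
  | |- measurable_fun _ (fun x => snd (@?f x)) => apply: (measurableT_comp (@measurable_snd _ _ _ _))
  | |- measurable_fun _ (fun x => (fun_of_matrix (@?f x) 0 ?i)) => apply: (measurableT_comp (measurable_coord i))
  | |- measurable_fun _ (fun x => (@?f x)%:E) => apply/measurable_EFinP
  | |- measurable_fun _ (EFin \o _) => apply/measurable_EFinP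
  end.

Section Domination.
Context d (T : measurableType d) (R : realType) (m : {measure set T -> \bar R}).

Lemma integrable_dom (f g : T -> R) : measurable_fun setT f ->
  (forall x, `|f x| <= g x) -> m.-integrable setT (EFin \o g) ->
  m.-integrable setT (EFin \o f).
Proof.
move=> mf fg; apply: le_integrable => //; first exact/measurable_EFinP.
by move=> x _; rewrite /= lee_fin (le_trans (fg x))// ler_norm.
Qed.

Lemma ge0_integrable (f : T -> R) : measurable_fun setT f -> (forall x, 0 <= f x) ->
  (\int[m]_x (f x)%:E < +oo)%E -> m.-integrable setT (EFin \o f).
Proof.
move=> mf f0 fin; apply/integrableP; split; first exact/measurable_EFinP.
by under eq_integral => x _ do rewrite /= ger0_norm//.
Qed.

Lemma integrable_scale k (f : T -> R) : m.-integrable setT (EFin \o f) ->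
  m.-integrable setT (EFin \o (fun x => k * f x)).
Proof. by move=> fi; exact: (integrableZl measurableT k fi). Qed.

Lemma integrable_add (f g : T -> R) : m.-integrable setT (EFin \o f) ->
  m.-integrable setT (EFin \o g) -> m.-integrable setT (EFin \o (fun x => f x + g x)).
Proof. by move=> fi gi; exact: (integrableD measurableT fi gi). Qed.

Lemma integrable_sub (f g : T -> R) : m.-integrable setT (EFin \o f) ->
  m.-integrable setT (EFin \o g) -> m.-integrable setT (EFin \o (fun x => f x - g x)).
Proof. by move=> fi gi; exact: (integrableB measurableT fi gi). Qed.

Lemma RintZ k (f : T -> R) : m.-integrable setT (EFin \o f) ->
  \int[m]_x (k * f x) = k * \int[m]_x f x.
Proof. by move=> fi; rewrite RintegralZl. Qed.

Lemma norm_Rintegral_le (f g : T -> R) : measurable_fun setT f ->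
  (forall x, `|f x| <= g x) -> m.-integrable setT (EFin \o g) ->
  `|\int[m]_x f x| <= \int[m]_x g x.
Proof.
move=> mf fg ig; have fi := integrable_dom mf fg ig.
apply: le_trans (le_normr_Rintegral _ fi) _ => //.
apply: le_Rintegral => //.
exact: (integrable_abse fi).
Qed.

Lemma Rintegral_dcvg (f_ : nat -> T -> R) (f g : T -> R) :
  (forall n, measurable_fun setT (f_ n)) -> measurable_fun setT f ->
  (forall x, f_ ^~ x @ \oo --> f x) -> m.-integrable setT (EFin \o g) ->
  (forall n x, `|f_ n x| <= g x) ->
  (\int[m]_x f_ n x) @[n --> \oo] --> \int[m]_x f x.
Proof.
move=> mf_ mf ff ig fg.
have fi : m.-integrable setT (EFin \o f).
  apply: (integrable_dom mf _ ig) => x.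
  have cv : `|f_ n x| @[n --> \oo] --> `|f x| by apply: cvg_norm; exact: ff.
  rewrite -(cvg_lim _ cv)//; apply: limr_le; first by apply/cvg_ex; eexists; exact: cv.
  by apply: nearW => n.
apply: fine_cvg; rewrite fineK; last exact: integrable_fin_num.
apply: (@dominated_cvg _ _ _ m _ _ (fun n x => (f_ n x)%:E) _ (EFin \o g)) => //.
- by move=> n; exact/measurable_EFinP.
- by move=> x _; apply: cvg_EFin; [exact: nearW|exact: ff].
- by move=> n x _; rewrite /= lee_fin.
Qed.

End Domination.

Section Gauss1.
Variable R : realType.
Local Notation leb1 := (@lebesgue_measure R).

Lemma integral_gauss1 (s : R) : 0 < s ->
  (\int[leb1]_x (expR (- s * x ^+ 2))%:E = (Num.sqrt (pi / s))%:E)%E.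
Proof.
move=> s0; pose sg : R := Num.sqrt (s^-1 / 2).
have s2 : sg ^+ 2 = s^-1 / 2 by rewrite sqr_sqrtr// divr_ge0// invr_ge0 ltW.
have sg0 : 0 < sg by rewrite sqrtr_gt0 divr_gt0// invr_gt0.
have sgn0 : sg != 0 by rewrite gt_eqF.
have E x : expR (- s * x ^+ 2) = (normal_peak sg)^-1 * normal_pdf 0 sg x.
  rewrite normal_pdfE// mulrA mulVf ?mul1r; last by rewrite gt_eqF// normal_peak_gt0.
  rewrite /normal_fun s2 subr0; congr expR.
  by rewrite -mulr_natr; field; rewrite gt_eqF.
under eq_integral do rewrite E EFinM.
rewrite ge0_integralZl//; last 3 first.
- by apply/measurable_EFinP; exact: measurable_normal_pdf.
- by move=> x _; rewrite lee_fin normal_pdf_ge0.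
- by rewrite lee_fin invr_ge0 normal_peak_ge0.
rewrite integral_normal_pdf mule1; congr EFin.
rewrite /normal_peak invrK; congr Num.sqrt; rewrite s2 -mulr_natr; field; rewrite gt_eqF//.
Qed.

Lemma integrable_gauss1 (s : R) : 0 < s ->
  leb1.-integrable setT (EFin \o (fun x : R => expR (- s * x ^+ 2))).
Proof.
move=> s0; apply: ge0_integrable; first by mfun.
  by move=> x; exact: expR_ge0.
by rewrite integral_gauss1// ltry.
Qed.

End Gauss1.

Section DerivativeRules.
Variable R : realType.
Implicit Types (f g : R -> R) (x df dg c : R).

Lemma der_ext f g x df : (forall y, f y = g y) -> is_derive x 1 f df -> is_derive x 1 g df.
Proof. by move=> fg; have -> : f = g by apply/funext. Qed.

Lemma der_cst c x : is_derive x 1 (fun=> c) 0.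
Proof. exact: is_derive_cst. Qed.

Lemma der_id x : is_derive x 1 (fun y : R => y) 1.
Proof. exact: is_derive_id. Qed.

Lemma der_add f g x df dg : is_derive x 1 f df -> is_derive x 1 g dg ->
  is_derive x 1 (fun y => f y + g y) (df + dg).
Proof. by move=> *; exact: is_deriveD. Qed.

Lemma der_opp f x df : is_derive x 1 f df -> is_derive x 1 (fun y => - f y) (- df).
Proof. by move=> *; exact: is_deriveN. Qed.

Lemma der_mul f g x df dg : is_derive x 1 f df -> is_derive x 1 g dg ->
  is_derive x 1 (fun y => f y * g y) (df * g x + f x * dg).
Proof.
move=> hf hg; have -> : df * g x + f x * dg = f x *: dg + g x *: df.
  by rewrite addrC [df * _]mulrC.
exact: is_deriveM.
Qed.

Lemma der_sqr f x df : is_derive x 1 f df -> is_derive x 1 (fun y => f y ^+ 2) (2 * f x * df).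
Proof.
move=> hf; have -> : 2 * f x * df = df * f x + f x * df by ring.
by apply: (der_ext (f := fun y => f y * f y)); [move=> y; rewrite expr2|exact: der_mul].
Qed.

Lemma der_expR f x df : is_derive x 1 f df ->
  is_derive x 1 (fun y => expR (f y)) (expR (f x) * df).
Proof. by move=> hf; exact: (@is_derive1_comp _ expR f). Qed.

Lemma der_sin f x df : is_derive x 1 f df ->
  is_derive x 1 (fun y => sin (f y)) (cos (f x) * df).
Proof. by move=> hf; exact: (@is_derive1_comp _ sin f). Qed.

Lemma der_cos f x df : is_derive x 1 f df ->
  is_derive x 1 (fun y => cos (f y)) (- sin (f x) * df).
Proof. by move=> hf; exact: (@is_derive1_comp _ cos f). Qed.

Lemma der_powR f x df c : 0 < f x -> is_derive x 1 f df ->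
  is_derive x 1 (fun y => f y `^ c) (c * f x `^ (c - 1) * df).
Proof.
move=> f0 hf; exact: (@is_derive1_comp _ (fun a => a `^ c) f x _ _ (is_derive1_powR c f0) hf).
Qed.

Lemma der_inv f x df : f x != 0 -> is_derive x 1 f df ->
  is_derive x 1 (fun y => (f y)^-1) (- (f x) ^- 2 * df).
Proof.
move=> f0 hf; exact: (is_deriveV f0 hf).
Qed.

Lemma der_eq f x df df' : is_derive x 1 f df -> df = df' -> is_derive x 1 f df'.
Proof. by move=> h <-. Qed.

Lemma der_continuous f (f' : R -> R) : (forall x : R, is_derive x 1 f (f' x)) -> continuous f.
Proof. by move=> hf x; apply: differentiable_continuous; apply/derivable1_diffP; case: (hf x). Qed.

Lemma der_derive1 f x df : is_derive x 1 f df -> derive1 f x = df.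
Proof. by move=> [h1 h2]; rewrite derive1E. Qed.

End DerivativeRules.

(** [is_derive] is a type class. With instance search switched off, the premises stay goals for this
    syntactic recursion, and the side conditions of powers and inverses are left to the caller. *)
Ltac der := repeat match goal with
  | H : is_derive ?x _ ?f _ |- is_derive ?x _ ?f _ => exact: H
  | |- is_derive _ _ (fun y => y) _ => exact: der_id
  | |- is_derive _ _ (fun y => ?c) _ => exact: der_cst
  | |- is_derive _ _ (fun y => @?f y + @?g y) _ =>
      notypeclasses refine (der_add (f := f) (g := g) _ _)
  | |- is_derive _ _ (fun y => - (@?f y)) _ =>
      notypeclasses refine (der_opp (f := f) _)
  | |- is_derive _ _ (fun y => @?f y * @?g y) _ =>
      notypeclasses refine (der_mul (f := f) (g := g) _ _)
  | |- is_derive _ _ (fun y => (@?f y) ^+ 2) _ =>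
      notypeclasses refine (der_sqr (f := f) _)
  | |- is_derive _ _ (fun y => expR (@?f y)) _ =>
      notypeclasses refine (der_expR (f := f) _)
  | |- is_derive _ _ (fun y => sin (@?f y)) _ =>
      notypeclasses refine (der_sin (f := f) _)
  | |- is_derive _ _ (fun y => cos (@?f y)) _ =>
      notypeclasses refine (der_cos (f := f) _)
  | |- is_derive _ _ (fun y => (@?f y) `^ _) _ =>
      notypeclasses refine (der_powR (f := f) _ _ _)
  | |- is_derive _ _ (fun y => (@?f y)^-1) _ =>
      notypeclasses refine (der_inv (f := f) _ _)
  end.

Ltac eder := notypeclasses refine (der_eq (df := _) _ _); [der|].

Section WholeLine.
Variable R : realType.
Local Notation leb1 := (@lebesgue_measure R).

(** The fundamental theorem on the intervals [-n-1, n+1], followed by dominated convergence; decay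
    of [h] along the integers is then enough. *)
Lemma integral_derive_eq0 (h h' : R -> R) :
  (forall x : R, is_derive x 1 h (h' x)) -> continuous h' ->
  leb1.-integrable setT (EFin \o h') ->
  h n%:R @[n --> \oo] --> 0 -> h (- n%:R) @[n --> \oo] --> 0 ->
  \int[leb1]_x h' x = 0.
Proof.
move=> dh ch ih hp hn.
have mh' : measurable_fun setT h' by exact: continuous_measurable_fun.
pose f_ n (x : R) := h' x * \1_(`[(- n.+1%:R : R), n.+1%:R]%classic) x.
have fE n : \int[leb1]_x f_ n x = h n.+1%:R - h (- n.+1%:R).
  have n0 : (- n.+1%:R : R) < n.+1%:R by rewrite -subr_gt0 opprK -natrD ltr0n.
  have cf : {within `[(- n.+1%:R : R), n.+1%:R], continuous h'}.
    exact: continuous_subspaceT.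
  have dF : derivable_oo_LRcontinuous h (- n.+1%:R) n.+1%:R.
    split.
    + by move=> x _; case: (dh x).
    + by apply: cvg_at_right_filter; exact: (der_continuous dh).
    + by apply: cvg_at_left_filter; exact: (der_continuous dh).
  have E := continuous_FTC2 n0 cf dF (fun x _ => der_derive1 (dh x)).
  rewrite -EFinB in E.
  rewrite /Rintegral -[RHS]/(fine (h n.+1%:R - h (- n.+1%:R))%:E) -E [in RHS]integral_mkcond; congr fine.
  apply: eq_integral => x _; rewrite /f_ patchE indicE.
  by case: ifPn => _; rewrite ?mulr1 ?mulr0.
have cv : (\int[leb1]_x f_ n x) @[n --> \oo] --> \int[leb1]_x h' x.
  apply: (@Rintegral_dcvg _ (measurableTypeR R) R leb1 _ _ (fun x => `|h' x|)) => //.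
  - move=> n; apply: measurable_funM => //; exact: measurable_indic.
  - move=> x; apply: cvg_near_cst; near=> n.
    rewrite /f_ indicE mem_set ?mulr1//= in_itv/= -ler_norml.
    have : ((Num.truncn `|x|).+1 <= n.+1)%N by rewrite ltnS; near: n; exact: nbhs_infty_ge.
    rewrite -(ler_nat R); apply: le_trans; exact: ltW (truncnS_gt _).
  - exact: (integrable_abse ih).
  - move=> n x; rewrite /f_ normrM ler_piMr// indicE; case: (_ \in _); rewrite ?normr1 ?normr0//.
have cv0 : (\int[leb1]_x f_ n x) @[n --> \oo] --> (0 : R).
  under eq_fun do rewrite fE.
  rewrite -[X in nbhs X](subr0 0); apply: cvgB.
    by rewrite (cvg_shiftS (fun n => h n%:R)).
  by rewrite (cvg_shiftS (fun n => h (- n%:R))).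
exact: (cvg_unique _ cv cv0).
Unshelve. all: end_near. Qed.

End WholeLine.

Section GaussFourier1.
Variables (R : realType) (s : R).
Hypothesis s0 : 0 < s.
Local Notation leb1 := (@lebesgue_measure R).

(** Half of the exponent absorbs the factor |x|, by |x| <= (1 + x^2)/2 and 1 + s x^2/2 <= exp(s
    x^2/2). *)
Lemma moment1_le (x : R) :
  `|x| * expR (- s * x ^+ 2) <= (2^-1 + s^-1) * expR (- (s / 2) * x ^+ 2).
Proof.
have -> : expR (- s * x ^+ 2) = expR (- (s / 2) * x ^+ 2) * expR (- (s / 2) * x ^+ 2).
  by rewrite -expRD; congr expR; field.
rewrite mulrA ler_wpM2r ?expR_ge0//.
rewrite mulNr expRN ler_pdivrMr ?expR_gt0//.
have h1 := expR_ge1Dx (s / 2 * x ^+ 2).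
apply: (@le_trans _ _ ((2^-1 + s^-1) * (1 + s / 2 * x ^+ 2))); last first.
  by rewrite ler_wpM2l// addr_ge0 ?invr_ge0 ?ler0n// ltW.
have -> : (2^-1 + s^-1) * (1 + s / 2 * x ^+ 2) =
    (1 + `|x| ^+ 2) / 2 + (s^-1 + s / 4 * x ^+ 2).
  by rewrite real_normK ?num_real//; field; rewrite gt_eqF.
rewrite ler_wpDr//.
  apply: addr_ge0; first by rewrite invr_ge0 ltW.
  by rewrite mulr_ge0 ?sqr_ge0// divr_ge0// ltW.
rewrite ler_pdivlMr// -subr_ge0.
have -> : 1 + `|x| ^+ 2 - `|x| * 2 = (1 - `|x|) ^+ 2 by ring.
exact: sqr_ge0.
Qed.

Lemma integrable_moment1 :
  leb1.-integrable setT (EFin \o (fun x : R => `|x| * expR (- s * x ^+ 2))).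
Proof.
have s20 : 0 < s / 2 by rewrite divr_gt0.
apply: (@integrable_dom _ (measurableTypeR R) R leb1 _
  (fun x => (2^-1 + s^-1) * expR (- (s / 2) * x ^+ 2))); first by mfun.
- by move=> x; rewrite ger0_norm ?mulr_ge0 ?expR_ge0//; exact: moment1_le.
- rewrite (_ : _ \o _ = fun x => ((2^-1 + s^-1)%:E * (expR (- (s / 2) * x ^+ 2))%:E)%E)//.
  by apply: integrableZl => //; exact: integrable_gauss1.
Qed.

Lemma cvg_gauss_nat : expR (- s * n%:R ^+ 2) @[n --> \oo] --> (0 : R).
Proof.
under eq_fun do rewrite mulNr.
apply: (@cvg_comp _ _ _ (fun n => s * n%:R ^+ 2) (fun x => expR (- x))); last exact: cvgr_expR.
apply/cvgryPge => A; near=> n.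
have n1 : (1 : R) <= n%:R by rewrite ler1n; near: n; exact: nbhs_infty_ge.
have : (Num.truncn (A / s)).+1%:R <= n%:R :> R.
  by rewrite ler_nat; near: n; exact: nbhs_infty_ge.
move=> /(le_trans (ltW (truncnS_gt _))); rewrite ler_pdivrMr// => /le_trans; apply.
rewrite mulrC ler_pM2l// expr2 ler_peMl// ler0n.
Unshelve. all: end_near. Qed.

Lemma integrable_cos_gauss1 z :
  leb1.-integrable setT (EFin \o (fun x : R => cos (z * x) * expR (- s * x ^+ 2))).
Proof.
apply: (@integrable_dom _ (measurableTypeR R) R leb1 _ (fun x => expR (- s * x ^+ 2))).
- by mfun.
- by move=> x; rewrite normrM (ger0_norm (expR_ge0 _)) ler_piMl ?expR_ge0// ler_norml cos_geN1 cos_le1.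
- exact: integrable_gauss1.
Qed.

Lemma integrable_xsin_gauss1 z :
  leb1.-integrable setT (EFin \o (fun x : R => x * sin (z * x) * expR (- s * x ^+ 2))).
Proof.
apply: (@integrable_dom _ (measurableTypeR R) R leb1 _ (fun x => `|x| * expR (- s * x ^+ 2))).
- by mfun.
- move=> x; rewrite !normrM (ger0_norm (expR_ge0 _)) ler_wpM2r ?expR_ge0//.
  by rewrite ler_piMr// ler_norml sin_geN1 sin_le1.
- exact: integrable_moment1.
Qed.

Lemma gauss_fourier_by_parts z :
  2 * s * \int[leb1]_x (x * sin (z * x) * expR (- s * x ^+ 2)) =
  z * \int[leb1]_x (cos (z * x) * expR (- s * x ^+ 2)).
Proof.
have i1 := integrable_cos_gauss1 z; have i2 := integrable_xsin_gauss1 z.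
rewrite -!RintegralZl//; apply/eqP; rewrite eq_sym -subr_eq0; apply/eqP.
rewrite -RintegralB//; [|exact: integrable_scale|exact: integrable_scale].
pose h (x : R) := sin (z * x) * expR (- s * x ^+ 2).
apply: (@integral_derive_eq0 _ h).
- move=> x; rewrite /h; eder.
  by rewrite /=; ring.
- move=> x; apply: (@der_continuous _ _ (fun x => derive1 (fun y : R => z * (cos (z * y) * expR (- s * y ^+ 2)) -
    2 * s * (y * sin (z * y) * expR (- s * y ^+ 2))) x)) => {}x.
  split; last by rewrite derive1E.
  by apply: ex_derive; der.
- by apply: integrable_sub; exact: integrable_scale.
- rewrite /h; apply: (@squeeze_cvgr _ _ _ _ (fun n => - expR (- s * n%:R ^+ 2)) (fun n => expR (- s * n%:R ^+ 2))).
  + apply: nearW => n; rewrite -ler_norml normrM (ger0_norm (expR_ge0 _)).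
    by rewrite ler_piMl ?expR_ge0// ler_norml sin_geN1 sin_le1.
  + by rewrite -oppr0; apply: cvgN; exact: cvg_gauss_nat.
  + exact: cvg_gauss_nat.
- rewrite /h; apply: (@squeeze_cvgr _ _ _ _ (fun n => - expR (- s * n%:R ^+ 2)) (fun n => expR (- s * n%:R ^+ 2))).
  + apply: nearW => n; rewrite sqrrN -ler_norml normrM (ger0_norm (expR_ge0 _)).
    by rewrite ler_piMl ?expR_ge0// ler_norml sin_geN1 sin_le1.
  + by rewrite -oppr0; apply: cvgN; exact: cvg_gauss_nat.
  + exact: cvg_gauss_nat.
Qed.

(** As a function of z the integral solves F' = - z F / (2 s): differentiate under the integral,
    then use [gauss_fourier_by_parts]. Hence F(z) exp(z^2 / (4 s)) is constant. *)
Lemma gauss_fourier1 z : \int[leb1]_x (cos (z * x) * expR (- s * x ^+ 2)) =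
  Num.sqrt (pi / s) * expR (- (4 * s)^-1 * z ^+ 2).
Proof.
pose f (z x : R) := cos (z * x) * expR (- s * x ^+ 2).
pose F z := \int[leb1]_x f z x.
have df (y x : R) : is_derive y 1 (f ^~ x) (- (x * sin (y * x) * expR (- s * x ^+ 2))).
  by rewrite /f; eder; rewrite /=; ring.
have pf y x : partial1of2 f y x = - (x * sin (y * x) * expR (- s * x ^+ 2)).
  by rewrite /partial1of2; exact: der_derive1.
have dF (y : R) : is_derive y 1 F (- (2 * s)^-1 * y * F y).
  have Iy : `](y - 1), (y + 1)[%classic y by rewrite /= in_itv/= ltrBlDr ltrDl ltr01.
  have intf (x : R) : `](y - 1), (y + 1)[%classic x -> leb1.-integrable setT (EFin \o f x).
    by move=> _; exact: integrable_cos_gauss1.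
  have derf (x w : R) : `](y - 1), (y + 1)[%classic x -> setT w -> derivable (f ^~ w) x 1.
    by move=> _ _; case: (df x w).
  have G0 (x : R) : 0 <= `|x| * expR (- s * x ^+ 2) by rewrite mulr_ge0 ?expR_ge0.
  have Gub (x w : R) : `](y - 1), (y + 1)[%classic x -> setT w ->
      `|partial1of2 f x w| <= `|w| * expR (- s * w ^+ 2).
    move=> _ _; rewrite pf normrN !normrM (ger0_norm (expR_ge0 _)) ler_wpM2r ?expR_ge0//.
    by rewrite ler_piMr// ler_norml sin_geN1 sin_le1.
  split.
    exact: (derivable_under_integral measurableT Iy intf derf G0 integrable_moment1 Gub).
  rewrite -derive1E.
  rewrite (differentiation_under_integral measurableT Iy intf derf G0 integrable_moment1 Gub).
  under eq_Rintegral do rewrite pf -mulN1r.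
  rewrite RintegralZl//; last exact: integrable_xsin_gauss1.
  apply: (@mulfI _ (2 * s)); first by rewrite mulf_neq0// gt_eqF.
  rewrite mulrCA gauss_fourier_by_parts /F /f; field.
  by rewrite gt_eqF.
pose H (y : R) := F y * expR ((4 * s)^-1 * y ^+ 2).
have : H z = H 0.
  apply: is_derive_0_is_cst => y; have ? := dF y; rewrite /H; eder.
  by rewrite /=; field; rewrite gt_eqF.
have -> : H 0 = Num.sqrt (pi / s).
  rewrite /H expr0n mulr0 expR0 mulr1 /F /f.
  under eq_Rintegral do rewrite mul0r cos0 mul1r.
  by rewrite /Rintegral integral_gauss1.
by rewrite /H => <-; rewrite -mulrA -expRD mulNr subrr expR0 mulr1.
Qed.

End GaussFourier1.

Section TensorIntegrable.
Context d1 d2 (T1 : measurableType d1) (T2 : measurableType d2) (R : realType).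
Variable m1 : {sigma_finite_measure set T1 -> \bar R}.
Variable m2 : {sigma_finite_measure set T2 -> \bar R}.

Lemma integrable_tensor (f : T1 -> R) (g : T2 -> R) :
  m1.-integrable setT (EFin \o f) -> m2.-integrable setT (EFin \o g) ->
  (sprod m1 m2).-integrable setT (EFin \o (fun z => f z.1 * g z.2)).
Proof.
move=> /integrableP[/measurable_EFinP mf fi] /integrableP[/measurable_EFinP mg gi].
apply/integrable12ltyP; first by mfun; apply: measurableT_comp.
have E x : (\int[m2]_y `|(f x * g y)%:E| = `|f x|%:E * \int[m2]_y `|(g y)%:E|)%E.
  rewrite -ge0_integralZl//.
  - by apply: eq_integral => y _; rewrite /= normrM EFinM.
  - by apply/measurable_EFinP; mfun.
under eq_integral do rewrite E.
rewrite ge0_integralZr//.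
- by apply: lte_mul_pinfty => //; [exact: integral_ge0|rewrite ge0_fin_numE//; exact: integral_ge0].
- by apply/measurable_EFinP; mfun.
- exact: integral_ge0.
Qed.

End TensorIntegrable.

Section RowIntegrals.
Variable R : realType.
Local Notation leb1 := (@lebesgue_measure R).
Local Notation rowB := (rowB R).
Local Notation leb := (leb R).

Lemma dotRdC n (u v : 'rV[R]_n) : dotRd u v = dotRd v u.
Proof. by apply: eq_bigr => i _; rewrite mulrC. Qed.

Lemma dotRdDl n (u v w : 'rV[R]_n) : dotRd (u + v) w = dotRd u w + dotRd v w.
Proof. by rewrite /dotRd -big_split; apply: eq_bigr => i _; rewrite mxE mulrDl. Qed.

Lemma dotRdNl n (u v : 'rV[R]_n) : dotRd (- u) v = - dotRd u v.
Proof. by rewrite /dotRd -sumrN; apply: eq_bigr => i _; rewrite mxE mulNr. Qed.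

Lemma dotRdZl n c (u v : 'rV[R]_n) : dotRd (c *: u) v = c * dotRd u v.
Proof. by rewrite /dotRd mulr_sumr; apply: eq_bigr => i _; rewrite mxE mulrA. Qed.

Lemma dotRd_ge0 n (u : 'rV[R]_n) : 0 <= dotRd u u.
Proof. by apply: sumr_ge0 => i _; rewrite -expr2 sqr_ge0. Qed.

Lemma euclid_ge0 n (u : 'rV[R]_n) : 0 <= euclid u.
Proof. exact: sqrtr_ge0. Qed.

Lemma sqr_euclid n (u : 'rV[R]_n) : euclid u ^+ 2 = dotRd u u.
Proof. by rewrite sqr_sqrtr// dotRd_ge0. Qed.

Lemma euclidN n (u : 'rV[R]_n) : euclid (- u) = euclid u.
Proof. by rewrite /euclid dotRdNl dotRdC dotRdNl opprK. Qed.

Lemma coord_le_euclid n (u : 'rV[R]_n) i : `|u 0 i| <= euclid u.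
Proof.
rewrite -(@ler_pXn2r _ 2)// ?nnegrE ?euclid_ge0//.
rewrite sqr_euclid real_normK ?num_real// /dotRd (bigD1 i)//= -expr2 lerDl.
by apply: sumr_ge0 => j _; rewrite -expr2 sqr_ge0.
Qed.

Lemma measurable_dotRd d (T : measurableType d) n (f g : T -> rowB n) :
  measurable_fun setT f -> measurable_fun setT g ->
  measurable_fun setT (fun x => dotRd (f x) (g x)).
Proof.
move=> mf mg; rewrite /dotRd; apply: measurable_sum => i.
by apply: measurable_funM; apply: (measurableT_comp (measurable_coord i)).
Qed.

Lemma measurable_euclid d (T : measurableType d) n (f : T -> rowB n) :
  measurable_fun setT f -> measurable_fun setT (fun x => euclid (f x)).
Proof. by move=> mf; rewrite /euclid; mfun; exact: measurable_dotRd. Qed.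

Lemma measurable_rowD d (T : measurableType d) n (f g : T -> rowB n) :
  measurable_fun setT f -> measurable_fun setT g ->
  measurable_fun setT (fun x => (f x : 'rV[R]_n) + g x : rowB n).
Proof.
move=> mf mg; apply: measurable_rowP => i; under eq_fun do rewrite mxE.
by apply: measurable_funD; apply: (measurableT_comp (measurable_coord i)).
Qed.

Lemma measurable_rowN d (T : measurableType d) n (f : T -> rowB n) :
  measurable_fun setT f -> measurable_fun setT (fun x => - (f x : 'rV[R]_n) : rowB n).
Proof.
move=> mf; apply: measurable_rowP => i; under eq_fun do rewrite mxE.
by apply: measurable_funN; apply: (measurableT_comp (measurable_coord i)).
Qed.

Lemma Rintegral_rsub n (f : rowB n -> R) (x : 'rV[R]_n) : measurable_fun setT f ->
  \int[leb n]_z f (x - (z : 'rV[R]_n)) = \int[leb n]_z f z.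
Proof. by move=> mf; congr fine; apply: (integral_rsub (f := EFin \o f)); exact/measurable_EFinP. Qed.

Lemma integrable_rsub n (f : rowB n -> R) (x : 'rV[R]_n) :
  (leb n).-integrable setT (EFin \o f) ->
  (leb n).-integrable setT (EFin \o (fun z => f (x - (z : 'rV[R]_n)))).
Proof.
move=> /integrableP[/measurable_EFinP mf fi]; apply/integrableP; split.
  apply/measurable_EFinP; apply: (measurableT_comp mf).
  by apply: measurable_rowD => //; apply: measurable_rowN.
by rewrite (integral_rsub (f := fun z => `|(f z)%:E|%E))//; apply/measurable_EFinP; mfun.
Qed.

Lemma Rintegral_opp1 (f : R -> R) : measurable_fun setT f ->
  \int[leb1]_x f (- x) = \int[leb1]_x f x.
Proof.
move=> mf; congr fine.
rewrite integralE [RHS]integralE; congr (_ - _)%E.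
  rewrite -[RHS]ge0_integral_opp1//; last by apply: measurable_funepos; exact/measurable_EFinP.
  by apply: eq_integral => z _; rewrite !funeposE.
rewrite -[RHS]ge0_integral_opp1//; last by apply: measurable_funeneg; exact/measurable_EFinP.
by apply: eq_integral => z _; rewrite !funenegE.
Qed.

Section gauss.
Variable s : R.
Hypothesis s0 : 0 < s.

Lemma expR_dotRd n (z : 'rV[R]_n) :
  expR (- s * dotRd z z) = \prod_(i < n) expR (- s * z 0 i ^+ 2).
Proof.
by rewrite -expR_sum /dotRd mulr_sumr.
Qed.

Lemma integral_gauss n :
  (\int[leb n]_z (expR (- s * dotRd z z))%:E = (Num.sqrt (pi / s) ^+ n)%:E)%E.
Proof.
under eq_integral do rewrite expR_dotRd.
by apply: (@integral_prod _ _ (fun x => expR (- s * x ^+ 2))); [mfun|move=> x; exact: expR_ge0|exact: integral_gauss1].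
Qed.

Lemma integrable_gauss n :
  (leb n).-integrable setT (EFin \o (fun z => expR (- s * dotRd z z))).
Proof.
apply: ge0_integrable; first by mfun; apply: measurable_dotRd.
  by move=> x; exact: expR_ge0.
by rewrite integral_gauss ltry.
Qed.

Lemma integrable_cos_gauss n (z : 'rV[R]_n) phi :
  (leb n).-integrable setT (EFin \o (fun xi => cos (dotRd xi z + phi) * expR (- s * dotRd xi xi))).
Proof.
apply: (integrable_dom _ _ (integrable_gauss n)).
  by mfun; apply: measurable_dotRd.
move=> x; rewrite normrM (ger0_norm (expR_ge0 _)) ler_piMl ?expR_ge0//.
by rewrite ler_norml cos_geN1 cos_le1.
Qed.

(** The phase stands for the other coordinates in the induction on the dimension of [gauss_fourier].
    Expanding the cosine of the sum leaves a sine integral, which vanishes by oddness. *)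
Lemma gauss_fourier1_phase z phi :
  \int[leb1]_x (cos (x * z + phi) * expR (- s * x ^+ 2)) =
  cos phi * (Num.sqrt (pi / s) * expR (- (4 * s)^-1 * z ^+ 2)).
Proof.
have ic : leb1.-integrable setT (EFin \o (fun x : R => cos (z * x) * expR (- s * x ^+ 2))).
  exact: integrable_cos_gauss1.
have is_ : leb1.-integrable setT (EFin \o (fun x : R => sin (z * x) * expR (- s * x ^+ 2))).
  apply: (@integrable_dom _ (measurableTypeR R) R leb1 _ (fun x => expR (- s * x ^+ 2))).
  - by mfun.
  - by move=> x; rewrite normrM (ger0_norm (expR_ge0 _)) ler_piMl ?expR_ge0// ler_norml sin_geN1 sin_le1.
  - exact: integrable_gauss1.
have sin0 : \int[leb1]_x (sin (z * x) * expR (- s * x ^+ 2)) = 0.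
  have := @Rintegral_opp1 (fun x => sin (z * x) * expR (- s * x ^+ 2)).
  move=> /(_ ltac:(mfun)).
  under eq_Rintegral do rewrite mulrN sinN sqrrN mulNr -mulN1r.
  rewrite RintegralZl// mulN1r; set S := Rintegral _ _ _ => E.
  by apply/eqP; move/eqP: E; rewrite eq_sym -addr_eq0 -mulr2n mulrn_eq0.
rewrite -gauss_fourier1//.
transitivity (\int[leb1]_x (cos phi * (cos (z * x) * expR (- s * x ^+ 2)) -
    sin phi * (sin (z * x) * expR (- s * x ^+ 2)))).
  by apply: eq_Rintegral => x _; rewrite cosD [x * z]mulrC; ring.
rewrite RintegralB//; [|exact: integrable_scale..].
by rewrite !RintegralZl// sin0 mulr0 subr0.
Qed.

Lemma dotRd_rcons1 n (p : R * rowB n) (z : 'rV[R]_n.+1) :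
  dotRd (rcons1 p) z = p.1 * z 0 0 + dotRd p.2 (\row_i z 0 (lift 0 i)).
Proof.
rewrite /dotRd big_ord_recl rcons1_0; congr (_ + _).
by apply: eq_bigr => i _; rewrite rcons1_lift mxE.
Qed.

Lemma dotRd_recl n (z w : 'rV[R]_n.+1) : dotRd z w =
  z 0 0 * w 0 0 + dotRd (\row_i z 0 (lift 0 i)) (\row_i w 0 (lift 0 i)).
Proof. by rewrite /dotRd big_ord_recl; congr (_ + _); apply: eq_bigr => i _; rewrite !mxE. Qed.

Lemma dotRd_rcons11 n (p : R * rowB n) :
  dotRd (rcons1 p) (rcons1 p) = p.1 ^+ 2 + dotRd p.2 p.2.
Proof.
rewrite dotRd_rcons1 rcons1_0 -expr2; congr (_ + _).
by apply: eq_bigr => i _; rewrite mxE rcons1_lift.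
Qed.

Lemma gauss_fourier n (z : 'rV[R]_n) phi :
  \int[leb n]_xi (cos (dotRd xi z + phi) * expR (- s * dotRd xi xi)) =
  cos phi * (Num.sqrt (pi / s) ^+ n * expR (- (4 * s)^-1 * dotRd z z)).
Proof.
elim: n z phi => [|n ih] z phi.
  rewrite /Rintegral ge0_integral_leb0/=.
    by rewrite /dotRd !big_ord0 !mulr0 expR0 add0r expr0 !mulr1.
  by apply/measurable_EFinP; mfun; apply: measurable_dotRd.
rewrite Rintegral_lebS; last exact: integrable_cos_gauss.
rewrite -Rintegral_sprod1; last exact: (integrable_rcons1 (integrable_cos_gauss z phi)).
pose z' : 'rV[R]_n := \row_i z 0 (lift 0 i).
pose K := Num.sqrt (pi / s) ^+ n * expR (- (4 * s)^-1 * dotRd z' z').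
transitivity (\int[leb1]_x (K * (cos (x * z 0 0 + phi) * expR (- s * x ^+ 2)))).
  apply: eq_Rintegral => x _.
  transitivity (\int[leb n]_v (expR (- s * x ^+ 2) *
      (cos (dotRd v z' + (x * z 0 0 + phi)) * expR (- s * dotRd v v)))).
    apply: eq_Rintegral => v _; rewrite dotRd_rcons1 dotRd_rcons11/= mulrDr expRD.
    rewrite (_ : x * z 0 0 + _ + phi = dotRd v z' + (x * z 0 0 + phi)); last by rewrite -/z'; ring.
    by rewrite mulrCA mulrA.
  rewrite RintegralZl//; last exact: integrable_cos_gauss.
  by rewrite ih /K; ring.
rewrite RintegralZl//; last first.
  apply: (@integrable_dom _ (measurableTypeR R) R leb1 _ (fun x => expR (- s * x ^+ 2))).
  - by mfun.
  - by move=> x; rewrite normrM (ger0_norm (expR_ge0 _)) ler_piMl ?expR_ge0// ler_norml cos_geN1 cos_le1.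
  - exact: integrable_gauss1.
rewrite gauss_fourier1_phase /K (dotRd_recl z z) -/z' mulrDr expRD (exprS _ n) expr2; ring.
Qed.

End gauss.
End RowIntegrals.

(** * Fourier inversion *)

Section Inversion.
Variable R : realType.
Local Notation rowB := (rowB R).
Local Notation leb := (leb R).
Variables (n : nat) (p : 'rV[R]_n -> R) (phat : 'rV[R]_n -> R).
Hypothesis ip : (leb n).-integrable setT (EFin \o p).
Hypothesis hc : forall xi : 'rV[R]_n, \int[leb n]_z (p z * cos (dotRd z xi)) = phat xi.
Hypothesis hs : forall xi : 'rV[R]_n, \int[leb n]_z (p z * sin (dotRd z xi)) = 0.

Let mp : measurable_fun setT (p : rowB n -> R).
Proof. by case/integrableP: ip => /measurable_EFinP. Qed.

Lemma integrable_mul_le1 (k : rowB n -> R) : measurable_fun setT k ->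
  (forall z, `|k z| <= 1) -> (leb n).-integrable setT (EFin \o (fun z => p z * k z)).
Proof.
move=> mk k1; apply: (integrable_dom _ _ (integrable_abse ip)); first by mfun.
by move=> z; rewrite normrM ler_piMr.
Qed.

Lemma norm_cos_le1 (x : R) : `|cos x| <= 1.
Proof. by rewrite ler_norml cos_geN1 cos_le1. Qed.

Lemma norm_sin_le1 (x : R) : `|sin x| <= 1.
Proof. by rewrite ler_norml sin_geN1 sin_le1. Qed.

Lemma Rintegral_cos_sub (xi w : 'rV[R]_n) :
  \int[leb n]_z (p z * cos (dotRd xi (w - (z : 'rV[R]_n)))) = cos (dotRd xi w) * phat xi.
Proof.
have mz : measurable_fun setT (fun z : rowB n => dotRd z xi) by exact: measurable_dotRd.
have ic : (leb n).-integrable setT (EFin \o (fun z => p z * cos (dotRd z xi))).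
  by apply: integrable_mul_le1 => [|z]; [mfun|exact: norm_cos_le1].
have is_ : (leb n).-integrable setT (EFin \o (fun z => p z * sin (dotRd z xi))).
  by apply: integrable_mul_le1 => [|z]; [mfun|exact: norm_sin_le1].
transitivity (\int[leb n]_z (cos (dotRd xi w) * (p z * cos (dotRd z xi)) +
    sin (dotRd xi w) * (p z * sin (dotRd z xi)))).
  apply: eq_Rintegral => z _.
  by rewrite dotRdC dotRdDl dotRdNl cosB dotRdC; ring.
rewrite RintegralD//; [|exact: integrable_scale..].
by rewrite !RintegralZl// hc hs mulr0 addr0.
Qed.

Lemma Rintegral_sin_sub (xi w : 'rV[R]_n) :
  \int[leb n]_z (p z * sin (dotRd xi (w - (z : 'rV[R]_n)))) = sin (dotRd xi w) * phat xi.
Proof.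
have mz : measurable_fun setT (fun z : rowB n => dotRd z xi) by exact: measurable_dotRd.
have ic : (leb n).-integrable setT (EFin \o (fun z => p z * cos (dotRd z xi))).
  by apply: integrable_mul_le1 => [|z]; [mfun|exact: norm_cos_le1].
have is_ : (leb n).-integrable setT (EFin \o (fun z => p z * sin (dotRd z xi))).
  by apply: integrable_mul_le1 => [|z]; [mfun|exact: norm_sin_le1].
transitivity (\int[leb n]_z (sin (dotRd xi w) * (p z * cos (dotRd z xi)) -
    cos (dotRd xi w) * (p z * sin (dotRd z xi)))).
  apply: eq_Rintegral => z _.
  by rewrite dotRdC dotRdDl dotRdNl sinB dotRdC; ring.
rewrite RintegralB//; [|exact: integrable_scale..].
by rewrite !RintegralZl// hc hs mulr0 subr0.
Qed.

Section convolution.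
Variables (k : R -> R) (f : 'rV[R]_n -> R).
Hypothesis mk : measurable_fun setT k.
Hypothesis k1 : forall x, `|k x| <= 1.
Hypothesis f_int : (leb n).-integrable setT (EFin \o f).
Hypothesis hk : forall xi w : 'rV[R]_n,
  \int[leb n]_z (p z * k (dotRd xi (w - (z : 'rV[R]_n)))) = k (dotRd xi w) * phat xi.

(** Fubini brings the integral over z inside, where [hk] evaluates it. Used with [k] = [cos] for
    inversion ([f] a Gaussian) and for the semigroup property ([f] the symbol), and with [k] = [sin]
    for the gradient. *)
Lemma Rintegral_fourier_conv (w : 'rV[R]_n) :
  \int[leb n]_z (p z * \int[leb n]_xi (f xi * k (dotRd xi (w - (z : 'rV[R]_n))))) =
  \int[leb n]_xi (f xi * phat xi * k (dotRd xi w)).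
Proof.
have mf : measurable_fun setT (f : rowB n -> R).
  by case/integrableP: f_int => /measurable_EFinP.
pose F (u : rowB n * rowB n) := p u.1 * (f u.2 * k (dotRd u.2 (w - (u.1 : 'rV[R]_n)))).
have mk' : measurable_fun setT (fun u : rowB n * rowB n =>
    k (dotRd u.2 (w - (u.1 : 'rV[R]_n)))).
  apply: (measurableT_comp mk); apply: measurable_dotRd => //.
  by apply: measurable_rowD => //; apply: measurable_rowN.
have iF : (sprod (leb n) (leb n)).-integrable setT (EFin \o F).
  apply: (integrable_dom _ _ (integrable_abse (integrable_tensor ip f_int))).
    rewrite /F; mfun; exact: measurableT_comp.
  move=> u; rewrite /F /= mulrA normrM ler_piMr//.
have := Rintegral_sprod1 iF; rewrite -(Rintegral_sprod2 iF) /F /= {F iF mk'} => E.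
transitivity (\int[leb n]_x \int[leb n]_y (p x * (f y * k (dotRd y (w - (x : 'rV[R]_n)))))).
  apply: eq_Rintegral => z _; symmetry; apply: RintZ.
  apply: (integrable_dom _ _ (integrable_abse f_int)).
    by mfun; apply: (measurableT_comp mk); exact: measurable_dotRd.
  by move=> u; rewrite normrM ler_piMr.
rewrite E; apply: eq_Rintegral => xi _.
transitivity (\int[leb n]_x (f xi * (p x * k (dotRd xi (w - (x : 'rV[R]_n)))))).
  by apply: eq_Rintegral => z _; rewrite mulrCA.
rewrite (RintZ (f xi)); first by rewrite hk mulrCA mulrC -mulrA [phat _ * _]mulrC.
apply: integrable_mul_le1; last by move=> z; exact: k1.
apply: (measurableT_comp mk); apply: measurable_dotRd; first exact: measurable_cst.
apply: measurable_rowD; first exact: measurable_cst.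
by apply: measurable_rowN; exact: measurable_id.
Qed.

End convolution.

Section regularize.
Hypothesis cp : continuous p.
Variable B : R.
Hypothesis pB : forall z, `|p z| <= B.
Hypothesis iphat : (leb n).-integrable setT (EFin \o phat).

Let K (s : R) := Num.sqrt (pi / s) ^+ n.

Lemma K_gauss (s c : R) : 0 < s -> 0 < c ->
  \int[leb n]_u (K s * expR (- (c * s)^-1 * dotRd u u)) = Num.sqrt (c * pi ^+ 2) ^+ n.
Proof.
move=> s0 c0; have cs : 0 < (c * s)^-1 by rewrite invr_gt0 mulr_gt0.
rewrite RintegralZl//; last exact: integrable_gauss.
rewrite /Rintegral integral_gauss//= /K -exprMn -sqrtrM; last by rewrite divr_ge0 ?pi_ge0 ?ltW.
by congr (Num.sqrt _ ^+ _); field; rewrite !gt_eqF.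
Qed.

(** A quantitative approximate identity. Inside the sup-norm box of size delta the oscillation of
    [p] is at most eta. Outside it, 2 B <= 2 B |u|^2 / delta^2, and |u|^2 exp(-|u|^2/(4s)) <= 8 s
    exp(-|u|^2/(8s)) turns this into an error of order s at the price of a wider Gaussian. *)
Lemma gauss_approx_le (x : 'rV[R]_n) (eta delta s : R) : 0 < s -> 0 < delta -> 0 <= eta ->
  (forall u : 'rV[R]_n, (forall i, `|u 0 i| < delta) -> `|p (x - u) - p x| <= eta) ->
  `|\int[leb n]_z (p z * (K s * expR (- (4 * s)^-1 * dotRd (x - (z : 'rV[R]_n)) (x - (z : 'rV[R]_n)))))
    - (2 * pi) ^+ n * p x| <=
  eta * (2 * pi) ^+ n + 16 * B * Num.sqrt (8 * pi ^+ 2) ^+ n / delta ^+ 2 * s.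
Proof.
move=> s0 d0 eta0 near_x.
have B0 : 0 <= B by exact: le_trans (normr_ge0 _) (pB 0).
have K0 : 0 <= K s by rewrite exprn_ge0// sqrtr_ge0.
pose g c (u : 'rV[R]_n) := K s * expR (- (c * s)^-1 * dotRd u u).
have mg c : measurable_fun setT (g c : rowB n -> R) by rewrite /g; mfun; exact: measurable_dotRd.
have g0 c u : 0 <= g c u by rewrite mulr_ge0// expR_ge0.
have ig c : 0 < c -> (leb n).-integrable setT (EFin \o g c).
  by move=> c0; apply: integrable_scale; apply: integrable_gauss; rewrite invr_gt0 mulr_gt0.
have Gg c : 0 < c -> \int[leb n]_u g c u = Num.sqrt (c * pi ^+ 2) ^+ n by exact: K_gauss.
have i4 := ig 4 (ltr0Sn _ _); have i8 := ig 8 (ltr0Sn _ _).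
have mpx : measurable_fun setT (fun u : rowB n => p (x - (u : 'rV[R]_n))).
  apply: (measurableT_comp mp); by apply: measurable_rowD => //; apply: measurable_rowN.
have -> : \int[leb n]_z (p z * (K s * expR (- (4 * s)^-1 * dotRd (x - (z : 'rV[R]_n)) (x - (z : 'rV[R]_n)))))
    = \int[leb n]_u (p (x - (u : 'rV[R]_n)) * g 4 u).
  rewrite -[RHS](@Rintegral_rsub _ _ (fun u => p (x - (u : 'rV[R]_n)) * g 4 u) x); last by mfun.
  apply: eq_Rintegral => z _.
  by have -> : x - (x - (z : 'rV[R]_n)) = z by rewrite opprB addrC subrK.
have ipg : (leb n).-integrable setT (EFin \o (fun u => p (x - (u : 'rV[R]_n)) * g 4 u)).
  apply: (integrable_dom _ _ (integrable_scale B i4)); first by mfun.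
  by move=> u; rewrite normrM (ger0_norm (g0 _ _)) ler_wpM2r.
have -> : (2 * pi) ^+ n * p x = \int[leb n]_u (p x * g 4 u).
  rewrite RintegralZl// Gg// [RHS]mulrC; congr (_ ^+ _ * _).
  have -> : 4 * pi ^+ 2 = (2 * pi) ^+ 2 :> R by ring.
  by rewrite sqrtr_sqr ger0_norm// mulr_ge0// pi_ge0.
rewrite -RintegralB//; last exact: integrable_scale.
apply: (@le_trans _ _ (\int[leb n]_u (eta * g 4 u + 16 * B * s / delta ^+ 2 * g 8 u))).
  apply: norm_Rintegral_le; [by mfun| |by apply: integrable_add; exact: integrable_scale].
  move=> u; rewrite -mulrBl normrM (ger0_norm (g0 _ _)).
  have [/forallP h|/forallPn[i]] := boolP [forall i, `|(u : 'rV[R]_n) 0 i| < delta].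
    apply: ler_wpDr; last by rewrite ler_wpM2r// near_x.
    by rewrite mulr_ge0// divr_ge0 ?sqr_ge0// !mulr_ge0// ltW.
  rewrite -leNgt => hi.
  apply: ler_wpDl; first by rewrite mulr_ge0.
  have hu : delta ^+ 2 <= dotRd u u.
    rewrite -sqr_euclid ler_pXn2r ?nnegrE ?euclid_ge0 ?(ltW d0)//.
    exact: le_trans hi (coord_le_euclid _ _).
  have h2 : `|p (x - (u : 'rV[R]_n)) - p x| <= 2 * B * (dotRd u u / delta ^+ 2).
    apply: (@le_trans _ _ (2 * B)).
      by rewrite (le_trans (ler_normB _ _))// mulrDl mul1r lerD.
    by rewrite ler_peMr ?mulr_ge0// ler_pdivlMr ?exprn_gt0// mul1r.
  apply: (@le_trans _ _ (2 * B * (dotRd u u / delta ^+ 2) * g 4 u)).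
    by rewrite ler_wpM2r.
  have h3 : dotRd u u * g 4 u <= 8 * s * g 8 u.
    have e8 : expR (- (4 * s)^-1 * dotRd u u) =
        expR (- ((8 * s)^-1 * dotRd u u)) * expR (- (8 * s)^-1 * dotRd u u).
      by rewrite -expRD; congr expR; field; rewrite gt_eqF.
    rewrite /g e8; set e1 := expR (- _); set e2 := expR _.
    have -> : dotRd u u * (K s * (e1 * e2)) = K s * e2 * (dotRd u u * e1) by ring.
    have -> : 8 * s * (K s * e2) = K s * e2 * (8 * s) by ring.
    rewrite ler_wpM2l ?mulr_ge0 ?expR_ge0// /e1 expRN ler_pdivrMr ?expR_gt0//.
    have := expR_ge1Dx ((8 * s)^-1 * dotRd u u) => h.
    rewrite -ler_pdivrMl ?mulr_gt0//; apply: le_trans h; lra.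
  have -> : 2 * B * (dotRd u u / delta ^+ 2) * g 4 u =
    (2 * B / delta ^+ 2) * (dotRd u u * g 4 u) by ring.
  have -> : 16 * B * s / delta ^+ 2 * g 8 u = (2 * B / delta ^+ 2) * (8 * s * g 8 u) by ring.
  by rewrite ler_wpM2l// divr_ge0 ?sqr_ge0// mulr_ge0.
rewrite RintegralD//; [|exact: integrable_scale..].
rewrite (RintZ eta i4) (RintZ _ i8) !Gg//.
have -> : 4 * pi ^+ 2 = (2 * pi) ^+ 2 :> R by ring.
rewrite sqrtr_sqr (ger0_norm (mulr_ge0 _ (pi_ge0 R)))// lerD2l.
by rewrite le_eqVlt; apply/orP; left; apply/eqP; ring.
Qed.

(** The regularised integral [L k], with the factor exp(-s |xi|^2) for s = 1/(k+1), has two limits: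
    the right-hand side by dominated convergence, and the left-hand side because it is the
    convolution of [p] with a concentrating Gaussian. *)
Lemma fourier_inversion (x : 'rV[R]_n) :
  (2 * pi) ^+ n * p x = \int[leb n]_xi (phat xi * cos (dotRd xi x)).
Proof.
have mphat : measurable_fun setT (phat : rowB n -> R).
  by case/integrableP: iphat => /measurable_EFinP.
pose s k : R := k.+1%:R^-1.
have s0 k : 0 < s k by rewrite invr_gt0.
pose L k := \int[leb n]_xi (expR (- s k * dotRd xi xi) * phat xi * cos (dotRd xi x)).
have LE k : L k = \int[leb n]_z (p z * (K (s k) *
    expR (- (4 * s k)^-1 * dotRd (x - (z : 'rV[R]_n)) (x - (z : 'rV[R]_n))))).
  rewrite /L -(@Rintegral_fourier_conv cos (fun xi => expR (- s k * dotRd xi xi)))//; last 4 first.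
  - exact: measurable_cos.
  - exact: norm_cos_le1.
  - exact: integrable_gauss.
  - exact: Rintegral_cos_sub.
  apply: eq_Rintegral => z _; congr (_ * _).
  have := gauss_fourier (s0 k) (x - (z : 'rV[R]_n)) 0; rewrite cos0 mul1r => <-.
  by apply: eq_Rintegral => xi _; rewrite addr0 mulrC.
have cv1 : L k @[k --> \oo] --> \int[leb n]_xi (phat xi * cos (dotRd xi x)).
  apply: (@Rintegral_dcvg _ _ _ (leb n) (fun k xi => expR (- s k * dotRd xi xi) * phat xi * cos (dotRd xi x)) _ (fun xi => `|phat xi|)).
  - by move=> k; mfun; exact: measurable_dotRd.
  - by mfun; exact: measurable_dotRd.
  - move=> xi.
    have -> : phat xi * cos (dotRd xi x) = expR (- 0 * dotRd xi xi) * phat xi * cos (dotRd xi x).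
      by rewrite oppr0 mul0r expR0 mul1r.
    apply: cvgM; last exact: cvg_cst.
    apply: cvgM; last exact: cvg_cst.
    apply: (@cvg_comp _ _ _ (fun k => - s k * dotRd xi xi) expR); last exact: continuous_expR.
    apply: cvgM; last exact: cvg_cst.
    by apply: cvgN; exact: cvg_harmonic.
  - exact: (integrable_abse iphat).
  - move=> k xi; rewrite normrM; apply: le_trans (ler_piMr _ (norm_cos_le1 _)) _ => //.
    rewrite normrM ler_piMl// ger0_norm ?expR_ge0// -expR0 ler_expR mulNr oppr_le0.
    by rewrite mulr_ge0 ?dotRd_ge0// ltW.
have cv2 : L k @[k --> \oo] --> (2 * pi) ^+ n * p x.
  apply/cvgrPdist_le => e e0.
  pose eta := e / 2 / (2 * pi) ^+ n.
  have pin : 0 < (2 * pi) ^+ n :> R by rewrite exprn_gt0// mulr_gt0// pi_gt0.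
  have eta0 : 0 < eta by rewrite !divr_gt0.
  have cpx : p w @[w --> x] --> p x by exact: cp.
  move/cvgrPdist_lt : cpx => /(_ _ eta0) /nbhs_ballP[delta /= d0 hd].
  have near_x (u : 'rV[R]_n) : (forall i, `|u 0 i| < delta) -> `|p (x - u) - p x| <= eta.
    move=> hu; rewrite distrC; apply: ltW; apply: hd; split=> // i j.
    by rewrite ord1 /ball /= !mxE opprB addrC subrK hu.
  pose A := 16 * B * Num.sqrt (8 * pi ^+ 2) ^+ n / delta ^+ 2.
  have cvA : A * s k @[k --> \oo] --> (0 : R).
    by rewrite -(mulr0 A); apply: cvgM; [exact: cvg_cst|exact: cvg_harmonic].
  have e20 : 0 < e / 2 by rewrite divr_gt0.
  move/cvgrPdist_le : cvA => /(_ _ e20) [N _ hN].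
  exists N => // k /= Nk; rewrite distrC LE.
  apply: le_trans (gauss_approx_le (s0 k) d0 (ltW eta0) near_x) _.
  rewrite /eta divfK ?gt_eqF// -/A [leRHS](splitr e) lerD2l.
  by have := hN _ Nk; rewrite /= sub0r normrN; apply: le_trans; exact: ler_norm.
exact: (cvg_unique _ cv2 cv1).
Qed.

End regularize.
End Inversion.

Section DirectionalDerivative.
Variables (R : realType) (n : nat).

Lemma derive_line (f : 'rV[R]_n -> R) (a v : 'rV[R]_n) :
  derive f a v = derive1 (fun t : R => f (t *: v + a)) 0.
Proof.
rewrite /derive /derive1.
suff -> : (fun h : R => h^-1 *: ((f \o shift a) (h *: v) - f a)) =
    (fun h => h^-1 *: (f ((h + 0) *: v + a) - f (0 *: v + a))) by [].
by apply/funext => h /=; rewrite addr0 scale0r add0r.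
Qed.

Lemma derive_sub (f : 'rV[R]_n -> R) (y a v : 'rV[R]_n) :
  derive (fun w => f (w - y)) a v = derive f (a - y) v.
Proof.
rewrite !derive_line; congr (derive1 _ 0); apply/funext => t.
by rewrite addrA.
Qed.

Lemma dotRd_line (xi z : 'rV[R]_n) i (t : R) :
  dotRd xi (t *: delta_mx 0 i + z) = t * xi 0 i + dotRd xi z.
Proof.
rewrite dotRdC dotRdDl dotRdZl [dotRd z xi]dotRdC; congr (_ * _ + _).
rewrite /dotRd (bigD1 i)//= mxE !eqxx mul1r big1 ?addr0// => j ji.
by rewrite mxE (negbTE ji) andbF mul0r.
Qed.

Lemma derive_fourier_cos (f : rowB R n -> R) (i : 'I_n) (z : 'rV[R]_n) :
  (leb R n).-integrable setT (EFin \o f) ->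
  (leb R n).-integrable setT (EFin \o (fun xi : rowB R n => xi 0 i * f xi)) ->
  derive (fun w : 'rV[R]_n => \int[leb R n]_xi (f xi * cos (dotRd xi w))) z (delta_mx 0 i) =
  - \int[leb R n]_xi (xi 0 i * f xi * sin (dotRd xi z)).
Proof.
move=> fi fi1; rewrite derive_line.
have mf : measurable_fun setT f by case/integrableP: fi => /measurable_EFinP.
pose F (t : R) (xi : rowB R n) := f xi * cos (t * xi 0 i + dotRd xi z).
have mz : measurable_fun setT (fun xi : rowB R n => dotRd xi z) by exact: measurable_dotRd.
have dF (t : R) xi : is_derive t 1 (F ^~ xi) (- (xi 0 i * f xi * sin (t * xi 0 i + dotRd xi z))).
  by rewrite /F; eder; rewrite /=; ring.
have pF t xi : partial1of2 F t xi = - (xi 0 i * f xi * sin (t * xi 0 i + dotRd xi z)).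
  by rewrite /partial1of2; exact: der_derive1.
have I0 : `](-1 : R), 1[%classic 0 by rewrite /= in_itv/= ltrN10 ltr01.
have intF (t : R) : `](-1 : R), 1[%classic t -> (leb R n).-integrable setT (EFin \o F t).
  move=> _; apply: (integrable_dom _ _ (integrable_abse fi)).
    by rewrite /F; mfun.
  by move=> xi; rewrite /F normrM ler_piMr// norm_cos_le1.
have derF (t : R) xi : `](-1 : R), 1[%classic t -> setT xi -> derivable (F ^~ xi) t 1.
  by move=> _ _; case: (dF t xi).
have Gub (t : R) xi : `](-1 : R), 1[%classic t -> setT xi ->
    `|partial1of2 F t xi| <= `|xi 0 i * f xi|.
  by move=> _ _; rewrite pF normrN normrM ler_piMr// norm_sin_le1.
have := @differentiation_under_integral R _ _ (leb R n) F setT measurableT 0 (-1) 1 I0 intF derF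
  (fun xi : rowB R n => `|xi 0 i * f xi|) (fun _ => normr_ge0 _) (integrable_abse fi1) Gub.
rewrite (_ : (fun x' => \int[leb R n]_y F x' y) = (fun t => \int[leb R n]_xi
    (f xi * cos (dotRd xi (t *: delta_mx 0 i + z))))); last first.
  by apply/funext => t; apply: eq_Rintegral => xi _; rewrite dotRd_line.
move=> ->; rewrite (@eq_Rintegral _ _ _ _ _ (fun xi : rowB R n => -1 * (xi 0 i * f xi * sin (dotRd xi z)))).
  rewrite RintegralZl ?mulN1r//.
  apply: (integrable_dom _ _ (integrable_abse fi1)).
    by mfun; exact: measurable_coord.
  by move=> xi; rewrite normrM ler_piMr// norm_sin_le1.
by move=> xi _; rewrite pF mul0r add0r mulN1r.
Qed.

End DirectionalDerivative.

(** * Fourier representation of the heat kernel *)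

Section Symbol.
Variables (R : realType) (n : nat) (alpha : R).
Local Notation leb := (leb R n).

Definition symb (a t : R) (xi : 'rV[R]_n) : R :=
  expR (- t * (euclid xi ^+ 2 + a `^ alpha * euclid xi `^ alpha)).

Lemma measurable_symb a d (T : measurableType d) (f : T -> R) (g : T -> rowB R n) :
  measurable_fun setT f -> measurable_fun setT g ->
  measurable_fun setT (fun x => symb a (f x) (g x)).
Proof.
move=> mf mg; have me := measurable_euclid mg.
by rewrite /symb; mfun.
Qed.

Lemma symb_ge0 a t xi : 0 <= symb a t xi. Proof. exact: expR_ge0. Qed.

Lemma symb_le a t xi : 0 < t -> symb a t xi <= expR (- t * dotRd xi xi).
Proof.
move=> t0; rewrite /symb ler_expR sqr_euclid !mulNr lerN2 ler_pM2l//.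
by rewrite lerDl mulr_ge0 ?powR_ge0.
Qed.

Lemma symbD a t s xi : symb a (t + s) xi = symb a t xi * symb a s xi.
Proof. by rewrite /symb -expRD; congr expR; ring. Qed.

Lemma integrable_symb a t : 0 < t -> leb.-integrable setT (EFin \o symb a t).
Proof.
move=> t0; apply: (integrable_dom _ _ (integrable_gauss t0 n)); first exact: measurable_symb.
by move=> xi; rewrite ger0_norm ?symb_ge0// symb_le.
Qed.

Lemma gauss_moment_le t (xi : 'rV[R]_n) i : 0 < t ->
  `|xi 0 i| * expR (- t * dotRd xi xi) <= (2^-1 + 2 / t) * expR (- (t / 2) * dotRd xi xi).
Proof.
move=> t0; have t20 : 0 < t / 2 by rewrite divr_gt0.
have -> : expR (- t * dotRd xi xi) =
    expR (- (t / 2) * dotRd xi xi) * expR (- (t / 2) * dotRd xi xi).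
  by rewrite -expRD; congr expR; field.
rewrite mulrA ler_wpM2r ?expR_ge0//.
have := moment1_le t20 (xi 0 i); rewrite invf_div => h.
apply: (le_trans _ (le_trans h _)).
  rewrite ler_wpM2l// ler_expR !mulNr lerN2 ler_pM2l//.
  by rewrite /dotRd (bigD1 i)//= -expr2 lerDl sumr_ge0// => j _; rewrite -expr2 sqr_ge0.
rewrite ler_piMr//; first by rewrite addr_ge0 ?invr_ge0// divr_ge0// ltW.
rewrite -expR0 ler_expR mulNr oppr_le0; apply: mulr_ge0; [by rewrite !divr_ge0// ltW | exact: sqr_ge0].
Qed.

Lemma integrable_gauss_moment t i : 0 < t ->
  leb.-integrable setT (EFin \o (fun xi : rowB R n => `|xi 0 i| * expR (- t * dotRd xi xi))).
Proof.
move=> t0; have t20 : 0 < t / 2 by rewrite divr_gt0.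
apply: (integrable_dom _ _ (integrable_scale (2^-1 + 2 / t) (integrable_gauss t20 n))).
  by mfun; exact: measurable_dotRd.
by move=> xi; rewrite ger0_norm ?mulr_ge0 ?expR_ge0// gauss_moment_le.
Qed.

Lemma integrable_symb_moment a t i : 0 < t ->
  leb.-integrable setT (EFin \o (fun xi : rowB R n => xi 0 i * symb a t xi)).
Proof.
move=> t0; apply: (integrable_dom _ _ (integrable_gauss_moment i t0)).
  by apply: measurable_funM; [exact: measurable_coord|exact: measurable_symb].
by move=> xi; rewrite normrM (ger0_norm (symb_ge0 _ _ _)) ler_wpM2l// symb_le.
Qed.

(** The inverse Fourier transform of the symbol, which is p^a by [paE]; [fspD] is its i-th partial
    derivative by [derive_pa]. As integrals with parameters both are jointly measurable in (t, z),
    about which [is_pa] says nothing. *)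
Definition fsp a t (z : 'rV[R]_n) : R :=
  ((2 * pi) ^+ n)^-1 * \int[leb]_xi (symb a t xi * cos (dotRd xi z)).

Definition fspD (i : 'I_n) a t (z : 'rV[R]_n) : R :=
  - ((2 * pi) ^+ n)^-1 * \int[leb]_xi (xi 0 i * symb a t xi * sin (dotRd xi z)).

Lemma measurable_fsp a d (T : measurableType d) (f : T -> R) (g : T -> rowB R n) :
  measurable_fun setT f -> measurable_fun setT g ->
  measurable_fun setT (fun x => fsp a (f x) (g x)).
Proof.
move=> mf mg; apply: measurable_funM => //.
apply: (@measurable_Rintegral _ _ T (rowB R n) R leb
  (fun u => symb a (f u.1) u.2 * cos (dotRd u.2 (g u.1)))).
have mf1 : measurable_fun setT (fun u : T * rowB R n => f u.1) by exact: measurableT_comp.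
have mg1 : measurable_fun setT (fun u : T * rowB R n => g u.1) by exact: measurableT_comp.
by mfun; [exact: measurable_symb|exact: measurable_dotRd].
Qed.

Lemma measurable_fspD i a d (T : measurableType d) (f : T -> R) (g : T -> rowB R n) :
  measurable_fun setT f -> measurable_fun setT g ->
  measurable_fun setT (fun x => fspD i a (f x) (g x)).
Proof.
move=> mf mg; apply: measurable_funM => //.
apply: (@measurable_Rintegral _ _ T (rowB R n) R leb
  (fun u : _ * rowB R n => u.2 0 i * symb a (f u.1) u.2 * sin (dotRd u.2 (g u.1)))).
have mf1 : measurable_fun setT (fun u : T * rowB R n => f u.1) by exact: measurableT_comp.
have mg1 : measurable_fun setT (fun u : T * rowB R n => g u.1) by exact: measurableT_comp.
by mfun; [exact: measurable_symb|exact: measurable_dotRd].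
Qed.

Variable pa : R -> R -> 'rV[R]_n -> R.
Hypothesis hpa : is_pa alpha pa.
Hypothesis pa_bounded : forall a t, 0 < a -> 0 < t -> exists B, forall z, `|pa a t z| <= B.

Lemma integrable_pa a t : 0 < a -> 0 < t -> leb.-integrable setT (EFin \o pa a t).
Proof.
move=> a0 t0; have [cp fin _ _] := hpa a0 t0.
apply/integrableP; split; first by apply/measurable_EFinP; exact: continuous_rowB.
rewrite -[X in (X < _)%E]intRdE_leb//.
by apply/measurable_EFinP; apply: measurableT_comp => //; exact: continuous_rowB.
Qed.

Lemma pa_cos a t (xi : 'rV[R]_n) : 0 < a -> 0 < t ->
  \int[leb]_z (pa a t z * cos (dotRd z xi)) = symb a t xi.
Proof.
move=> a0 t0; have [_ _ hc _] := hpa a0 t0; rewrite -[RHS](hc xi) intRd_leb//.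
apply: integrable_mul_le1; first exact: integrable_pa.
  by mfun; exact: measurable_dotRd.
by move=> z; exact: norm_cos_le1.
Qed.

Lemma pa_sin a t (xi : 'rV[R]_n) : 0 < a -> 0 < t ->
  \int[leb]_z (pa a t z * sin (dotRd z xi)) = 0.
Proof.
move=> a0 t0; have [_ _ _ hs] := hpa a0 t0; rewrite -[RHS](hs xi) intRd_leb//.
apply: integrable_mul_le1; first exact: integrable_pa.
  by mfun; exact: measurable_dotRd.
by move=> z; exact: norm_sin_le1.
Qed.

Lemma paE a t z : 0 < a -> 0 < t -> pa a t z = fsp a t z.
Proof.
move=> a0 t0; have [cp _ _ _] := hpa a0 t0; have [B pB] := pa_bounded a0 t0.
have pin : (2 * pi) ^+ n != 0 :> R by rewrite gt_eqF// exprn_gt0// mulr_gt0// pi_gt0.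
apply: (mulfI pin); rewrite /fsp mulrA divff// mul1r.
apply: (fourier_inversion (integrable_pa a0 t0) _ _ cp pB).
- by move=> xi; exact: pa_cos.
- by move=> xi; exact: pa_sin.
- exact: integrable_symb.
Qed.

Lemma derive_pa a t i (z y : 'rV[R]_n) : 0 < a -> 0 < t ->
  derive (fun w => pa a t (w - y)) z (delta_mx 0 i) = fspD i a t (z - y).
Proof.
move=> a0 t0; rewrite derive_sub.
have -> : pa a t = fun z => ((2 * pi) ^+ n)^-1 * \int[leb]_xi (symb a t xi * cos (dotRd xi z)).
  by apply/funext => w; rewrite paE.
pose k : R := ((2 * pi) ^+ n)^-1.
have -> : (fun z => k * \int[leb]_xi (symb a t xi * cos (dotRd xi z))) =
    (fun z : 'rV[R]_n => \int[leb]_xi (k * symb a t xi * cos (dotRd xi z))).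
  apply/funext => w; rewrite -RintegralZl//.
    by apply: eq_Rintegral => xi _; rewrite mulrA.
  apply: integrable_mul_le1; first exact: integrable_symb.
    by mfun; exact: measurable_dotRd.
  by move=> xi; exact: norm_cos_le1.
rewrite derive_fourier_cos; last 2 first.
- by apply: integrable_scale; exact: integrable_symb.
- have -> : (fun xi : rowB R n => xi 0 i * (k * symb a t xi)) =
      (fun xi : rowB R n => k * (xi 0 i * symb a t xi)) by apply/funext => xi; rewrite mulrCA.
  by apply: integrable_scale; exact: integrable_symb_moment.
rewrite /fspD mulNr -/k -RintegralZl//.
  by congr (- _); apply: eq_Rintegral => xi _; ring.
apply: integrable_mul_le1; first exact: integrable_symb_moment.
  by mfun; exact: measurable_dotRd.
by move=> xi; exact: norm_sin_le1.
Qed.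

(** The semigroup property, from multiplicativity of the symbol in time. One factor enters as an
    integrable function and the other as a Fourier integral, which is the form
    [Rintegral_fourier_conv] takes. *)
Lemma fsp_conv a t s (w : 'rV[R]_n) : 0 < a -> 0 < t -> 0 < s ->
  \int[leb]_z (pa a t z * fsp a s (w - (z : 'rV[R]_n))) = fsp a (s + t) w.
Proof.
move=> a0 t0 s0; rewrite /fsp.
rewrite (@eq_Rintegral _ _ _ _ _ (fun z : rowB R n => ((2 * pi) ^+ n)^-1 * (pa a t z *
  \int[leb]_xi (symb a s xi * cos (dotRd xi (w - (z : 'rV[R]_n))))))); last first.
  by move=> z _; rewrite mulrCA.
have mi : measurable_fun setT (fun z : rowB R n => \int[leb]_xi (symb a s xi * cos (dotRd xi (w - (z : 'rV[R]_n))))).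
  apply: (@measurable_Rintegral _ _ (rowB R n) (rowB R n) R leb
    (fun u => symb a s u.2 * cos (dotRd u.2 (w - (u.1 : 'rV[R]_n))))).
  by mfun; [exact: measurable_symb|apply: measurable_dotRd => //; apply: measurable_rowD => //; exact: measurable_rowN].
rewrite RintegralZl//; last first.
  apply: (integrable_dom _ _ (integrable_scale (\int[leb]_xi symb a s xi) (integrable_abse (integrable_pa a0 t0)))).
    by apply: measurable_funM => //; case/integrableP: (integrable_pa a0 t0) => /measurable_EFinP.
  move=> z; rewrite normrM mulrC ler_wpM2r//.
  apply: norm_Rintegral_le; last exact: integrable_symb.
    by mfun; [exact: measurable_symb|exact: measurable_dotRd].
  by move=> xi; rewrite normrM (ger0_norm (symb_ge0 _ _ _)) ler_piMr ?symb_ge0// norm_cos_le1.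
congr (_ * _).
rewrite (@Rintegral_fourier_conv _ _ (pa a t) (symb a t))//.
- by apply: eq_Rintegral => xi _; rewrite symbD.
- exact: integrable_pa.
- exact: measurable_cos.
- by move=> x; exact: norm_cos_le1.
- exact: integrable_symb.
- move=> xi v; apply: Rintegral_cos_sub; first exact: integrable_pa.
    by move=> ?; exact: pa_cos.
  by move=> ?; exact: pa_sin.
Qed.

Lemma fspD_conv i a t s (w : 'rV[R]_n) : 0 < a -> 0 < t -> 0 < s ->
  \int[leb]_z (pa a t z * fspD i a s (w - (z : 'rV[R]_n))) = fspD i a (s + t) w.
Proof.
move=> a0 t0 s0; rewrite /fspD.
rewrite (@eq_Rintegral _ _ _ _ _ (fun z : rowB R n => - ((2 * pi) ^+ n)^-1 * (pa a t z *
  \int[leb]_xi (xi 0 i * symb a s xi * sin (dotRd xi (w - (z : 'rV[R]_n))))))); last first.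
  by move=> z _; rewrite mulrCA.
have is_ := integrable_symb_moment a i s0.
have ms : measurable_fun setT (fun xi : rowB R n => xi 0 i * symb a s xi).
  by case/integrableP: is_ => /measurable_EFinP.
have mi : measurable_fun setT (fun z : rowB R n => \int[leb]_xi (xi 0 i * symb a s xi * sin (dotRd xi (w - (z : 'rV[R]_n))))).
  apply: (@measurable_Rintegral _ _ (rowB R n) (rowB R n) R leb
    (fun u : _ * rowB R n => u.2 0 i * symb a s u.2 * sin (dotRd u.2 (w - (u.1 : 'rV[R]_n))))).
  by mfun; [exact: measurable_symb|apply: measurable_dotRd => //; apply: measurable_rowD => //; exact: measurable_rowN].
rewrite RintegralZl//; last first.
  apply: (integrable_dom _ _ (integrable_scale (\int[leb]_xi `|xi 0 i * symb a s xi|) (integrable_abse (integrable_pa a0 t0)))).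
    by apply: measurable_funM => //; case/integrableP: (integrable_pa a0 t0) => /measurable_EFinP.
  move=> z; rewrite normrM mulrC ler_wpM2r//.
  apply: norm_Rintegral_le; last exact: (integrable_abse is_).
    by mfun; exact: measurable_dotRd.
  by move=> xi; rewrite normrM ler_piMr// norm_sin_le1.
congr (_ * _).
rewrite (@Rintegral_fourier_conv _ _ (pa a t) (symb a t) _ sin (fun xi : rowB R n => xi 0 i * symb a s xi))//.
- by apply: eq_Rintegral => xi _; rewrite symbD mulrA.
- exact: integrable_pa.
- exact: measurable_sin.
- by move=> x; exact: norm_sin_le1.
- move=> xi v; apply: Rintegral_sin_sub; first exact: integrable_pa.
    by move=> ?; exact: pa_cos.
  by move=> ?; exact: pa_sin.
Qed.

End Symbol.

(** * Gradient bound *)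

Section BinomialSeries.
Variables (R : realType) (g : R).
Hypothesis g01 : 0 < g < 1.

(** The Taylor coefficients (-1)^k binom(g, k) of (1 - x)^g. For 0 < g < 1 all of them but the first
    are nonpositive, so 1 - (1 - x)^g has nonnegative coefficients. *)
Fixpoint bcoef (k : nat) : R :=
  if k is k'.+1 then bcoef k' * ((k'%:R - g) / k'.+1%:R) else 1.

Lemma bcoefS k : k.+1%:R * bcoef k.+1 = (k%:R - g) * bcoef k.
Proof.
by rewrite /= [RHS]mulrC mulrCA; congr (_ * _); rewrite mulrC divfK// pnatr_eq0.
Qed.

Lemma bcoefS_le0 k : bcoef k.+1 <= 0.
Proof.
have /andP[g0 g1] := g01.
elim: k => [|k ih]; first by rewrite /= mul1r invr1 mulr1 sub0r oppr_le0 ltW.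
rewrite -[bcoef k.+2]/(bcoef k.+1 * ((k.+1%:R - g) / k.+2%:R)) mulr_le0_ge0//.
by rewrite divr_ge0// subr_ge0 (le_trans (ltW g1))// ler1n.
Qed.

Definition bsum (K : nat) (x : R) : R := \sum_(0 <= k < K.+1) bcoef k * x ^+ k.

Lemma bsumS K x : bsum K.+1 x = bsum K x + bcoef K.+1 * x ^+ K.+1.
Proof. by rewrite /bsum big_nat_recr. Qed.

Lemma bsum0 x : bsum 0 x = 1.
Proof. by rewrite /bsum big_nat1 expr0 mulr1. Qed.

Lemma bsum_x0 K : bsum K 0 = 1.
Proof.
elim: K => [|K ih]; first by rewrite bsum0.
by rewrite bsumS ih expr0n mulr0 addr0.
Qed.

(** The function (1 - x)^g satisfies (1 - x) S' = - g S; its partial sums do so up to one term of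
    top degree. *)
Lemma der_bsum K (x : R) : exists2 D, is_derive x 1 (bsum K) D &
  (1 - x) * D = - g * bsum K x + (g - K%:R) * bcoef K * x ^+ K.
Proof.
elim: K => [|K [D dD E]].
  exists 0; last by rewrite bsum0 expr0 /=; ring.
  by apply: (der_ext _ (der_cst 1 x)) => y; rewrite bsum0.
exists (D + bcoef K.+1 * (K.+1%:R * x ^+ K)).
  have dX : is_derive x 1 (fun y : R => y ^+ K.+1) (K.+1%:R * x ^+ K).
    elim: (K) => [|k ihk].
      apply: (der_ext _ (der_eq (der_id x) _)) => [y|]; first by rewrite expr1.
      by rewrite expr0 mulr1.
    have dk : is_derive x 1 (fun y : R => y * y ^+ k.+1) (k.+2%:R * x ^+ k.+1).
      by eder; rewrite /= -[k.+2%:R]natr1 !exprS; ring.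
    by apply: (der_ext _ dk) => y; rewrite [RHS]exprS.
  have dS : is_derive x 1 (fun y => bsum K y + bcoef K.+1 * y ^+ K.+1)
      (D + bcoef K.+1 * (K.+1%:R * x ^+ K)).
    by eder; rewrite /=; ring.
  by apply: (der_ext _ dS) => y; rewrite bsumS.
rewrite mulrDr E bsumS.
have -> : bcoef K.+1 * (K.+1%:R * x ^+ K) = (K%:R - g) * bcoef K * x ^+ K.
  by rewrite mulrA [bcoef _ * _]mulrC bcoefS.
have -> : (g - K.+1%:R) * bcoef K.+1 * x ^+ K.+1 =
    g * bcoef K.+1 * x ^+ K.+1 - (K%:R - g) * bcoef K * x ^+ K.+1.
  by rewrite -bcoefS; ring.
by rewrite !exprS; ring.
Qed.

(** This is the coefficient of the remainder in [der_bsum]. It starts at g (1 - g), and the ratio of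
    consecutive values is 1 - g / (K + 2). *)
Lemma bcoef_bound K : 0 <= (g - K.+1%:R) * bcoef K.+1 <= 1.
Proof.
have /andP[g0 g1] := g01.
have p k : g - k.+1%:R <= 0 by rewrite subr_le0 (le_trans (ltW g1))// ler1n.
rewrite mulr_le0 ?p ?bcoefS_le0//=.
elim: K => [|K ih]; first by rewrite /= mul1r invr1 mulr1; nra.
have -> : (g - K.+2%:R) * bcoef K.+2 =
    (1 - g / K.+2%:R) * ((g - K.+1%:R) * bcoef K.+1).
  have -> : bcoef K.+2 = ((K.+1%:R - g) * bcoef K.+1) / K.+2%:R.
    by rewrite -bcoefS mulrC mulKf// pnatr_eq0.
  have q0 : K.+2%:R != 0 :> R by rewrite pnatr_eq0.
  by move: (K.+2%:R : R) q0 (K.+1%:R : R) => q q0 q'; field.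
apply: le_trans ih; rewrite ler_piMl ?mulr_le0 ?p ?bcoefS_le0//.
by rewrite gerBl divr_ge0// ltW.
Qed.

(** Mean value theorem for S(y) (1 - y)^(-g), which is 1 at 0: by [der_bsum] its derivative is the
    remainder term times (1 - y)^(-g-1). *)
Lemma bsum_bound K (x : R) : 0 < x -> x < 1 ->
  `|bsum K.+1 x * (1 - x) `^ (- g) - 1| <= (1 - x) `^ (- g - 1) * x ^+ K.+1.
Proof.
move=> x0 x1; have /andP[g0 g1] := g01.
pose G y := bsum K.+1 y * (1 - y) `^ (- g).
pose G' y := (1 - y) `^ (- g - 1) * ((g - K.+1%:R) * bcoef K.+1 * y ^+ K.+1).
have dG (y : R) : y < 1 -> is_derive y 1 G (G' y).
  move=> y1; have [D dD E] := der_bsum K.+1 y.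
  have y10 : 0 < 1 - y by rewrite subr_gt0.
  rewrite /G; eder; first exact: y10.
  rewrite /= /G'.
  have e1 : (1 - y) `^ (- g) = (1 - y) * (1 - y) `^ (- g - 1).
    rewrite -{2}(powRr1 (ltW y10)) -powRD; first by congr (_ `^ _); ring.
    by apply/implyP => _; rewrite gt_eqF.
  have -> : (g - K.+1%:R) * bcoef K.+1 * y ^+ K.+1 = (1 - y) * D + g * bsum K.+1 y.
    by rewrite E; ring.
  by rewrite e1; ring.
have cG : {within `[0, x], continuous G}.
  apply: derivable_within_continuous => y; rewrite in_itv/= => /andP[_ yx].
  by case: (dG y (le_lt_trans yx x1)).
have dG' (y : R) : y \in `]0, x[%R -> is_derive y 1 G (G' y).
  by rewrite in_itv/= => /andP[_ yx]; apply: dG; exact: lt_trans yx x1.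
have [xi xi_in] := MVT x0 dG' cG.
move: xi_in; rewrite in_itv/= => /andP[xi0 xix].
have -> : G 0 = 1 by rewrite /G bsum_x0 mul1r subr0 powR1.
rewrite subr0 -/(G x) => ->.
have /andP[b0 b1] := bcoef_bound K.
have x10 : 0 < 1 - x by rewrite subr_gt0.
have xi10 : 0 < 1 - xi by rewrite subr_gt0 (lt_trans xix).
have m0 : 0 <= (g - K.+1%:R) * bcoef K.+1 * xi ^+ K.+1.
  by rewrite mulr_ge0// exprn_ge0// ltW.
rewrite ger0_norm; last by rewrite mulr_ge0 ?(ltW x0)// mulr_ge0 ?powR_ge0.
rewrite /G' -mulrA; apply: ler_pM; rewrite ?powR_ge0//.
- by rewrite mulr_ge0// ltW.
- rewrite -opprD !powRN lef_pV2 ?posrE ?powR_gt0//.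
  apply: ge0_ler_powR; rewrite ?nnegrE ?ltW//; first by rewrite addr_gt0.
  by rewrite ltrD2l ltrN2.
- rewrite -[leRHS]mulr1; apply: ler_pM => //; [exact: ltW| |exact: ltW].
  rewrite -[leRHS]mul1r; apply: ler_pM => //; first by rewrite exprn_ge0// ltW.
  by apply: lerXn2r; rewrite ?nnegrE ltW.
Qed.

Lemma cvg_bsum (x : R) : 0 < x -> x < 1 -> bsum K x @[K --> \oo] --> (1 - x) `^ g.
Proof.
move=> x0 x1; have x10 : 0 < 1 - x by rewrite subr_gt0.
have cv : bsum K.+1 x * (1 - x) `^ (- g) @[K --> \oo] --> (1 : R).
  apply/cvgrPdist_le => e e0.
  have : (1 - x) `^ (- g - 1) * x ^+ K.+1 @[K --> \oo] --> (0 : R).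
    rewrite -(mulr0 ((1 - x) `^ (- g - 1))); apply: cvgM; first exact: cvg_cst.
    rewrite (cvg_shiftS (fun K => x ^+ K)); apply: cvg_expr.
    by rewrite ger0_norm// ltW.
  move/cvgrPdist_le => /(_ _ e0)[N _ hN]; exists N => // k /= Nk.
  rewrite distrC; apply: le_trans (bsum_bound k x0 x1) _.
  by have := hN _ Nk; rewrite /= sub0r normrN; apply: le_trans; exact: ler_norm.
rewrite -cvg_shiftS; have -> : (1 - x) `^ g = 1 * (1 - x) `^ g by rewrite mul1r.
have -> : (fun K => bsum K.+1 x) = (fun K => bsum K.+1 x * (1 - x) `^ (- g) * (1 - x) `^ g).
  apply/funext => K; rewrite -mulrA powRN mulVf ?mulr1//.
  by rewrite gt_eqF// powR_gt0.
by apply: cvgM => //; exact: cvg_cst.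
Qed.

End BinomialSeries.

Section PowerLimit.
Variable R : realType.

Lemma cvg_powR (u : nat -> R) (l g : R) : 0 < g -> (forall k, 0 <= u k) ->
  u k @[k --> \oo] --> l -> u k `^ g @[k --> \oo] --> l `^ g.
Proof.
move=> g0 u0 ul.
have l0 : 0 <= l.
  rewrite -(cvg_lim _ ul)//; apply: limr_ge; first by apply/cvg_ex; exists l.
  by apply: nearW.
move: l0; rewrite le_eqVlt => /predU1P[l0|l0].
  (* At 0 the power need not be differentiable, so this limit is handled with the explicit radius
     e^(1/g). *)
  rewrite -l0 powR0 ?gt_eqF//; apply/cvgrPdist_lt => e e0.
  have e10 : 0 < e `^ (g^-1) by rewrite powR_gt0.
  move: ul; rewrite -l0 => /cvgrPdist_lt /(_ _ e10)[N _ hN]; exists N => // k /= /hN /=.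
  rewrite !sub0r !normrN !ger0_norm ?powR_ge0// => h.
  have -> : e = (e `^ g^-1) `^ g by rewrite -powRrM mulVf ?gt_eqF// powRr1// ltW.
  by apply: gt0_ltr_powR => //; rewrite nnegrE ?powR_ge0.
apply: (@cvg_comp _ _ _ u (fun x => x `^ g)); first exact: ul.
have : {for l, continuous (fun x : R => x `^ g)}.
  apply: differentiable_continuous; apply/derivable1_diffP.
  by have [] := is_derive1_powR g l0.
exact.
Qed.

(** Squeezed by means of 1 - y <= exp(-y) <= 1/(1 + y). The shift by 1/(k+1) keeps the exponential
    strictly below 1 even for lam = 0, as the binomial series requires. *)
Lemma cvg_onem_exp (lam : R) : 0 <= lam ->
  k.+1%:R * (1 - expR (- ((lam + k.+1%:R^-1) / k.+1%:R))) @[k --> \oo] --> lam.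
Proof.
move=> lam0.
pose h k : R := k.+1%:R^-1.
have h0 k : 0 < h k by rewrite invr_gt0.
have ch : h k @[k --> \oo] --> (0 : R) by exact: cvg_harmonic.
have cy : lam + h k @[k --> \oo] --> lam.
  have {2}-> : lam = lam + 0 by rewrite addr0.
  by apply: cvgD => //; exact: cvg_cst.
apply: (@squeeze_cvgr _ _ _ _ (fun k => (lam + h k) / (1 + (lam + h k) * h k)) (fun k => lam + h k)) => //.
- apply: nearW => k; have k0 : 0 < k.+1%:R :> R by [].
  set y := lam + _; have y0 : 0 < y by rewrite ltr_wpDl// h0.
  rewrite -/(h k) -/y.
  have e1 : expR (- (y * h k)) <= (1 + y * h k)^-1.
    rewrite expRN lef_pV2 ?posrE ?expR_gt0 ?expR_ge1Dx//.
    by rewrite addr_gt0// mulr_gt0.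
  have e2 := expR_ge1Dx (- (y * h k)).
  have hk : k.+1%:R = (h k)^-1 :> R by rewrite /h invrK.
  have p1 : 0 < 1 + y * h k by rewrite addr_gt0// mulr_gt0.
  apply/andP; split; rewrite hk.
    rewrite [leRHS]mulrC ler_pdivlMr ?invr_gt0//.
    have -> : y / (1 + y * h k) = (1 - (1 + y * h k)^-1) / h k.
      by field; rewrite !gt_eqF.
    by rewrite divfK ?gt_eqF// lerD2l lerN2.
  by rewrite [leLHS]mulrC ler_pdivrMr//; lra.
- suff : (lam + h k) / (1 + (lam + h k) * h k) @[k --> \oo] --> lam / (1 + lam * 0).
    by rewrite mulr0 addr0 divr1.
  apply: cvgM => //; apply: cvgV; first by rewrite mulr0 addr0 oner_neq0.
  by apply: cvgD; [exact: cvg_cst|exact: cvgM].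
Qed.

End PowerLimit.

Section GradientClass.
Variables (R : realType) (n : nat) (kap : R).
Hypothesis kap01 : 0 < kap < 1.
Local Notation leb := (leb R n).
Local Notation A := ((1 - kap ^+ 2)^-1).

Let kap2 : 0 < 1 - kap ^+ 2.
Proof. by have /andP[k0 k1] := kap01; rewrite subr_gt0 expr_lt1// ltW. Qed.

Let A0 : 0 < A. Proof. by rewrite invr_gt0. Qed.

(** Fourier multipliers as functions of l = |xi|^2, hence bounded on l >= 0 only. *)
Definition bmult (f : R -> R) :=
  measurable_fun [set: R] f /\ exists B, forall l, 0 <= l -> `|f l| <= B.

Definition fC (f : R -> R) (t : R) (z : 'rV[R]_n) : R :=
  \int[leb]_xi (expR (- t * dotRd xi xi) * f (dotRd xi xi) * cos (dotRd xi z)).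

Definition fS (f : R -> R) (i : 'I_n) (t : R) (z : 'rV[R]_n) : R :=
  \int[leb]_xi (xi 0 i * (expR (- t * dotRd xi xi) * f (dotRd xi xi)) * sin (dotRd xi z)).

Lemma measurable_bmult (f : R -> R) : measurable_fun [set: R] f ->
  measurable_fun setT (fun xi : rowB R n => f (dotRd xi xi)).
Proof. by move=> mf; apply: (measurableT_comp mf); exact: measurable_dotRd. Qed.

Lemma integrable_bmult f t : bmult f -> 0 < t -> leb.-integrable setT
  (EFin \o (fun xi => expR (- t * dotRd xi xi) * f (dotRd xi xi))).
Proof.
move=> [mf [B fB]] t0; have mfd := measurable_bmult mf.
apply: (integrable_dom _ _ (integrable_scale B (integrable_gauss t0 n))).
  by mfun; exact: measurable_dotRd.
move=> xi; rewrite normrM mulrC (ger0_norm (expR_ge0 _)) ler_wpM2r ?expR_ge0//.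
by rewrite fB// dotRd_ge0.
Qed.

Lemma integrable_bmult_moment f t i : bmult f -> 0 < t -> leb.-integrable setT
  (EFin \o (fun xi : rowB R n => xi 0 i * (expR (- t * dotRd xi xi) * f (dotRd xi xi)))).
Proof.
move=> [mf [B fB]] t0; have mfd := measurable_bmult mf.
apply: (integrable_dom _ _ (integrable_scale B (integrable_gauss_moment i t0))).
  by mfun; exact: measurable_dotRd.
move=> xi; rewrite !normrM (ger0_norm (expR_ge0 _)) mulrA [leRHS]mulrC.
by rewrite ler_wpM2l ?mulr_ge0 ?expR_ge0// fB// dotRd_ge0.
Qed.

Lemma integrable_fC f t z : bmult f -> 0 < t -> leb.-integrable setT
  (EFin \o (fun xi => expR (- t * dotRd xi xi) * f (dotRd xi xi) * cos (dotRd xi z))).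
Proof.
move=> bf t0; apply: integrable_mul_le1; first exact: integrable_bmult.
  by mfun; exact: measurable_dotRd.
by move=> xi; exact: norm_cos_le1.
Qed.

Lemma integrable_fS f i t z : bmult f -> 0 < t -> leb.-integrable setT
  (EFin \o (fun xi : rowB R n => xi 0 i * (expR (- t * dotRd xi xi) * f (dotRd xi xi)) * sin (dotRd xi z))).
Proof.
move=> bf t0; apply: integrable_mul_le1; first exact: integrable_bmult_moment.
  by mfun; exact: measurable_dotRd.
by move=> xi; exact: norm_sin_le1.
Qed.

(** The gradient estimate for the function with Fourier transform exp(-t |xi|^2) f(|xi|^2), up to
    powers of 2 pi. The constant is the same for all [f], so these multipliers form a convex cone
    closed under bounded pointwise limits. Evaluation at kap z leaves room for the factor |z| / t
    that differentiation of a Gaussian produces. *)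
Definition gradP f := bmult f /\ forall t z i, 0 < t ->
  `|fS f i t z| <= A * (Num.sqrt t)^-1 * fC f t (kap *: z).

Lemma gradP_fC_ge0 f t (z : 'rV[R]_n) (i : 'I_n) : gradP f -> 0 < t -> 0 <= fC f t (kap *: z).
Proof.
move=> [_ h] t0; have := le_trans (normr_ge0 _) (h t z i t0).
by rewrite pmulr_rge0// mulr_gt0// invr_gt0 sqrtr_gt0.
Qed.

Lemma bmult_cst c : bmult (fun=> c).
Proof. by split; [exact: measurable_cst|exists `|c|]. Qed.

Lemma fC_cst1 t z : 0 < t ->
  fC (fun=> 1) t z = Num.sqrt (pi / t) ^+ n * expR (- (4 * t)^-1 * dotRd z z).
Proof.
move=> t0; have := gauss_fourier t0 z 0; rewrite cos0 mul1r => <-.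
by apply: eq_Rintegral => xi _; rewrite addr0 mulr1 mulrC.
Qed.

(** The i-th derivative of the Gaussian computed twice: under the integral sign and from the closed
    form. *)
Lemma fS_cst1 i t (z : 'rV[R]_n) : 0 < t ->
  fS (fun=> 1) i t z = z 0 i / (2 * t) * fC (fun=> 1) t z.
Proof.
move=> t0; have b1 := bmult_cst 1.
have D : derive (fC (fun=> 1) t) z (delta_mx 0 i) = - fS (fun=> 1) i t z.
  exact: (derive_fourier_cos z (integrable_bmult b1 t0) (integrable_bmult_moment i b1 t0)).
rewrite -[LHS]opprK -D.
rewrite (_ : fC (fun=> 1) t = fun w => Num.sqrt (pi / t) ^+ n * expR (- (4 * t)^-1 * dotRd w w)); last first.
  by apply/funext => w; rewrite fC_cst1.
rewrite derive_line.
set K := Num.sqrt (pi / t) ^+ n.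
have dK : is_derive (0 : R) 1 (fun s : R => K * expR (- (4 * t)^-1 * (s * s + 2 * s * z 0 i + dotRd z z)))
    (- (z 0 i / (2 * t) * (K * expR (- (4 * t)^-1 * dotRd z z)))).
  by eder; rewrite /= !(mul0r, mulr0, add0r, addr0); field; rewrite gt_eqF.
rewrite -[RHS]opprK -(der_derive1 dK); congr (- derive1 _ 0); apply/funext => s.
congr (_ * expR (_ * _)); rewrite dotRd_line !mxE !eqxx mulr1 dotRdC dotRd_line; ring.
Qed.

(** With y = |z| / sqrt t and delta = 1 - kap^2, the gradient brings a factor y/2, and passing from
    z to kap z gains exp(delta y^2 / 4) >= 1 + delta y^2 / 4 >= delta y / 2. *)
Lemma gradP_cst1 : gradP (fun=> 1).
Proof.
split=> [|t z i t0]; first exact: bmult_cst.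
have st : 0 < Num.sqrt t by rewrite sqrtr_gt0.
have tE : t = Num.sqrt t ^+ 2 by rewrite sqr_sqrtr// ltW.
rewrite fS_cst1// !fC_cst1// !dotRdZl [dotRd z (kap *: z)]dotRdC dotRdZl -sqr_euclid.
set K := Num.sqrt (pi / t) ^+ n; have K0 : 0 <= K by rewrite exprn_ge0// sqrtr_ge0.
set r := euclid z; set y := r / Num.sqrt t.
have r0 : 0 <= r := euclid_ge0 z.
have y0 : 0 <= y by rewrite divr_ge0// ltW.
set E := expR (- (4 * t)^-1 * (kap * (kap * r ^+ 2))).
have -> : expR (- (4 * t)^-1 * r ^+ 2) = expR (- ((1 - kap ^+ 2) / 4 * y ^+ 2)) * E.
  rewrite /E -expRD /y; congr expR; rewrite {1 3}tE; field; rewrite gt_eqF//.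
rewrite normrM normrM (ger0_norm (_ : 0 <= K * _)); last by rewrite !mulr_ge0 ?expR_ge0.
have -> : A * (Num.sqrt t)^-1 * (K * E) = K * E * (A * (Num.sqrt t)^-1) by ring.
have -> u : u * (K * (expR (- ((1 - kap ^+ 2) / 4 * y ^+ 2)) * E)) =
   K * E * (u * expR (- ((1 - kap ^+ 2) / 4 * y ^+ 2))) by ring.
rewrite ler_wpM2l ?mulr_ge0 ?expR_ge0// expRN ler_pdivrMr ?expR_gt0//.
rewrite normfV (gtr0_norm (mulr_gt0 _ t0))//.
apply: (@le_trans _ _ (r / (2 * t))).
  by rewrite ler_wpM2r ?coord_le_euclid// invr_ge0 mulr_ge0// ltW.
have -> : r / (2 * t) = (Num.sqrt t)^-1 * (y / 2).
  by rewrite /y {1}tE; field; rewrite gt_eqF.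
set e := expR _; have -> : A / Num.sqrt t * e = (Num.sqrt t)^-1 * (A * e) by ring.
rewrite ler_wpM2l ?invr_ge0 ?(ltW st)// /e => {e}.
have := expR_ge1Dx ((1 - kap ^+ 2) / 4 * y ^+ 2) => h.
rewrite [leRHS]mulrC ler_pdivlMr//.
apply: le_trans h.
have := kap2; set d := 1 - kap ^+ 2 => d0.
have d1 : d <= 1 by rewrite /d gerBl sqr_ge0.
have : 0 <= (1 - y) ^+ 2 by exact: sqr_ge0.
nra.
Qed.

(** The factor exp(-v l) only replaces t by t + v, and (t + v)^(-1/2) <= t^(-1/2). This is why
    [gradP] quantifies over all t. *)
Lemma gradP_expM v f : 0 <= v -> gradP f -> gradP (fun l => expR (- (v * l)) * f l).
Proof.
move=> v0 [[mf [B fB]] h]; have bf : bmult f by split; [|exists B].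
split.
  split; first by mfun.
  exists B => l l0; rewrite normrM -[leRHS]mul1r ler_pM// ?fB//.
  by rewrite ger0_norm ?expR_ge0// -expR0 ler_expR oppr_le0 mulr_ge0.
move=> t z i t0; have tv : 0 < t + v by rewrite ltr_pwDl.
have -> : fS (fun l => expR (- (v * l)) * f l) i t z = fS f i (t + v) z.
  apply: eq_Rintegral => xi _; congr (_ * _ * _); rewrite mulrA -expRD; congr (expR _ * _); ring.
have -> : fC (fun l => expR (- (v * l)) * f l) t (kap *: z) = fC f (t + v) (kap *: z).
  apply: eq_Rintegral => xi _; congr (_ * _); rewrite mulrA -expRD; congr (expR _ * _); ring.
apply: le_trans (h _ z i tv) _.
apply: ler_wpM2r; first by apply: (@gradP_fC_ge0 f (t + v) z i) => //; split.
rewrite ler_pM2l// lef_pV2 ?posrE ?sqrtr_gt0// ler_wsqrtr// lerDl//.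
Qed.

Lemma gradP_add f g : gradP f -> gradP g -> gradP (fun l => f l + g l).
Proof.
move=> [bf hf] [bg hg]; have [mf [B fB]] := bf; have [mg [B' gB']] := bg.
split.
  split; first by mfun.
  by exists (B + B') => l l0; rewrite (le_trans (ler_normD _ _))// lerD ?fB ?gB'.
move=> t z i t0.
have -> : fS (fun l => f l + g l) i t z = fS f i t z + fS g i t z.
  rewrite /fS -RintegralD//; [|exact: integrable_fS..].
  by apply: eq_Rintegral => xi _; ring.
have -> : fC (fun l => f l + g l) t (kap *: z) = fC f t (kap *: z) + fC g t (kap *: z).
  rewrite /fC -RintegralD//; [|exact: integrable_fC..].
  by apply: eq_Rintegral => xi _; ring.
apply: le_trans (ler_normD _ _) _.
by rewrite mulrDr; apply: lerD; [exact: hf|exact: hg].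
Qed.

Lemma gradP_scale c f : 0 <= c -> gradP f -> gradP (fun l => c * f l).
Proof.
move=> c0 [bf hf]; have [mf [B fB]] := bf.
split.
  split; first by mfun.
  by exists (c * B) => l l0; rewrite normrM (ger0_norm c0) ler_wpM2l ?fB.
move=> t z i t0.
have -> : fS (fun l => c * f l) i t z = c * fS f i t z.
  rewrite /fS -RintZ; last exact: integrable_fS.
  by apply: eq_Rintegral => xi _; ring.
have -> : fC (fun l => c * f l) t (kap *: z) = c * fC f t (kap *: z).
  rewrite /fC -RintZ; last exact: integrable_fC.
  by apply: eq_Rintegral => xi _; ring.
by rewrite mulrCA normrM (ger0_norm c0) ler_wpM2l// hf.
Qed.

Lemma gradP_lim (f_ : nat -> R -> R) (f : R -> R) B :
  (forall k, gradP (f_ k)) -> measurable_fun setT f ->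
  (forall k l, 0 <= l -> `|f_ k l| <= B) ->
  (forall l, 0 <= l -> f_ k l @[k --> \oo] --> f l) -> gradP f.
Proof.
move=> hf mf fB ff.
have mf_ k : measurable_fun setT (f_ k) by have [[]] := hf k.
have bf : bmult f.
  split=> //; exists B => l l0.
  have cv : `|f_ k l| @[k --> \oo] --> `|f l| by apply: cvg_norm; exact: ff.
  rewrite -(cvg_lim _ cv)//; apply: limr_le; first by apply/cvg_ex; eexists; exact: cv.
  by apply: nearW => k; exact: fB.
have mfd := measurable_bmult mf.
have mfd_ k := measurable_bmult (mf_ k).
split=> // t z i t0.
have cS : fS (f_ k) i t z @[k --> \oo] --> fS f i t z.
  apply: (@Rintegral_dcvg _ _ _ leb
    (fun k xi => xi 0 i * (expR (- t * dotRd xi xi) * f_ k (dotRd xi xi)) * sin (dotRd xi z)) _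
    (fun xi : rowB R n => B * (`|xi 0 i| * expR (- t * dotRd xi xi)))).
  - by move=> k; have ? := mfd_ k; mfun; exact: measurable_dotRd.
  - by mfun; exact: measurable_dotRd.
  - move=> xi; apply: cvgM; last exact: cvg_cst.
    apply: cvgM; first exact: cvg_cst.
    by apply: cvgM; [exact: cvg_cst|apply: ff; exact: dotRd_ge0].
  - by apply: integrable_scale; exact: integrable_gauss_moment.
  - move=> k xi; rewrite normrM; apply: le_trans (ler_piMr _ (norm_sin_le1 _)) _ => //.
    rewrite !normrM (ger0_norm (expR_ge0 _)) mulrA [leRHS]mulrC.
    by rewrite ler_wpM2l ?mulr_ge0 ?expR_ge0// fB// dotRd_ge0.
have cC : fC (f_ k) t (kap *: z) @[k --> \oo] --> fC f t (kap *: z).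
  apply: (@Rintegral_dcvg _ _ _ leb
    (fun k xi => expR (- t * dotRd xi xi) * f_ k (dotRd xi xi) * cos (dotRd xi (kap *: z))) _
    (fun xi : rowB R n => B * expR (- t * dotRd xi xi))).
  - by move=> k; have ? := mfd_ k; mfun; exact: measurable_dotRd.
  - by mfun; exact: measurable_dotRd.
  - move=> xi; apply: cvgM; last exact: cvg_cst.
    by apply: cvgM; [exact: cvg_cst|apply: ff; exact: dotRd_ge0].
  - by apply: integrable_scale; exact: integrable_gauss.
  - move=> k xi; rewrite normrM; apply: le_trans (ler_piMr _ (norm_cos_le1 _)) _ => //.
    rewrite !normrM (ger0_norm (expR_ge0 _)) [leRHS]mulrC.
    by rewrite ler_wpM2l ?expR_ge0// fB// dotRd_ge0.
have cC' : A * (Num.sqrt t)^-1 * fC (f_ k) t (kap *: z) @[k --> \oo] -->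
    A * (Num.sqrt t)^-1 * fC f t (kap *: z) by apply: cvgM => //; exact: cvg_cst.
have cS' : `|fS (f_ k) i t z| @[k --> \oo] --> `|fS f i t z| by apply: cvg_norm.
rewrite -(cvg_lim _ cS')// -(cvg_lim _ cC')//.
apply: ler_lim; [exact: cvgP cS'|exact: cvgP cC'|].
by apply: nearW => k; have [_] := hf k; apply.
Qed.

(** Multipliers that preserve [gradP] compose, hence are closed under products as well as sums. This
    gives access to power series in exp(-v l) and to exponentials of such series. *)
Definition gradM (g : R -> R) := bmult g /\ forall f, gradP f -> gradP (fun l => g l * f l).

Lemma gradM_expM v : 0 <= v -> gradM (fun l => expR (- (v * l))).
Proof.
move=> v0; split; last by move=> f; exact: gradP_expM.
split; first by mfun.
by exists 1 => l l0; rewrite ger0_norm ?expR_ge0// -expR0 ler_expR oppr_le0 mulr_ge0.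
Qed.

Lemma gradM_cst c : 0 <= c -> gradM (fun=> c).
Proof. by move=> c0; split; [exact: bmult_cst|move=> f; exact: gradP_scale]. Qed.

Lemma gradM_mul g h : gradM g -> gradM h -> gradM (fun l => g l * h l).
Proof.
move=> [[mg [B gB]] hg] [[mh [B' hB]] hh]; split.
  split; first by mfun.
  by exists (B * B') => l l0; rewrite normrM ler_pM ?gB ?hB.
move=> f /hh /hg; congr gradP; apply/funext => l; exact: mulrA.
Qed.

Lemma gradM_add g h : gradM g -> gradM h -> gradM (fun l => g l + h l).
Proof.
move=> [[mg [B gB]] hg] [[mh [B' hB]] hh]; split.
  split; first by mfun.
  by exists (B + B') => l l0; rewrite (le_trans (ler_normD _ _))// lerD ?gB ?hB.
move=> f fP; have := gradP_add (hg _ fP) (hh _ fP).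
by congr gradP; apply/funext => l; rewrite mulrDl.
Qed.

Lemma gradM_lim (g_ : nat -> R -> R) (g : R -> R) B :
  (forall k, gradM (g_ k)) -> measurable_fun setT g ->
  (forall k l, 0 <= l -> `|g_ k l| <= B) ->
  (forall l, 0 <= l -> g_ k l @[k --> \oo] --> g l) -> gradM g.
Proof.
move=> hg mg gB gg; split.
  split=> //; exists B => l l0.
  have cv : `|g_ k l| @[k --> \oo] --> `|g l| by apply: cvg_norm; exact: gg.
  rewrite -(cvg_lim _ cv)//; apply: limr_le; first by apply/cvg_ex; eexists; exact: cv.
  by apply: nearW => k; exact: gB.
move=> f fP; have [[mf [B' fB]] _] := fP.
apply: (@gradP_lim (fun k l => g_ k l * f l) _ (B * B')).
- by move=> k; have [_] := hg k; apply.
- by mfun.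
- by move=> k l l0; rewrite normrM ler_pM ?gB ?fB.
- by move=> l l0; apply: cvgM; [exact: gg|exact: cvg_cst].
Qed.

Lemma gradM_exp1 k v w : 0 <= v -> 0 <= w -> gradM (fun l => expR (- (v * l + w)) ^+ k).
Proof.
move=> v0 w0; elim: k => [|k ih].
  by have := gradM_cst (@ler01 R); congr gradM; apply/funext => l; rewrite expr0.
have := gradM_mul (gradM_mul (gradM_cst (expR_ge0 (- w))) (gradM_expM v0)) ih.
by congr gradM; apply/funext => l; rewrite exprS opprD expRD [expR (- w) * _]mulrC.
Qed.

(** The partial sums of the exponential series have nonnegative coefficients, and exp B bounds them
    uniformly when |g| <= B. *)
Lemma gradM_exp g : gradM g -> gradM (fun l => expR (g l)).
Proof.
move=> gM; have [[mg [B gB]] _] := gM.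
pose s_ K l := series (exp_coeff (g l)) K.
have sS K l : s_ K.+1 l = s_ K l + g l ^+ K / K`!%:R.
  by rewrite /s_ !seriesEnat/= big_nat_recr.
have gk k : gradM (fun l => g l ^+ k).
  elim: k => [|k ih]; first by have := gradM_cst (@ler01 R); congr gradM; apply/funext => l; rewrite expr0.
  by have := gradM_mul gM ih; congr gradM; apply/funext => l; rewrite exprS.
have sM K : gradM (s_ K).
  elim: K => [|K ih].
    have := gradM_cst (lexx (0 : R)); congr gradM; apply/funext => l.
    by rewrite /s_ seriesEnat/= big_geq.
  have fi : (0 : R) <= (K`!%:R)^-1 by rewrite invr_ge0.
  have := gradM_add ih (gradM_mul (gk K) (gradM_cst fi)).
  by congr gradM; apply/funext => l; rewrite sS.
apply: (gradM_lim (B := expR B) sM); first by mfun.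
- move=> K l l0; have cvB := is_cvg_series_exp_coeff B.
  have B0 : 0 <= B by exact: le_trans (normr_ge0 _) (gB _ l0).
  apply: (@le_trans _ _ (series (exp_coeff B) K)).
    rewrite /s_ !seriesEnat/=; apply: le_trans (ler_norm_sum _ _ _) _.
    apply: ler_sum => k _; rewrite /exp_coeff/= normrM normrX.
    have f0 : (0 : R) <= (k`!%:R)^-1 by rewrite invr_ge0.
    rewrite (ger0_norm f0) ler_wpM2r ?invr_ge0//; apply: lerXn2r; rewrite ?nnegrE//; exact: gB.
  apply: nondecreasing_cvgn_le => //.
  apply/nondecreasing_seqP => k; rewrite !seriesEnat/= big_nat_recr//= lerDl.
  by rewrite divr_ge0// exprn_ge0.
- by move=> l l0; exact: is_cvg_series_exp_coeff.
Qed.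

(** Written as exp(-c) exp(c (1 - (1 - x)^g)), so that after the constant factor the exponent is a
    power series in x with nonnegative coefficients. Its partial sums increase and stay in
    [0, 1]. *)
Lemma gradM_onem_pow g k c : 0 < g < 1 -> 0 <= c ->
  gradM (fun l => expR (- (c * (1 - expR (- ((l + k.+1%:R^-1) / k.+1%:R))) `^ g))).
Proof.
move=> g01 c0; set h : R := k.+1%:R^-1; have h0 : 0 < h by rewrite invr_gt0.
pose x l := expR (- ((l + h) * h)).
have x0 l : 0 < x l by exact: expR_gt0.
have x1 l : 0 <= l -> x l < 1.
  by move=> l0; rewrite -expR0 ltr_expR oppr_lt0 mulr_gt0// ltr_wpDl.
have xM j : gradM (fun l => x l ^+ j).
  have := gradM_exp1 j (ltW h0) (ltW (mulr_gt0 h0 h0)); congr gradM.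
  by apply/funext => l; rewrite /x mulrDl [h * l]mulrC.
have uM K : gradM (fun l => 1 - bsum g K (x l)).
  elim: K => [|K ih].
    have := gradM_cst (lexx (0 : R)); congr gradM; apply/funext => l.
    by rewrite bsum0 subrr.
  have b0 : 0 <= - bcoef g K.+1 by rewrite oppr_ge0 bcoefS_le0.
  have := gradM_add ih (gradM_mul (gradM_cst b0) (xM K.+1)).
  by congr gradM; apply/funext => l; rewrite bsumS; ring.
have mx : measurable_fun setT x by rewrite /x; mfun.
have u01 K l : 0 <= l -> 0 <= 1 - bsum g K (x l) <= 1.
  move=> l0; have xx := x1 _ l0; have cv := cvg_bsum g01 (x0 l) xx.
  have dec : nonincreasing_seq (fun K => bsum g K (x l)).
    apply/nonincreasing_seqP => j; rewrite bsumS gerDl mulr_le0_ge0 ?bcoefS_le0//.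
    by rewrite exprn_ge0// ltW.
  apply/andP; split.
    rewrite subr_ge0; have := dec 0%N K (leq0n _); rewrite bsum0; exact.
  rewrite gerBl; have := nonincreasing_cvgn_ge dec (cvgP _ cv) K.
  by rewrite (cvg_lim _ cv)//; apply: le_trans; exact: powR_ge0.
have vM : gradM (fun l => 1 - (1 - x l) `^ g).
  apply: (gradM_lim (B := 1) uM); first by mfun.
    by move=> K l l0; have /andP[? ?] := u01 K l l0; rewrite ger0_norm.
  move=> l l0; apply: cvgB; first exact: cvg_cst.
  exact: cvg_bsum (x1 _ l0).
have := gradM_mul (gradM_exp (gradM_mul (gradM_cst c0) vM)) (gradM_cst (expR_ge0 (- c))).
by congr gradM; apply/funext => l; rewrite -expRD; congr expR; rewrite /x; ring.
Qed.

(* [l `^ g] is the limit of [m `^ g * (1 - x) `^ g] with [x = exp (- (l + 1/m) / m) < 1],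
   and [1 - (1 - x) `^ g] is a power series in [x] with nonnegative coefficients. *)
Lemma gradP_expR_powR g c : 0 < g < 1 -> 0 <= c ->
  gradP (fun l => expR (- (c * l `^ g))).
Proof.
move=> g01 c0; have /andP[g0 g1] := g01.
suff : gradM (fun l => expR (- (c * l `^ g))).
  move=> [_ /(_ _ gradP_cst1)]; congr gradP; apply/funext => l; exact: mulr1.
pose f_ k l := expR (- (c * k.+1%:R `^ g * (1 - expR (- ((l + k.+1%:R^-1) / k.+1%:R))) `^ g)).
apply: (gradM_lim (g_ := f_) (B := 1)).
- by move=> k; apply: gradM_onem_pow => //; rewrite mulr_ge0// powR_ge0.
- by mfun.
- move=> k l l0; rewrite ger0_norm ?expR_ge0// -expR0 ler_expR oppr_le0.
  by rewrite !mulr_ge0 ?powR_ge0.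
- move=> l l0; apply: (@cvg_comp _ _ _ (fun k => - (c * k.+1%:R `^ g *
      (1 - expR (- ((l + k.+1%:R^-1) / k.+1%:R))) `^ g)) expR); last exact: continuous_expR.
  apply: cvgN.
  pose u k : R := k.+1%:R * (1 - expR (- ((l + k.+1%:R^-1) / k.+1%:R))).
  have e0 k : 0 <= 1 - expR (- ((l + k.+1%:R^-1) / k.+1%:R)) :> R.
    by rewrite subr_ge0 -expR0 ler_expR oppr_le0 divr_ge0// addr_ge0// invr_ge0.
  have -> : (fun k => c * k.+1%:R `^ g * (1 - expR (- ((l + k.+1%:R^-1) / k.+1%:R))) `^ g) =
      (fun k => c * u k `^ g).
    by apply/funext => k; rewrite /u powRM// mulrA.
  apply: cvgM; first exact: cvg_cst.
  apply: cvg_powR => //; last exact: cvg_onem_exp.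
  by move=> k; rewrite mulr_ge0.
Qed.

Lemma fspD_le (alpha a t : R) (i : 'I_n) (z : 'rV[R]_n) : 0 < alpha < 2 -> 0 < t ->
  `|fspD alpha i a t z| <= A * (Num.sqrt t)^-1 * fsp alpha a t (kap *: z).
Proof.
move=> /andP[al0 al2] t0.
have al01 : 0 < alpha / 2 < 1 by apply/andP; split; lra.
have ta : 0 <= t * a `^ alpha by rewrite mulr_ge0 ?powR_ge0// ltW.
(* Since |xi|^alpha is the power alpha/2 of |xi|^2, the stable part of the symbol is a multiplier in
   [gradP]. It depends on t through its constant, and the estimate is used at that same t. *)
have [_ /(_ t z i t0)] := gradP_expR_powR al01 ta.
have E xi : symb alpha a t xi = expR (- t * dotRd xi xi) *
    expR (- (t * a `^ alpha * dotRd xi xi `^ (alpha / 2))) :> R.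
  rewrite /symb -expRD sqr_euclid; congr expR.
  have -> : euclid xi `^ alpha = dotRd xi xi `^ (alpha / 2).
    rewrite /euclid -powR12_sqrt ?dotRd_ge0// -powRrM; congr (_ `^ _).
    by rewrite mulrC.
  by ring.
have pin : 0 < ((2 * pi) ^+ n)^-1 :> R by rewrite invr_gt0 exprn_gt0// mulr_gt0// pi_gt0.
rewrite /fspD /fsp normrM normrN (gtr0_norm pin) mulrCA ler_pM2l//.
rewrite /fS /fC.
under [X in `|X| <= _ -> _]eq_Rintegral do rewrite -E.
by under [X in _ <= _ * X -> _]eq_Rintegral do rewrite -E.
Qed.

End GradientClass.

(** * Kernel inequalities *)

Section Euclid.
Variables (R : realType) (n : nat).
Implicit Types u v w : 'rV[R]_n.

Lemma dotRdZr c u v : dotRd u (c *: v) = c * dotRd u v.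
Proof. by rewrite dotRdC dotRdZl dotRdC. Qed.

Lemma dotRdDr u v w : dotRd u (v + w) = dotRd u v + dotRd u w.
Proof. by rewrite dotRdC dotRdDl ![dotRd _ u]dotRdC. Qed.

Lemma euclidZ c u : euclid (c *: u) = `|c| * euclid u.
Proof.
by rewrite /euclid dotRdZl dotRdZr mulrA -expr2 sqrtrM ?sqr_ge0// sqrtr_sqr.
Qed.

Lemma euclid_eq0 u : euclid u = 0 -> u = 0.
Proof.
move=> u0; apply/rowP => i; rewrite mxE; apply/eqP; rewrite -normr_le0 -u0.
exact: coord_le_euclid.
Qed.

Lemma euclid0 : euclid (0 : 'rV[R]_n) = 0.
Proof. by rewrite -(scale0r (0 : 'rV[R]_n)) euclidZ normr0 mul0r. Qed.

Lemma euclid_gt0 u : u != 0 -> 0 < euclid u.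
Proof.
move=> u0; rewrite lt_neqAle euclid_ge0 andbT eq_sym.
by apply: contra_neq u0; exact: euclid_eq0.
Qed.

Lemma cauchy_schwarz u v : dotRd u v <= euclid u * euclid v.
Proof.
have [v0|/euclid_gt0 v0] := eqVneq v 0.
  by rewrite v0 euclid0 mulr0 -(scale0r (0 : 'rV[R]_n)) dotRdZr mul0r.
have := dotRd_ge0 (euclid v ^+ 2 *: u - dotRd u v *: v).
rewrite !(dotRdDl, dotRdDr, =^~ scaleNr, dotRdZl, dotRdZr) [dotRd v u]dotRdC -!sqr_euclid.
set U := euclid u; set V := euclid v in v0 *; set D := dotRd u v => h.
have {}h : 0 <= V ^+ 2 * (U ^+ 2 * V ^+ 2 - D ^+ 2).
  by apply: le_trans h _; rewrite le_eqVlt; apply/orP; left; apply/eqP; ring.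
rewrite pmulr_rge0 ?exprn_gt0// subr_ge0 -exprMn in h.
apply: le_trans (ler_norm _) _.
rewrite -(@ler_pXn2r _ 2)// ?nnegrE ?mulr_ge0 ?euclid_ge0//.
by rewrite real_normK ?num_real.
Qed.

Lemma euclidD u v : euclid (u + v) <= euclid u + euclid v.
Proof.
rewrite -(@ler_pXn2r _ 2)// ?nnegrE ?addr_ge0 ?euclid_ge0//.
rewrite sqr_euclid !(dotRdDl, dotRdDr) [dotRd v u]dotRdC sqrrD -!sqr_euclid.
have := cauchy_schwarz u v; rewrite -mulr_natr; lra.
Qed.

Lemma euclid_le_sum u : euclid u <= \sum_(i < n) `|u 0 i|.
Proof.
have s0 : 0 <= \sum_(i < n) `|u 0 i| by apply: sumr_ge0.
rewrite -(@ler_pXn2r _ 2)// ?nnegrE ?euclid_ge0// sqr_euclid expr2 mulr_suml.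
apply: ler_sum => i _; rewrite -expr2 -real_normK ?num_real// expr2.
by rewrite ler_wpM2l// (bigD1 i)//= lerDl sumr_ge0.
Qed.

(** The difference of the two sides is |s u - r v|^2 / (r s (r + s)). *)
Lemma sqr_euclid_convex u v (r s : R) : 0 < r -> 0 < s ->
  euclid (u + v) ^+ 2 / (r + s) <= euclid u ^+ 2 / r + euclid v ^+ 2 / s.
Proof.
move=> r0 s0; have := dotRd_ge0 (s *: u - r *: v).
rewrite !sqr_euclid !(dotRdDl, dotRdDr, =^~ scaleNr, dotRdZl, dotRdZr) [dotRd v u]dotRdC.
set U := dotRd u u; set V := dotRd v v; set D := dotRd u v => h.
have rs : 0 < r + s by rewrite addr_gt0.
have E : U / r + V / s - (U + D + (D + V)) / (r + s) =
  (s * (s * U + - r * D) + - r * (s * D + - r * V)) / (r * s * (r + s)).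
  by field; rewrite !gt_eqF.
rewrite -subr_ge0 E divr_ge0//; last by rewrite !mulr_ge0// ltW.
by apply: le_trans h _; rewrite le_eqVlt; apply/orP; left; apply/eqP; ring.
Qed.

End Euclid.

Section Kernels.
Variables (R : realType) (n : nat) (alpha : R).
Hypothesis al0 : 0 < alpha.
Hypothesis al2 : alpha < 2.
Local Notation p := (n%:R + alpha).
Implicit Types (u v z w : 'rV[R]_n) (a b r s t : R).

(** A replacement for the minimum in q^a by a single power: [th a t] times [Hk t z] is a^alpha t
    (sqrt t + |z|)^(-n-alpha). All dependence on a sits in [th], while the integral of [Hk] over
    space is bounded uniformly in t. *)
Definition Hk t z : R := t `^ (alpha / 2) * (Num.sqrt t + euclid z) `^ (- p).
Definition Gk b t z : R := t `^ (- (n%:R / 2)) * expR (- b * euclid z ^+ 2 / t).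
Definition th a t : R := a `^ alpha * t `^ (1 - alpha / 2).
Definition Qk a b t z : R := Gk b t z + th a t * Hk t z.

Lemma p_gt0 : 0 < p. Proof. by rewrite ltr_wpDl. Qed.

Lemma Hk_ge0 t z : 0 <= Hk t z. Proof. by rewrite mulr_ge0 ?powR_ge0. Qed.
Lemma Gk_ge0 b t z : 0 <= Gk b t z. Proof. by rewrite mulr_ge0 ?powR_ge0 ?expR_ge0. Qed.
Lemma th_ge0 a t : 0 <= th a t. Proof. by rewrite mulr_ge0 ?powR_ge0. Qed.
Lemma Qk_ge0 a b t z : 0 <= Qk a b t z.
Proof. by apply: addr_ge0; [exact: Gk_ge0|apply: mulr_ge0; [exact: th_ge0|exact: Hk_ge0]]. Qed.

Lemma HkN t z : Hk t (- z) = Hk t z. Proof. by rewrite /Hk euclidN. Qed.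

Lemma powR_antitone (x y q : R) : 0 <= q -> 0 < x -> x <= y -> y `^ (- q) <= x `^ (- q).
Proof.
move=> q0 x0 xy; have y0 := lt_le_trans x0 xy.
rewrite !powRN lef_pV2 ?posrE ?powR_gt0//.
by apply: ge0_ler_powR => //; rewrite nnegrE ltW.
Qed.

Lemma HkE t z : 0 < t ->
  Hk t z = t `^ (- (n%:R / 2)) * (1 + euclid z / Num.sqrt t) `^ (- p).
Proof.
move=> t0; have st : 0 < Num.sqrt t by rewrite sqrtr_gt0.
rewrite /Hk; have -> : Num.sqrt t + euclid z = Num.sqrt t * (1 + euclid z / Num.sqrt t).
  by field; rewrite gt_eqF.
rewrite powRM ?(ltW st)//; last by rewrite addr_ge0 ?divr_ge0 ?euclid_ge0 ?ltW.
rewrite mulrA; congr (_ * _); rewrite -powR12_sqrt ?ltW// -powRrM -powRD.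
  by congr (_ `^ _); field.
by apply/implyP => _; rewrite gt_eqF.
Qed.

(** The quantity sqrt(r + s) + |u + v| is at most the sum of the two given ones, hence at most twice
    the larger. *)
Lemma Hk_3P1 r s u v : 0 < r -> 0 < s ->
  Num.sqrt s + euclid v <= Num.sqrt r + euclid u ->
  Hk r u <= 2 `^ p * Hk (r + s) (u + v).
Proof.
move=> r0 s0 h; have p0 := p_gt0.
set A := Num.sqrt r + _ in h *; set B := Num.sqrt s + _ in h.
have A0 : 0 < A by rewrite ltr_pwDl ?sqrtr_gt0 ?euclid_ge0.
have rs : 0 < r + s by rewrite addr_gt0.
set T := Num.sqrt (r + s) + euclid (u + v).
have T0 : 0 < T by rewrite ltr_pwDl ?sqrtr_gt0 ?euclid_ge0.
have sq : Num.sqrt (r + s) <= Num.sqrt r + Num.sqrt s.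
  rewrite -(@ler_pXn2r _ 2)// ?nnegrE ?addr_ge0 ?sqrtr_ge0//.
  rewrite sqr_sqrtr ?(ltW rs)// sqrrD !sqr_sqrtr ?(ltW r0) ?(ltW s0)//.
  have : 0 <= Num.sqrt r * Num.sqrt s by rewrite mulr_ge0 ?sqrtr_ge0.
  by rewrite -mulr_natr; lra.
have TA : T / 2 <= A.
  rewrite ler_pdivrMr//; have := euclidD u v; rewrite /T /A /B in h *; lra.
rewrite /Hk mulrCA; apply: ler_pM; rewrite ?powR_ge0//.
  by apply: ge0_ler_powR; rewrite ?nnegrE ?(ltW r0) ?(ltW rs) ?lerDl ?(ltW s0) ?divr_ge0// ltW.
apply: (@le_trans _ _ ((T / 2) `^ (- p))).
  by apply: powR_antitone; rewrite ?(ltW p0)// divr_gt0.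
rewrite powRM ?invr_ge0 ?(ltW T0)// mulrC le_eqVlt; apply/orP; left; apply/eqP; congr (_ * _).
by rewrite -powR_inv1// -powRrM; congr (_ `^ _); ring.
Qed.

Lemma Hk_3P r s u v : 0 < r -> 0 < s ->
  Hk r u * Hk s v <= 2 `^ p * Hk (r + s) (u + v) * (Hk r u + Hk s v).
Proof.
move=> r0 s0.
have [h|/ltW h] := leP (Num.sqrt s + euclid v) (Num.sqrt r + euclid u).
  apply: le_trans (ler_wpM2r (Hk_ge0 _ _) (Hk_3P1 r0 s0 h)) _.
  apply: ler_wpM2l; last by rewrite lerDr Hk_ge0.
  by apply: mulr_ge0; [exact: powR_ge0|exact: Hk_ge0].
have := Hk_3P1 s0 r0 h; rewrite [s + r]addrC [v + u]addrC => h'.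
rewrite mulrC; apply: le_trans (ler_wpM2r (Hk_ge0 _ _) h') _.
apply: ler_wpM2l; last by rewrite lerDl Hk_ge0.
by apply: mulr_ge0; [exact: powR_ge0|exact: Hk_ge0].
Qed.

(** Since n + alpha < 2 (n + 2), one has (1 + y)^(n+alpha) <= (2 (1 + y^2))^(n+2), and this power is
    controlled by the term of order n + 2 in the series of exp(b (1 + y^2)). *)
Definition GH b : R := 2 ^+ n.+2 * (n.+2)`!%:R / b ^+ n.+2 * expR b.

Lemma GH_gt0 b : 0 < b -> 0 < GH b.
Proof.
move=> b0; apply: mulr_gt0; last exact: expR_gt0.
apply: divr_gt0; last exact: exprn_gt0.
by apply: mulr_gt0; [exact: exprn_gt0|rewrite ltr0n fact_gt0].
Qed.

Lemma GH_ge0 b : 0 < b -> 0 <= GH b.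
Proof. by move=> /GH_gt0 /ltW. Qed.

Lemma powR_le_gauss b (y : R) : 0 < b -> 0 <= y -> (1 + y) `^ p <= GH b * expR (b * y ^+ 2).
Proof.
move=> b0 y0; have y1 : 1 <= 1 + y by rewrite lerDl.
apply: (@le_trans _ _ ((1 + y) `^ (n.+2 * 2)%:R)).
  apply: ler_powR => //; rewrite natrM -addn2 natrD.
  have n0 : (0 : R) <= n%:R by []; have := al2; lra.
rewrite powR_mulrn ?(le_trans ler01)// mulnC exprM.
have x0 : 0 <= b * (1 + y ^+ 2) by rewrite mulr_ge0 ?(ltW b0)// addr_ge0 ?sqr_ge0.
apply: (@le_trans _ _ ((2 * (1 + y ^+ 2)) ^+ n.+2)).
  rewrite lerXn2r ?nnegrE ?sqr_ge0 ?mulr_ge0 ?addr_ge0 ?sqr_ge0//.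
  have : 0 <= (1 - y) ^+ 2 by exact: sqr_ge0.
  nra.
have := expR_ge1Dxn n.+1 x0 => h.
have {}h : (b * (1 + y ^+ 2)) ^+ n.+2 / n.+2`!%:R <= expR (b * (1 + y ^+ 2)).
  by apply: le_trans h; rewrite lerDr.
have f0 : 0 < n.+2`!%:R :> R by rewrite ltr0n fact_gt0.
move: h; rewrite ler_pdivrMr// exprMn => h.
have bk : 0 < b ^+ n.+2 by exact: exprn_gt0.
have -> : GH b * expR (b * y ^+ 2) =
    2 ^+ n.+2 * ((b ^+ n.+2)^-1 * (expR (b * (1 + y ^+ 2)) * n.+2`!%:R)).
  by rewrite mulrDr mulr1 expRD /GH; ring.
rewrite exprMn ler_wpM2l ?exprn_ge0//.
by rewrite -(@ler_pM2l _ (b ^+ n.+2))// mulVKf// gt_eqF.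
Qed.

Lemma Gk_le_Hk b s v : 0 < b -> 0 < s -> Gk b s v <= GH b * Hk s v.
Proof.
move=> b0 s0; rewrite HkE// /Gk [leRHS]mulrCA; apply: ler_wpM2l; first exact: powR_ge0.
have st : 0 < Num.sqrt s by rewrite sqrtr_gt0.
set y := euclid v / Num.sqrt s.
have y0 : 0 <= y by rewrite divr_ge0 ?euclid_ge0 ?ltW.
have -> : - b * euclid v ^+ 2 / s = - (b * y ^+ 2).
  by rewrite /y expr_div_n (sqr_sqrtr (ltW s0)) mulNr mulNr -mulrA.
have G0 := GH_gt0 b0.
have y10 : 0 < (1 + y) `^ p by rewrite powR_gt0// ltr_pwDl.
rewrite expRN powRN ler_pdivlMr// ler_pdivrMl ?expR_gt0// [leRHS]mulrC.
exact: powR_le_gauss.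
Qed.

End Kernels.

Section Kernels.
Variables (R : realType) (n : nat) (alpha : R).
Hypothesis al0 : 0 < alpha.
Hypothesis al2 : alpha < 2.
Local Notation p := (n%:R + alpha).
Implicit Types (u v z w : 'rV[R]_n) (a b r s t : R).

Lemma powR_half_le (rho r t : R) : 0 < rho -> 0 < t -> rho * t <= r ->
  r `^ (- (n%:R / 2)) <= rho `^ (- (n%:R / 2)) * t `^ (- (n%:R / 2)).
Proof.
move=> rho0 t0 h; rewrite -powRM ?(ltW rho0) ?(ltW t0)//.
by apply: powR_antitone; rewrite ?divr_ge0 ?mulr_gt0.
Qed.

Lemma Gk_split b b' t z : Gk (b + b') t z = Gk b t z * expR (- b' * euclid z ^+ 2 / t).
Proof.
rewrite /Gk; have -> : - (b + b') * euclid z ^+ 2 / t =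
  - b * euclid z ^+ 2 / t + - b' * euclid z ^+ 2 / t by ring.
by rewrite expRD mulrA.
Qed.

Lemma Gk_le (rho : R) b b' s t z w : 0 < rho -> 0 < t -> rho * t <= s ->
  b * euclid w ^+ 2 / t <= b' * euclid z ^+ 2 / s ->
  Gk b' s z <= rho `^ (- (n%:R / 2)) * Gk b t w.
Proof.
move=> rho0 t0 h e; rewrite /Gk mulrA; apply: ler_pM; rewrite ?powR_ge0 ?expR_ge0//.
  exact: powR_half_le.
by rewrite ler_expR !mulNr lerN2.
Qed.

(* With [q = sqrt (b / b')]: either [r] is a fixed fraction of [t], and convexity of
   [|.|^2 / t] applies, or [s ~ t] and then [|v| >= q |u + v|] or [|u| >= (1 - q) |u + v|]. *)
Lemma Gk_3P b b' : 0 < b -> b < b' -> exists2 C, 0 <= C & forall r s u v, 0 < r -> 0 < s ->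
  Gk b r u * Gk b' s v <= C * Gk b (r + s) (u + v) * (Hk alpha r u + Hk alpha s v).
Proof.
move=> b0 bb; have b'0 := lt_trans b0 bb.
have db0 : 0 < b' - b by rewrite subr_gt0.
set q := Num.sqrt (b / b').
have q0 : 0 < q by rewrite sqrtr_gt0 divr_gt0.
have qE : q ^+ 2 = b / b' by rewrite sqr_sqrtr// divr_ge0// ltW.
have q1 : q < 1 by rewrite -(@ltr_pXn2r _ 2)// ?nnegrE ?(ltW q0)// qE expr1n ltr_pdivrMr// mul1r.
set ka := 1 - q; have ka0 : 0 < ka by rewrite subr_gt0.
set rho := ka ^+ 2 / 2; have rho0 : 0 < rho by rewrite divr_gt0// exprn_gt0.
have rho2 : rho < 1 / 2 by rewrite /rho ltr_pM2r ?invr_gt0// expr_lt1// ?(ltW ka0)// /ka ltrBlDr ltrDl.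
have b20 : 0 < b / 2 by rewrite divr_gt0.
have [K1 [K1E K10]] : exists K, K = rho `^ (- (n%:R / 2)) * GH n (b' - b) /\ 0 <= K.
  by eexists; split; first reflexivity; rewrite mulr_ge0 ?powR_ge0 ?GH_ge0.
have [K2 [K2E K20]] : exists K, K = (1 / 2) `^ (- (n%:R / 2)) * GH n b /\ 0 <= K.
  by eexists; split; first reflexivity; rewrite mulr_ge0 ?powR_ge0 ?GH_ge0.
have [K3 [K3E K30]] : exists K, K = (1 / 2) `^ (- (n%:R / 2)) * GH n (b / 2) /\ 0 <= K.
  by eexists; split; first reflexivity; rewrite mulr_ge0 ?powR_ge0 ?GH_ge0.
exists (K1 + K2 + K3); first by rewrite !addr_ge0.
move=> r s u v r0 s0; set t := r + s; set w := u + v.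
have t0 : 0 < t by rewrite addr_gt0.
have Hu := Hk_ge0 alpha r u; have Hv := Hk_ge0 alpha s v; have G0 := Gk_ge0 b t w.
have fin K h : K <= K1 + K2 + K3 -> 0 <= K -> 0 <= h -> h <= Hk alpha r u + Hk alpha s v ->
    Gk b r u * Gk b' s v <= K * Gk b t w * h ->
    Gk b r u * Gk b' s v <= (K1 + K2 + K3) * Gk b t w * (Hk alpha r u + Hk alpha s v).
  move=> KK K0 h0 hH /le_trans; apply; apply: ler_pM => //; first by rewrite mulr_ge0.
  exact: ler_wpM2r.
have [rt|rt] := leP (rho * t) r.
  apply: (fin K1 _ _ K10 Hv); [by rewrite -addrA lerDl addr_ge0|rewrite lerDr; exact: Hu|].
  have -> : Gk b' s v = expR (- b * euclid v ^+ 2 / s) * Gk (b' - b) s v.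
    by have := Gk_split (b' - b) b s v; rewrite subrK mulrC.
  rewrite mulrA; have -> : K1 * Gk b t w * Hk alpha s v =
     rho `^ (- (n%:R / 2)) * Gk b t w * (GH n (b' - b) * Hk alpha s v) by rewrite K1E; ring.
  apply: ler_pM; [by rewrite mulr_ge0 ?Gk_ge0 ?expR_ge0|exact: Gk_ge0| |exact: Gk_le_Hk].
  rewrite /Gk -(mulrA (r `^ _)) -expRD [leRHS]mulrA; apply: ler_pM; rewrite ?powR_ge0 ?expR_ge0//.
    exact: powR_half_le.
  rewrite ler_expR; have := sqr_euclid_convex u v r0 s0; rewrite -/w -/t => h.
  have := ler_wpM2l (ltW b0) h; rewrite mulrDr => {}h.
  have E (x y : R) : - b * x / y = - (b * (x / y)) by rewrite mulNr mulNr -mulrA.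
  by rewrite !E -opprD lerN2.
have st2 : 1 / 2 * t <= s.
  have : rho * t < 1 / 2 * t by rewrite ltr_pM2r.
  by move=> /(lt_trans rt); rewrite /t => h; lra.
have half0 : (0 : R) < 1 / 2 by rewrite divr_gt0.
have [vw|vw] := leP (q * euclid w) (euclid v).
  apply: (fin K2 _ _ K20 Hu); [by rewrite [K1 + K2]addrC -addrA lerDl addr_ge0|rewrite lerDl; exact: Hv|].
  have -> : K2 * Gk b t w * Hk alpha r u =
    (GH n b * Hk alpha r u) * ((1 / 2) `^ (- (n%:R / 2)) * Gk b t w) by rewrite K2E; ring.
  apply: ler_pM; rewrite ?Gk_ge0//; first exact: Gk_le_Hk.
  apply: Gk_le => //.
  have -> : b * euclid w ^+ 2 / t = b' * (q * euclid w) ^+ 2 / t.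
    by rewrite exprMn qE; field; rewrite !gt_eqF.
  apply: ler_pM.
  - by apply: mulr_ge0; [exact: ltW|exact: sqr_ge0].
  - by rewrite invr_ge0 ltW.
  - apply: ler_wpM2l; first exact: ltW.
    by rewrite lerXn2r// nnegrE ?euclid_ge0// mulr_ge0 ?euclid_ge0// ltW.
  - by rewrite lef_pV2 ?posrE// /t lerDr ltW.
have uw : ka * euclid w <= euclid u.
  have := euclidD (u + v) (- v); rewrite addrK euclidN => _.
  have := euclidD u v; rewrite -/w /ka mulrBl mul1r lerBlDr => h.
  by apply: le_trans h _; rewrite lerD2l ltW.
apply: (fin K3 _ _ K30 Hu); [by rewrite lerDr addr_ge0|rewrite lerDl; exact: Hv|].
have -> : K3 * Gk b t w * Hk alpha r u =
    (GH n (b / 2) * Hk alpha r u * expR (- b * euclid w ^+ 2 / t)) *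
    ((1 / 2) `^ (- (n%:R / 2)) * t `^ (- (n%:R / 2))).
  by rewrite K3E /Gk; ring.
apply: ler_pM; rewrite ?Gk_ge0//.
  have bE : b = b / 2 + b / 2 by field.
  rewrite [in leLHS]bE Gk_split; apply: ler_pM; rewrite ?Gk_ge0 ?expR_ge0//; first exact: Gk_le_Hk.
  rewrite ler_expR !mulNr lerN2.
  have -> : b * euclid w ^+ 2 / t = b / 2 * (ka * euclid w) ^+ 2 / (rho * t).
    by rewrite /rho exprMn; field; rewrite !gt_eqF.
  apply: ler_pM.
  - by apply: mulr_ge0; [exact: ltW|exact: sqr_ge0].
  - by rewrite invr_ge0 mulr_ge0 ?(ltW t0) ?(ltW rho0).
  - apply: ler_wpM2l; first exact: ltW.
    by rewrite lerXn2r// nnegrE ?euclid_ge0// mulr_ge0 ?euclid_ge0// ltW.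
  - by rewrite lef_pV2 ?posrE ?mulr_gt0// ltW.
rewrite /Gk -[leRHS]mulr1; apply: ler_pM; rewrite ?powR_ge0 ?expR_ge0//.
  exact: powR_half_le.
rewrite expR_le1 mulNr mulNr oppr_le0; apply: divr_ge0; last exact: ltW.
by apply: mulr_ge0; [exact: ltW|exact: sqr_ge0].
Qed.

Lemma th_le a s t : 0 < s -> s <= t -> th alpha a s <= th alpha a t.
Proof.
move=> s0 st; apply: ler_wpM2l; first exact: powR_ge0.
apply: ge0_ler_powR; rewrite ?nnegrE ?(ltW s0) ?(le_trans (ltW s0) st)//.
by rewrite subr_ge0 ler_pdivrMr// mul1r ltW.
Qed.

(** Only the product of the two Gaussians is kept. In the other three products a Gaussian is bounded
    by a multiple of [Hk], and [Hk_3P] applies. Each carries at least one factor [th], raised to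
    time r + s; [th] <= 1 disposes of a second one. *)
Lemma Qk_mul_le b b' a r s u v : 0 < b -> 0 < b' -> 0 < r -> 0 < s -> th alpha a (r + s) <= 1 ->
  Qk alpha a b r u * Qk alpha a b' s v <= Gk b r u * Gk b' s v +
  2 `^ p * (GH n b + GH n b' + 1) * (th alpha a (r + s) * Hk alpha (r + s) (u + v)) *
  (Hk alpha r u + Hk alpha s v).
Proof.
move=> b0 b'0 r0 s0; set t := r + s => t1.
have g0 := GH_ge0 n b0; have g'0 := GH_ge0 n b'0.
have tr : th alpha a r <= th alpha a t by apply: th_le; rewrite // lerDl ltW.
have ts : th alpha a s <= th alpha a t by apply: th_le; rewrite // lerDr ltW.
have := Hk_3P al0 u v r0 s0; have := Gk_le_Hk al2 u b0 r0; have := Gk_le_Hk al2 v b'0 s0.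
have := powR_ge0 (2 : R) p; rewrite /Qk -/t.
have := th_ge0 alpha a t; have := th_ge0 alpha a r; have := th_ge0 alpha a s.
have := Hk_ge0 alpha r u; have := Hk_ge0 alpha s v; have := Hk_ge0 alpha t (u + v).
have := Gk_ge0 b r u; have := Gk_ge0 b' s v.
move: tr ts t1 g0 g'0.
move: (Hk alpha r u) (Hk alpha s v) (Hk alpha t (u + v)) (Gk b r u) (Gk b' s v).
move: (th alpha a t) (th alpha a r) (th alpha a s) (GH n b) (GH n b') (2 `^ p); clear.
move=> tt tr ts G G' P hu hv ht gu gv trt tst t1 G0 G'0 gv0 gu0 ht0 hv0 hu0 ts0 tr0 tt0 P0.
move=> hgv hgu hh.
have h0 : 0 <= P * ht * (hu + hv) by rewrite !mulr_ge0 ?addr_ge0.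
have e1 : tr * (hu * gv) <= tt * (G' * (P * ht * (hu + hv))).
  apply: ler_pM; [exact: tr0|exact: mulr_ge0|exact: trt|].
  apply: le_trans (ler_wpM2l hu0 hgv) _; rewrite [leLHS]mulrCA; exact: ler_wpM2l.
have e2 : ts * (gu * hv) <= tt * (G * (P * ht * (hu + hv))).
  apply: ler_pM; [exact: ts0|exact: mulr_ge0|exact: tst|].
  apply: le_trans (ler_wpM2r hv0 hgu) _; rewrite -[leLHS]mulrA; exact: ler_wpM2l.
have e3 : tr * ts * (hu * hv) <= tt * (P * ht * (hu + hv)).
  apply: ler_pM; [exact: mulr_ge0|exact: mulr_ge0| |exact: hh].
  rewrite -[leRHS]mulr1; apply: ler_pM; [exact: tr0|exact: ts0|exact: trt|exact: le_trans tst t1].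
by move: e1 e2 e3; clear => *; lra.
Qed.

Lemma Qk_3P b b' : 0 < b -> b < b' -> exists2 C, 0 <= C &
  forall a r s u v, 0 < r -> 0 < s -> th alpha a (r + s) <= 1 ->
  Qk alpha a b r u * Qk alpha a b' s v <=
  C * Qk alpha a b (r + s) (u + v) * (Hk alpha r u + Hk alpha s v).
Proof.
move=> b0 bb; have b'0 := lt_trans b0 bb.
have [C1 C10 H1] := Gk_3P b0 bb.
pose A := (2 : R) `^ p * (GH n b + GH n b' + 1).
have A0 : 0 <= A by rewrite mulr_ge0 ?powR_ge0// !addr_ge0 ?GH_ge0.
exists (C1 + A); first by rewrite addr_ge0.
move=> a r s u v r0 s0 t1; apply: le_trans (Qk_mul_le u v b0 b'0 r0 s0 t1) _.
rewrite -/A.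
have := H1 r s u v r0 s0.
have := Hk_ge0 alpha r u; have := Hk_ge0 alpha s v.
have := Gk_ge0 b (r + s) (u + v).
have : 0 <= th alpha a (r + s) * Hk alpha (r + s) (u + v).
  by apply: mulr_ge0; [exact: th_ge0|exact: Hk_ge0].
rewrite [Qk _ _ _ (r + s) _]/Qk.
move: (th _ _ _ * _) (Gk b _ _) (Hk alpha r u) (Hk alpha s v) (Gk b r u * _) => T g hu hv gg.
move: C10 A0; clear => C0 A0 T0 g0 hv0 hu0 h.
have h0 : 0 <= hu + hv by exact: addr_ge0.
have := mulr_ge0 (mulr_ge0 A0 g0) h0; have := mulr_ge0 (mulr_ge0 C0 T0) h0.
by move: h; clear => *; lra.
Qed.
End Kernels.

Section Compare.
Variables (R : realType) (n : nat) (alpha : R).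
Hypothesis al0 : 0 < alpha.
Hypothesis al2 : alpha < 2.
Local Notation p := (n%:R + alpha).
Implicit Types (u v z w : 'rV[R]_n) (a b c r s t : R).

Lemma powRN_le1 (q y : R) : 0 <= q -> 1 <= y -> y `^ (- q) <= 1.
Proof. by move=> q0 /(powR_antitone q0 ltr01); rewrite powR1. Qed.

Lemma powRN_ge1 (q y : R) : 0 <= q -> 0 < y -> y <= 1 -> 1 <= y `^ (- q).
Proof. by move=> q0 y0 /(powR_antitone q0 y0); rewrite powR1. Qed.

Lemma sqrtDeuclid_gt0 t z : 0 < t -> 0 < Num.sqrt t + euclid z.
Proof. by move=> t0; rewrite ltr_pwDl ?sqrtr_gt0 ?euclid_ge0. Qed.

Lemma thHkE a t z : 0 < t ->
  th alpha a t * Hk alpha t z = a `^ alpha * t * (Num.sqrt t + euclid z) `^ (- p).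
Proof.
move=> t0; rewrite /th /Hk mulrA; congr (_ * _); rewrite -mulrA -powRD; last first.
  by apply/implyP => _; rewrite gt_eqF.
by rewrite subrK powRr1// ltW.
Qed.

Lemma Hk_le_powR t z : 0 < t -> Hk alpha t z <= t `^ (- (n%:R / 2)).
Proof.
move=> t0; rewrite HkE// -[leRHS]mulr1; apply: ler_wpM2l; first exact: powR_ge0.
have y0 : 0 <= euclid z / Num.sqrt t by rewrite divr_ge0 ?euclid_ge0 ?sqrtr_ge0.
by apply: powRN_le1; rewrite ?lerDl// ltW// p_gt0.
Qed.

Definition Jk a t z : R := if z == 0 then t `^ (- (n%:R / 2))
   else Num.min (t `^ (- (n%:R / 2))) (a `^ alpha * t / euclid z `^ p).

Lemma qfunE a b t z : qfun alpha a b t z = Gk b t z + Jk a t z.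
Proof. by []. Qed.

Lemma Jk_ge0 a t z : 0 < t -> 0 <= Jk a t z.
Proof.
move=> t0; rewrite /Jk; case: ifP => _; first exact: powR_ge0.
by rewrite le_min powR_ge0 divr_ge0 ?mulr_ge0 ?powR_ge0// ltW.
Qed.

Lemma qfun_ge0 a b t z : 0 < t -> 0 <= qfun alpha a b t z.
Proof. by move=> t0; rewrite qfunE; apply: addr_ge0; [exact: Gk_ge0|exact: Jk_ge0]. Qed.

(** For |z| <= sqrt t the minimum is at most t^(-n/2), which is at most exp(b) times the Gaussian.
    For |z| > sqrt t, sqrt t + |z| <= 2 |z|. *)
Lemma qfun_le_Qk a b t z : 0 < b -> 0 < t ->
  qfun alpha a b t z <= (1 + expR b + 2 `^ p) * Qk alpha a b t z.
Proof.
move=> b0 t0; have p0 := p_gt0 n al0.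
have G0 := Gk_ge0 b t z.
have T0 : 0 <= th alpha a t * Hk alpha t z.
  by apply: mulr_ge0; [exact: th_ge0|exact: Hk_ge0].
have e0 : 0 <= expR b := expR_ge0 b.
have P0 : 0 <= (2 : R) `^ p := powR_ge0 2 p.
rewrite qfunE /Qk; set T := th alpha a t * _ in T0 *; set G := Gk b t z in G0 *.
set E := expR b in e0 *; set P := 2 `^ p in P0 *.
have eT : 0 <= E * T by exact: mulr_ge0.
have PG : 0 <= P * G by exact: mulr_ge0.
suff [h|h] : Jk a t z <= E * G \/ Jk a t z <= P * T.
- have PT : 0 <= P * T by exact: mulr_ge0.
  by rewrite !mulrDl !mulrDr !mul1r; move: h T0 eT PG PT; clear => *; lra.
- have EG : 0 <= E * G by exact: mulr_ge0.
  by rewrite !mulrDl !mulrDr !mul1r; move: h T0 eT PG EG; clear => *; lra.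
have [zt|zt] := leP (euclid z) (Num.sqrt t); [left|right].
  apply: (@le_trans _ _ (t `^ (- (n%:R / 2)))).
    by rewrite /Jk; case: ifP => // _; rewrite ge_min lexx.
  rewrite /G /Gk mulrCA -[leLHS]mulr1; apply: ler_wpM2l; first exact: powR_ge0.
  rewrite /E -expRD -expR0 ler_expR mulNr mulNr subr_ge0 ler_pdivrMr// ler_pM2l//.
  rewrite -(sqr_sqrtr (ltW t0)); apply: lerXn2r => //; rewrite nnegrE; [exact: euclid_ge0|exact: sqrtr_ge0].
have z0 : 0 < euclid z by apply: le_lt_trans zt; exact: sqrtr_ge0.
have zn0 : z == 0 = false by apply/negbTE; apply: contraTneq z0 => ->; rewrite euclid0 ltxx.
rewrite /Jk zn0 ge_min /T thHkE//; apply/orP; right.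
rewrite [leRHS]mulrCA; apply: ler_wpM2l; first by rewrite mulr_ge0 ?powR_ge0// ltW.
have -> : P * (Num.sqrt t + euclid z) `^ (- p) = ((Num.sqrt t + euclid z) / 2) `^ (- p).
  rewrite powRM ?invr_ge0 ?addr_ge0 ?sqrtr_ge0 ?euclid_ge0// mulrC; congr (_ * _).
  by rewrite -powR_inv1// -powRrM /P; congr (_ `^ _); ring.
rewrite -powRN; apply: powR_antitone; first exact: ltW.
  by rewrite divr_gt0// sqrtDeuclid_gt0.
by rewrite ler_pdivrMr//; move: zt; clear => *; lra.
Qed.

Lemma Qk_le_qfun a b t z : 0 < t -> th alpha a t <= 1 ->
  Qk alpha a b t z <= qfun alpha a b t z.
Proof.
move=> t0 h; rewrite qfunE /Qk lerD2l.
have p0 := p_gt0 n al0.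
have h1 : th alpha a t * Hk alpha t z <= t `^ (- (n%:R / 2)).
  apply: le_trans (Hk_le_powR z t0).
  by rewrite -[leRHS]mul1r; apply: ler_wpM2r => //; exact: Hk_ge0.
rewrite /Jk; case: ifP => // /negbT z0; rewrite le_min h1/=.
rewrite thHkE// -powRN; apply: ler_wpM2l; first by rewrite mulr_ge0 ?powR_ge0// ltW.
by apply: powR_antitone; rewrite ?euclid_gt0// ?ltW// ltrDr sqrtr_gt0.
Qed.

(** The source of the exponents in the theorem: with c = 2 betaL / betaU, scaling time by c matches
    betaU / 2 at time t with betaL at time c t, and betaU at time c t with betaU^2 / (2 betaL) at
    time t. *)
Lemma qfun_scale a b c t z : 0 < c -> 0 < t ->
  qfun alpha a b (c * t) z <= (c `^ (- (n%:R / 2)) + c) * qfun alpha a (b / c) t z.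
Proof.
move=> c0 t0; rewrite !qfunE.
have e : Gk b (c * t) z = c `^ (- (n%:R / 2)) * Gk (b / c) t z.
  rewrite /Gk powRM ?(ltW c0) ?(ltW t0)// -mulrA; congr (_ * (_ * expR _)).
  by field; rewrite !gt_eqF.
have G0 : 0 <= c * Gk (b / c) t z by apply: mulr_ge0; [exact: ltW|exact: Gk_ge0].
have h : Jk a (c * t) z <= (c `^ (- (n%:R / 2)) + c) * Jk a t z.
  have q0 := powR_ge0 c (- (n%:R / 2)).
  rewrite /Jk powRM ?(ltW c0) ?(ltW t0)//; case: ifP => _.
    by rewrite mulrDl lerDl mulr_ge0 ?powR_ge0// ltW.
  have -> : a `^ alpha * (c * t) / euclid z `^ p = c * (a `^ alpha * t / euclid z `^ p) by ring.
  have x0 := powR_ge0 t (- (n%:R / 2)).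
  have y0 : 0 <= a `^ alpha * t / euclid z `^ p.
    by rewrite divr_ge0 ?mulr_ge0 ?powR_ge0// ltW.
  move: q0 x0 y0; set x := t `^ _; set y := a `^ alpha * t / _; set q := c `^ _ => q0 x0 y0.
  rewrite ge_min; apply/orP; case: (leP x y) => xy; [left|right].
    by rewrite mulrDl lerDl mulr_ge0// ltW.
  by rewrite mulrDl lerDr mulr_ge0.
by rewrite mulrDr; apply: lerD => //; rewrite e mulrDl lerDl.
Qed.

Lemma Qk_scale a b ka t z : 0 < ka -> ka <= 1 -> 0 < t ->
  Qk alpha a b t (ka *: z) <= ka `^ (- p) * Qk alpha a (b * ka ^+ 2) t z.
Proof.
move=> k0 k1 t0; have p0 := p_gt0 n al0; rewrite /Qk mulrDr; apply: lerD.
  have -> : Gk b t (ka *: z) = Gk (b * ka ^+ 2) t z.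
    rewrite /Gk euclidZ (ger0_norm (ltW k0)) exprMn; congr (_ * expR _); ring.
  rewrite -[leLHS]mul1r; apply: ler_wpM2r; first exact: Gk_ge0.
  by apply: powRN_ge1 => //; exact: ltW.
rewrite [leRHS]mulrCA; apply: ler_wpM2l; first exact: th_ge0.
rewrite /Hk [leRHS]mulrCA; apply: ler_wpM2l; first exact: powR_ge0.
rewrite -powRM ?(ltW k0) ?(ltW (sqrtDeuclid_gt0 _ _))//.
apply: powR_antitone; first exact: ltW.
  by rewrite mulr_gt0 ?sqrtDeuclid_gt0.
rewrite euclidZ (ger0_norm (ltW k0)) mulrDr lerD2r -[leRHS]mul1r.
by apply: ler_wpM2r => //; exact: sqrtr_ge0.
Qed.

End Compare.

(** * Integrals of the kernels and the Kato class *)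

Section Improper.
Variable R : realType.
Local Notation leb1 := (@lebesgue_measure R).

(** The fundamental theorem on compact intervals exhausting [D], passed to the limit by monotone
    convergence. Bounds on [F] replace its limits at the ends, where it may be singular. *)
Lemma ge0_FTC_le (f F : R -> R) (D : set R) (l r : nat -> R) (L U : R) :
  measurable D ->
  (forall k, l k < r k) ->
  (forall k x, l k <= x -> x <= r k -> D x) ->
  (forall k m, (k <= m)%N -> l m <= l k /\ r k <= r m) ->
  (forall x, D x -> \forall k \near \oo, l k <= x <= r k) ->
  (forall x : R, D x -> is_derive x 1 F (f x)) ->
  (forall x : R, D x -> {for x, continuous f}) ->
  measurable_fun setT f ->
  (forall x, D x -> 0 <= f x) ->
  (forall x, D x -> L <= F x <= U) ->
  (\int[leb1]_(x in D) (f x)%:E <= (U - L)%:E)%E.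
Proof.
move=> mD lr lrD mono cover dF cf mf f0 FLU.
pose g k (x : R) := (f x * \1_(`[l k, r k]%classic) x)%:E.
have int_g k : (\int[leb1]_(x in D) g k x = (F (r k) - F (l k))%:E)%E.
  have DA x : `[l k, r k]%classic x -> D x.
    by rewrite /= in_itv/= => /andP[]; exact: lrD.
  have cfk : {within `[l k, r k], continuous f}.
    by apply: continuous_in_subspaceT => x /set_mem /DA; exact: cf.
  have Fc x : D x -> {for x, continuous F}.
    by move=> Dx; apply: differentiable_continuous; apply/derivable1_diffP; case: (dF _ Dx).
  have Dl : D (l k) by apply: (lrD k) => //; exact: ltW.
  have Dr : D (r k) by apply: (lrD k) => //; exact: ltW.
  have dFk : derivable_oo_LRcontinuous F (l k) (r k).
    split.
    + move=> x; rewrite in_itv/= => /andP[/ltW lx /ltW xr].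
      by case: (dF _ (lrD _ _ lx xr)).
    + by apply: cvg_at_right_filter; exact: Fc.
    + by apply: cvg_at_left_filter; exact: Fc.
  have dE : {in `]l k, r k[, derive1 F =1 f}.
    move=> x; rewrite in_itv/= => /andP[/ltW lx /ltW xr].
    exact: der_derive1 (dF _ (lrD _ _ lx xr)).
  rewrite EFinB -(continuous_FTC2 (lr k) cfk dFk dE).
  rewrite integral_mkcond [RHS]integral_mkcond; apply: eq_integral => x _.
  rewrite /g !patchE indicE; case: (boolP (x \in `[l k, r k]%classic)) => xk.
    by rewrite mulr1 (mem_set (DA _ (set_mem xk))).
  by rewrite mulr0; case: ifP.
have gk0 k x : D x -> (0 <= g k x)%E.
  by move=> Dx; rewrite lee_fin mulr_ge0// f0.
have mg k : measurable_fun D (g k).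
  apply/measurable_EFinP; apply: measurable_funTS; apply: measurable_funM => //.
have nd x : D x -> nondecreasing_seq (g ^~ x).
  move=> Dx k m km; rewrite lee_fin ler_wpM2l ?f0// !indicE ler_nat.
  case: (boolP (x \in `[l k, r k]%classic)) => //; rewrite inE/= in_itv/= => /andP[lx xr].
  have [ml rm] := mono _ _ km.
  by rewrite mem_set//= in_itv/= (le_trans ml lx) (le_trans xr rm).
have cv := @cvg_monotone_convergence _ (measurableTypeR R) R leb1 D mD g mg gk0 nd.
have E : (\int[leb1]_(x in D) (f x)%:E = \int[leb1]_(x in D) limn (g ^~ x))%E.
  apply: eq_integral => x /set_mem Dx; apply/esym/cvg_lim => //.
  apply: cvg_near_cst; near=> k; rewrite /g indicE mem_set ?mulr1//= in_itv/=.
  by near: k; exact: cover.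
rewrite E -(cvg_lim _ cv)//; apply: lime_le; first by apply/cvg_ex; eexists; exact: cv.
apply: nearW => k; rewrite int_g lee_fin.
have /andP[_ ?] : L <= F (r k) <= U by apply: FLU; apply: (lrD k) => //; exact: ltW.
have /andP[? _] : L <= F (l k) <= U by apply: FLU; apply: (lrD k) => //; exact: ltW.
exact: lerB.
Unshelve. all: end_near. Qed.

Lemma ge0_FTC_oy_le (f F : R -> R) (L U : R) :
  (forall x : R, 0 < x -> is_derive x 1 F (f x)) ->
  (forall x : R, 0 < x -> {for x, continuous f}) ->
  measurable_fun setT f ->
  (forall x, 0 < x -> 0 <= f x) ->
  (forall x, 0 < x -> L <= F x <= U) ->
  (\int[leb1]_(x in `]0%R, +oo[) (f x)%:E <= (U - L)%:E)%E.
Proof.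
have Dx x : `]0%R, +oo[%classic x -> 0 < x by rewrite /= in_itv/= andbT.
move=> dF cf mf f0 FLU.
apply: (@ge0_FTC_le f F _ (fun k => k.+1%:R^-1) (fun k => k.+2%:R)) => //.
- move=> k; apply: (@le_lt_trans _ _ 1); last by rewrite ltr1n.
  by rewrite invf_le1 ?ltr0n// ler1n.
- by move=> k x lx _; rewrite /= in_itv/= andbT; apply: lt_le_trans lx; rewrite invr_gt0 ltr0n.
- by move=> k m km; rewrite lef_pV2 ?posrE ?ltr0n// !ler_nat !ltnS.
- move=> x /Dx x0; near=> k; apply/andP; split.
    rewrite -[leRHS]invrK lef_pV2 ?posrE ?invr_gt0 ?ltr0n//.
    apply: le_trans (ltW (truncnS_gt _)) _.
    by rewrite ler_nat ltnS; near: k; exact: nbhs_infty_ge.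
  apply: le_trans (ltW (truncnS_gt _)) _; rewrite ler_nat ltnS ltnW// ltnS.
  by near: k; exact: nbhs_infty_ge.
- by move=> x /Dx; exact: dF.
- by move=> x /Dx; exact: cf.
- by move=> x /Dx; exact: f0.
- by move=> x /Dx; exact: FLU.
Unshelve. all: end_near. Qed.

Lemma ge0_FTC_oo_le (f F : R -> R) (t L U : R) : 0 < t ->
  (forall x : R, 0 < x -> x < t -> is_derive x 1 F (f x)) ->
  (forall x : R, 0 < x -> x < t -> {for x, continuous f}) ->
  measurable_fun setT f ->
  (forall x, 0 < x -> x < t -> 0 <= f x) ->
  (forall x, 0 < x -> x < t -> L <= F x <= U) ->
  (\int[leb1]_(x in `]0%R, t[) (f x)%:E <= (U - L)%:E)%E.
Proof.
move=> t0 dF cf mf f0 FLU.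
have Dx x : `]0, t[%classic x -> 0 < x < t by rewrite /= in_itv/=.
have k3 k : k.+3%:R^-1 < 1 - k.+3%:R^-1 :> R.
  have h : k.+3%:R^-1 <= 3^-1 :> R by rewrite lef_pV2 ?posrE ?ltr0n// ler_nat.
  by move: h; move: (k.+3%:R^-1 : R) => x h; lra.
have kp k : 0 < k.+3%:R^-1 :> R by rewrite invr_gt0 ltr0n.
have km m k : (m <= k)%N -> k.+3%:R^-1 <= m.+3%:R^-1 :> R.
  by move=> mk; rewrite lef_pV2 ?posrE ?ltr0n// ler_nat !ltnS.
(* The offset 3 makes the first interval [t/3, 2t/3] nondegenerate. *)
apply: (@ge0_FTC_le f F _ (fun k => t * k.+3%:R^-1) (fun k => t * (1 - k.+3%:R^-1))) => //.
- by move=> k; rewrite ltr_pM2l.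
- move=> k x lx xr; rewrite /= in_itv/= (lt_le_trans _ lx) ?mulr_gt0//=.
  by apply: le_lt_trans xr _; rewrite -[ltRHS]mulr1 ltr_pM2l// ltrBlDr ltrDl.
- by move=> m k /km h; rewrite !ler_pM2l// lerD2l lerN2.
- move=> x /Dx/andP[x0 xt]; near=> k; apply/andP; split.
    rewrite ler_pdivrMr ?ltr0n// mulrC -ler_pdivrMr//.
    apply: le_trans (ltW (truncnS_gt _)) _.
    rewrite ler_nat ltnS; apply: (@leq_trans k); last by rewrite !leqW.
    by near: k; exact: nbhs_infty_ge.
  have tx : 0 < t - x by rewrite subr_gt0.
  rewrite mulrBr mulr1 lerBrDr -lerBrDl.
  rewrite ler_pdivrMr ?ltr0n// mulrC -ler_pdivrMr//.
  apply: le_trans (ltW (truncnS_gt _)) _.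
  rewrite ler_nat ltnS; apply: (@leq_trans k); last by rewrite !leqW.
    by near: k; exact: nbhs_infty_ge.
- by move=> x /Dx/andP[]; exact: dF.
- by move=> x /Dx/andP[]; exact: cf.
- by move=> x /Dx/andP[]; exact: f0.
- by move=> x /Dx/andP[]; exact: FLU.
Unshelve. all: end_near. Qed.

End Improper.

Section NonnegIntegral.
Context d (T : measurableType d) (R : realType) (m : {measure set T -> \bar R}).

Lemma int_le (f g : T -> R) : measurable_fun setT f -> measurable_fun setT g ->
  (forall x, 0 <= f x) -> (forall x, f x <= g x) ->
  (\int[m]_x (f x)%:E <= \int[m]_x (g x)%:E)%E.
Proof.
move=> mf mg f0 fg; apply: ge0_le_integral => //; try exact/measurable_EFinP.
- by move=> x _; rewrite lee_fin.
- by move=> x _; rewrite lee_fin.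
Qed.

Lemma intZ k (f : T -> R) : measurable_fun setT f -> (forall x, 0 <= f x) -> 0 <= k ->
  (\int[m]_x (k * f x)%:E = k%:E * \int[m]_x (f x)%:E)%E.
Proof.
move=> mf f0 k0; under eq_integral do rewrite EFinM.
by apply: ge0_integralZl_EFin => //; [move=> x _; rewrite lee_fin|exact/measurable_EFinP].
Qed.

Lemma intD (f g : T -> R) : measurable_fun setT f -> measurable_fun setT g ->
  (forall x, 0 <= f x) -> (forall x, 0 <= g x) ->
  (\int[m]_x (f x + g x)%:E = \int[m]_x (f x)%:E + \int[m]_x (g x)%:E)%E.
Proof.
move=> mf mg f0 g0; under eq_integral do rewrite EFinD.
by apply: ge0_integralD => //; try exact/measurable_EFinP; move=> x _; rewrite lee_fin.
Qed.

Lemma Rintegral_le_fin (f : T -> R) (K : R) : measurable_fun setT f -> (forall x, 0 <= f x) ->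
  (\int[m]_x (f x)%:E <= K%:E)%E -> \int[m]_x f x <= K.
Proof.
move=> mf f0 h; rewrite -lee_fin /Rintegral fineK// ge0_fin_numE.
  exact: le_lt_trans h (ltry _).
by apply: integral_ge0 => x _; rewrite lee_fin.
Qed.

End NonnegIntegral.

Lemma ae_int_le (R : realType) n (y : 'rV[R]_n) (f g : rowB R n -> R) : (0 < n)%N ->
  measurable_fun setT f -> measurable_fun setT g ->
  (forall x, 0 <= f x) -> (forall x, 0 <= g x) -> (forall x, x != y -> f x <= g x) ->
  (\int[leb R n]_x (f x)%:E <= \int[leb R n]_x (g x)%:E)%E.
Proof.
move=> n0 mf mg f0 g0 fg; apply: ae_ge0_le_integral => //; try exact/measurable_EFinP.
- by move=> x _; rewrite lee_fin.
- by move=> x _; rewrite lee_fin.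
- by have := ae_neq0 y n0; apply: filterS => x /fg h _; rewrite lee_fin.
Qed.

Section KernelIntegrals.
Variables (R : realType) (n : nat) (alpha : R).
Hypothesis n0 : (0 < n)%N.
Hypothesis al0 : 0 < alpha.
Hypothesis al2 : alpha < 2.
Local Notation leb1 := (@lebesgue_measure R).
Local Notation p := (n%:R + alpha).
Implicit Types (u v z w : 'rV[R]_n) (a b c r s t : R).

Lemma derivable_continuous (f : R -> R) (x df : R) : is_derive x 1 f df -> {for x, continuous f}.
Proof. by move=> H; apply: differentiable_continuous; apply/derivable1_diffP; case: H. Qed.

Lemma int1_powR_le (r g : R) : 0 < r -> 0 < g ->
  (\int[leb1]_x ((r + `|x|) `^ (- (1 + g)))%:E <= (2 * (g^-1 * r `^ (- g)))%:E)%E.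
Proof.
move=> r0 g0; pose f (x : R) := (r + `|x|) `^ (- (1 + g)).
have rx (x : R) : 0 < r + `|x| by rewrite ltr_pwDl.
have rx' (x : R) : 0 < x -> 0 < r + x by move=> x0; rewrite addr_gt0.
have f0 (x : R) : 0 <= f x by exact: powR_ge0.
have cf : continuous f.
  move=> x; apply: (@continuous_comp _ _ _ (fun x => r + `|x|) (fun y : R => y `^ (- (1 + g)))).
    by apply: cvgD; [exact: cvg_cst|exact: norm_continuous].
  apply: (@derivable_continuous _ _ (- (1 + g) * (r + `|x|) `^ (- (1 + g) - 1) * 1)).
  by apply: der_powR => //; exact: der_id.
have mf : measurable_fun setT f by rewrite /f; mfun.
rewrite (@ge0_symfun_integralT R f)//; last by move=> x; rewrite /f /= normrN.
rewrite EFinM; apply: lee_pmul => //.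
  by apply: integral_ge0 => x _; rewrite lee_fin.
rewrite -set_itvcy -integral_itv_obnd_cbnd; last by apply/measurable_EFinP; exact: measurable_funTS.
pose F (x : R) := - (g^-1 * (r + x) `^ (- g)).
have -> : g^-1 * r `^ (- g) = 0 - (- (g^-1 * r `^ (- g))) by rewrite sub0r opprK.
apply: (@ge0_FTC_oy_le _ f F).
- move=> x x0; rewrite /F; eder; first exact: rx'.
  rewrite /= /f (ger0_norm (ltW x0)).
  rewrite (_ : - g - 1 = - (1 + g)); last by ring.
  by field; rewrite gt_eqF.
- by move=> x _; exact: cf.
- exact: mf.
- by move=> x _; exact: f0.
- move=> x x0; rewrite /F oppr_le0 mulr_ge0 ?powR_ge0 ?invr_ge0 ?(ltW g0)// andbT lerN2.
  apply: ler_wpM2l; first by rewrite invr_ge0 ltW.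
  by apply: powR_antitone; [exact: ltW|exact: r0|rewrite lerDl ltW].
Qed.

Lemma measurable_Hk d (T : measurableType d) (f : T -> R) (g : T -> rowB R n) :
  measurable_fun setT f -> measurable_fun setT g ->
  measurable_fun setT (fun x => Hk alpha (f x) (g x)).
Proof. by move=> mf mg; rewrite /Hk; mfun; exact: measurable_euclid. Qed.

Lemma measurable_Gk b d (T : measurableType d) (f : T -> R) (g : T -> rowB R n) :
  measurable_fun setT f -> measurable_fun setT g ->
  measurable_fun setT (fun x => Gk b (f x) (g x)).
Proof. by move=> mf mg; rewrite /Gk; mfun; exact: measurable_euclid. Qed.

Lemma measurable_Qk a b d (T : measurableType d) (f : T -> R) (g : T -> rowB R n) :
  measurable_fun setT f -> measurable_fun setT g ->
  measurable_fun setT (fun x => Qk alpha a b (f x) (g x)).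
Proof.
move=> mf mg; rewrite /Qk /Gk /th.
by mfun; try exact: measurable_euclid; exact: measurable_Hk.
Qed.

(** Since n + alpha = n (1 + alpha/n) and |z| >= |z_i|, the kernel is dominated by a product of
    functions of one coordinate, each integrable because alpha/n > 0. The powers of t cancel. *)
Lemma integral_Hk_le t : 0 < t ->
  (\int[leb R n]_z (Hk alpha t z)%:E <= ((2 * (alpha / n%:R)^-1) ^+ n)%:E)%E.
Proof.
move=> t0; have nR : 0 < n%:R :> R by rewrite ltr0n.
set g := alpha / n%:R; have g0 : 0 < g by rewrite divr_gt0.
set r := Num.sqrt t; have r0 : 0 < r by rewrite sqrtr_gt0.
have I1 := int1_powR_le r0 g0.
pose f (x : R) := (r + `|x|) `^ (- (1 + g)).
have f0 (x : R) : 0 <= f x by exact: powR_ge0.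
have mf : measurable_fun setT f by rewrite /f; mfun.
have If0 : (0 <= \int[leb1]_x (f x)%:E)%E by apply: integral_ge0 => x _; rewrite lee_fin.
pose c := fine (\int[leb1]_x (f x)%:E)%E.
have cE : (\int[leb1]_x (f x)%:E = c%:E)%E.
  by rewrite fineK// ge0_fin_numE//; apply: le_lt_trans I1 (ltry _).
have c0 : 0 <= c by rewrite -lee_fin -cE.
have cle : c <= 2 * (g^-1 * r `^ (- g)) by rewrite -lee_fin -cE.
have mP : measurable_fun setT (fun z : rowB R n => \prod_(i < n) f (z 0 i)).
  by mfun; apply: (measurableT_comp mf); exact: measurable_coord.
apply: (@le_trans _ _ (\int[leb R n]_z (t `^ (alpha / 2) * \prod_(i < n) f (z 0 i))%:E)%E).
  apply: int_le.
  - exact: measurable_Hk.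
  - by mfun.
  - by move=> z; exact: Hk_ge0.
  - move=> z; rewrite /Hk; apply: ler_wpM2l; first exact: powR_ge0.
    have -> : (Num.sqrt t + euclid z) `^ (- p) = \prod_(i < n) (r + euclid z) `^ (- (1 + g)).
      rewrite prodr_const card_ord -powR_mulrn ?powR_ge0// -powRrM; congr (_ `^ _).
      by rewrite /g; field; rewrite gt_eqF.
    apply: ler_prod => i _; rewrite powR_ge0/=; apply: powR_antitone.
    + by rewrite addr_ge0// ltW.
    + by rewrite ltr_pwDl.
    + by rewrite lerD2l coord_le_euclid.
rewrite intZ ?powR_ge0//; last by move=> z; apply: prodr_ge0.
rewrite (integral_prod n mf f0 cE) -EFinM lee_fin.
apply: (@le_trans _ _ (t `^ (alpha / 2) * (2 * (g^-1 * r `^ (- g))) ^+ n)).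
  by apply: ler_wpM2l; [exact: powR_ge0|rewrite lerXn2r ?nnegrE// (le_trans c0)].
rewrite mulrA exprMn mulrCA -[leRHS]mulr1; apply: ler_wpM2l.
  by rewrite exprn_ge0// mulr_ge0// invr_ge0 ltW.
rewrite -powR_mulrn ?powR_ge0// -powRrM /r -powR12_sqrt ?(ltW t0)// -powRrM -powRD; last first.
  by apply/implyP => _; rewrite gt_eqF.
by rewrite (_ : _ + _ = 0) ?powRr0// /g; field; rewrite gt_eqF.
Qed.

(* The antiderivative of the integrand, up to a factor, is
   [(sqrt s / (sqrt s + |z|)) ^ (1 + alpha)]. *)
Lemma integral_time_Hk_le t z : (1 < n)%N -> 0 < t -> z != 0 ->
  (\int[leb1]_(s in `]0%R, t[) ((Num.sqrt s)^-1 * Hk alpha s z)%:E <=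
   (2 / (1 + alpha) * (euclid z `^ (1 - n%:R) *
     (Num.sqrt t / (Num.sqrt t + euclid z)) `^ (1 + alpha)))%:E)%E.
Proof.
move=> n1 t0 z0; have := euclid_gt0 z0; set v := euclid z => v0.
have a10 : 0 < 1 + alpha by rewrite addr_gt0.
pose K := 2 / (1 + alpha) * v `^ (1 - n%:R).
have K0 : 0 <= K by rewrite mulr_ge0 ?powR_ge0// divr_ge0// ltW.
pose F (s : R) := K * (s `^ 2^-1 / (s `^ 2^-1 + v)) `^ (1 + alpha).
pose f (s : R) := v `^ (2 - n%:R) * (s `^ ((alpha - 1) / 2) * (s `^ 2^-1 + v) `^ (- (2 + alpha))).
have q0 (s : R) : 0 < s -> 0 < s `^ 2^-1 by move=> s0; exact: powR_gt0.
have qv (s : R) : 0 <= s -> 0 < s `^ 2^-1 + v by move=> s0; rewrite ltr_wpDl ?powR_ge0.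
have dF (s : R) : 0 < s -> is_derive s 1 F (f s).
  move=> s0; have q := q0 _ s0; have qq := qv _ (ltW s0).
  rewrite /F; eder => //.
  - by rewrite divr_gt0.
  - by rewrite gt_eqF.
  have e1 : (s `^ 2^-1 / (s `^ 2^-1 + v)) `^ (1 + alpha - 1) =
      s `^ (alpha / 2) * (s `^ 2^-1 + v) `^ (- alpha).
    rewrite powRM ?invr_ge0 ?(ltW q) ?(ltW qq)// -(powR_inv1 (ltW qq)) -!powRrM.
    by congr (_ `^ _ * _ `^ _); field.
  have e2 : s `^ ((alpha - 1) / 2) = s `^ (alpha / 2) * s `^ (2^-1 - 1).
    by rewrite -powRD; [congr (_ `^ _); field|apply/implyP => _; rewrite gt_eqF].
  have e3 : (s `^ 2^-1 + v) `^ (- (2 + alpha)) =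
      (s `^ 2^-1 + v) `^ (- alpha) * ((s `^ 2^-1 + v) ^+ 2)^-1.
    rewrite (_ : - (2 + alpha) = - alpha + - 2%:R); last by ring.
    rewrite powRD; last by apply/implyP => _; rewrite gt_eqF.
    by congr (_ * _); rewrite powRN powR_mulrn// ltW.
  have e4 : v `^ (2 - n%:R) = v `^ (1 - n%:R) * v.
    rewrite (_ : 2 - n%:R = (1 - n%:R) + 1); last by ring.
    by rewrite powRD ?powRr1 ?(ltW v0)//; apply/implyP => _; rewrite gt_eqF.
  rewrite /= /f e1 e2 e3 e4 /K; move: (s `^ (2^-1 - 1)) (s `^ (alpha / 2)) (v `^ _) => A B C.
  move: ((_ + _) `^ _) => D; field.
  by rewrite !gt_eqF.
have f0 (s : R) : 0 <= f s by rewrite !mulr_ge0 ?powR_ge0.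
have mf : measurable_fun setT f by rewrite /f; mfun.
have F0 (s : R) : 0 <= F s by rewrite mulr_ge0 ?powR_ge0.
have FE : 2 / (1 + alpha) * (v `^ (1 - n%:R) * (Num.sqrt t / (Num.sqrt t + v)) `^ (1 + alpha)) = F t.
  by rewrite /F /K mulrA powR12_sqrt// ltW.
rewrite FE; apply: (@le_trans _ _ (\int[leb1]_(s in `]0%R, t[) (f s)%:E)%E).
  apply: ge0_le_integral => //.
  - move=> s _; rewrite lee_fin; apply: mulr_ge0; last exact: Hk_ge0.
    by rewrite invr_ge0 sqrtr_ge0.
  - apply/measurable_EFinP/measurable_funTS; apply: measurable_funM; first exact: (measurableT_comp (@measurable_invr R setT) (@measurable_sqrt R setT)).
    exact: (@measurable_Hk _ (measurableTypeR R)).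
  - by apply/measurable_EFinP/measurable_funTS.
  - move=> s; rewrite /= in_itv/= => /andP[s0 st]; rewrite lee_fin /f /Hk -/v.
    have q := q0 _ s0; have qq := qv _ (ltW s0).
    have -> : (Num.sqrt s)^-1 * (s `^ (alpha / 2) * (Num.sqrt s + v) `^ (- p)) =
        s `^ ((alpha - 1) / 2) * ((s `^ 2^-1 + v) `^ (- (2 + alpha)) * (s `^ 2^-1 + v) `^ (2 - n%:R)).
      rewrite -powR12_sqrt ?(ltW s0)// [LHS]mulrA; congr (_ * _).
        rewrite -powRN -powRD; last by apply/implyP => _; rewrite gt_eqF.
        by congr (_ `^ _); field.
      rewrite -powRD; last by apply/implyP => _; rewrite gt_eqF.
      by congr (_ `^ _); ring.
    rewrite mulrA [leLHS]mulrC; apply: ler_wpM2r; first by rewrite mulr_ge0 ?powR_ge0.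
    rewrite -opprB; apply: powR_antitone => //; first by rewrite subr_ge0 ler_nat.
    by rewrite lerDr ltW.
rewrite -[in leRHS](subr0 (F t)).
apply: (@ge0_FTC_oo_le _ f F).
- exact: t0.
- by move=> x x0 _; exact: dF.
- move=> x x0 _; have q := q0 _ x0; have qq := qv _ (ltW x0).
  have [df Hf] : {df | is_derive x 1 f df}.
    by eexists; rewrite /f; der.
  exact: derivable_continuous Hf.
- exact: mf.
- by move=> x _ _; exact: f0.
- move=> x x0 xt; apply/andP; split; first exact: F0.
  have qx := qv _ (ltW x0); have qt := qv _ (ltW t0).
  apply: ler_wpM2l; first exact: K0.
  apply: ge0_ler_powR.
  + exact: ltW.
  + by rewrite nnegrE divr_ge0 ?powR_ge0// ltW.
  + by rewrite nnegrE divr_ge0 ?powR_ge0// ltW.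
  have xtq : x `^ 2^-1 <= t `^ 2^-1.
    by apply: ge0_ler_powR; rewrite ?nnegrE ?(ltW x0) ?(ltW t0) ?invr_ge0// ltW.
  rewrite (ler_pdivrMr _ _ qx) mulrAC (ler_pdivlMr _ _ qt).
  rewrite !mulrDr [t `^ _ * x `^ _]mulrC lerD2l; apply: ler_wpM2r; [exact: ltW|exact: xtq].
Qed.
End KernelIntegrals.

Section GaussConv.
Variables (R : realType) (n : nat) (alpha : R).
Hypothesis n0 : (0 < n)%N.
Hypothesis al0 : 0 < alpha.
Hypothesis al2 : alpha < 2.
Local Notation p := (n%:R + alpha).
Implicit Types (u v z w x y : 'rV[R]_n) (a b c r s t : R).

Lemma sqr_euclid_complete u v r s : 0 < r -> 0 < s ->
  euclid u ^+ 2 / r + euclid v ^+ 2 / s =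
  euclid (u + v) ^+ 2 / (r + s) +
  (r + s) / (r * s) * dotRd (v - (s / (r + s)) *: (u + v)) (v - (s / (r + s)) *: (u + v)).
Proof.
move=> r0 s0.
have e c : dotRd (v - c *: (u + v)) (v - c *: (u + v)) = dotRd v v +
    - c * (dotRd u v + dotRd v v) + - c * (dotRd u v + dotRd v v +
    - c * (dotRd u u + dotRd u v) + - c * (dotRd u v + dotRd v v)).
  by rewrite !(dotRdDl, dotRdDr, =^~ scaleNr, dotRdZl, dotRdZr) [dotRd v u]dotRdC; ring.
rewrite e !sqr_euclid !(dotRdDl, dotRdDr) [dotRd v u]dotRdC.
by field; rewrite !gt_eqF// addr_gt0.
Qed.

Lemma integral_Gk_conv b r s x y : 0 < b -> 0 < r -> 0 < s ->
  (\int[leb R n]_z (Gk b r (x - z) * Gk b s (z - y))%:E =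
   ((pi / b) `^ (n%:R / 2) * Gk b (r + s) (x - y))%:E)%E.
Proof.
move=> b0 r0 s0; have T0 : 0 < r + s by rewrite addr_gt0.
set T := r + s in T0 *.
pose k := b * (T / (r * s)).
have k0 : 0 < k by rewrite !mulr_gt0// invr_gt0 mulr_gt0.
(* Completing the square in z: [m] is the minimiser of |x - z|^2 / r + |z - y|^2 / s, and [k] the
   coefficient of the remaining Gaussian. *)
pose m := y + (s / T) *: (x - y).
transitivity (\int[leb R n]_z
   (r `^ (- (n%:R / 2)) * s `^ (- (n%:R / 2)) * expR (- b * euclid (x - y) ^+ 2 / T) *
    expR (- k * dotRd (m - z) (m - z)))%:E)%E.
  apply: eq_integral => z _; congr EFin; rewrite /Gk.
  have := sqr_euclid_complete (x - (z : 'rV[R]_n)) ((z : 'rV[R]_n) - y) r0 s0.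
  rewrite addrA subrK -/T.
  have -> : (z : 'rV[R]_n) - y - (s / T) *: (x - y) = - (m - (z : 'rV[R]_n)).
    by rewrite opprB /m opprD addrA.
  rewrite dotRdNl [dotRd _ (- _)]dotRdC dotRdNl opprK => h.
  rewrite mulrACA -expRD -[in RHS]mulrA -expRD; congr (_ * expR _).
  have -> : - b * euclid (x - z) ^+ 2 / r + - b * euclid ((z : 'rV[R]_n) - y) ^+ 2 / s =
    - b * (euclid (x - z) ^+ 2 / r + euclid ((z : 'rV[R]_n) - y) ^+ 2 / s) by ring.
  by rewrite h /k; ring.
have mG : measurable_fun setT (fun z : rowB R n => expR (- k * dotRd z z)).
  by mfun; exact: measurable_dotRd.
have mG' : measurable_fun setT (fun z : rowB R n => expR (- k * dotRd (m - z) (m - z))).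
  by mfun; apply: measurable_dotRd; apply: measurable_rowD; mfun; exact: measurable_rowN.
rewrite intZ; [|exact: mG'|by move=> z; exact: expR_ge0|by rewrite !mulr_ge0 ?powR_ge0 ?expR_ge0].
rewrite (@integral_rsub _ _ (fun z => (expR (- k * dotRd z z))%:E)); last exact/measurable_EFinP.
rewrite integral_gauss// -EFinM; congr EFin.
have pb : 0 < pi / b by rewrite divr_gt0// pi_gt0.
have rs0 : 0 < r * s by rewrite mulr_gt0.
have -> : Num.sqrt (pi / k) ^+ n =
    (pi / b) `^ (n%:R / 2) * ((r `^ (n%:R / 2) * s `^ (n%:R / 2)) * T `^ (- (n%:R / 2))).
  have kE : pi / k = (pi / b) * (r * s / T) by rewrite /k; field; rewrite !gt_eqF.
  have rsT : 0 < r * s / T by rewrite divr_gt0.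
  have x0 : 0 <= pi / b * (r * s / T) by apply: mulr_ge0; exact: ltW.
  rewrite kE -(powR12_sqrt x0) -powR_mulrn ?powR_ge0// -powRrM.
  rewrite (_ : 2^-1 * n%:R = n%:R / 2); last by field.
  have Ti : 0 <= T^-1 by rewrite invr_ge0 ltW.
  rewrite (powRM _ (ltW pb) (ltW rsT)) (powRM _ (ltW rs0) Ti) (powRM _ (ltW r0) (ltW s0)).
  congr (_ * (_ * _)); rewrite -(powR_inv1 (ltW T0)) -powRrM.
  by congr (_ `^ _); ring.
have e (q : R) : 0 < q -> q `^ (- (n%:R / 2)) * q `^ (n%:R / 2) = 1.
  by move=> q0; rewrite powRN mulVf// gt_eqF// powR_gt0.
rewrite /Gk -/T; have er := e r r0; have es := e s s0.
transitivity ((r `^ (- (n%:R / 2)) * r `^ (n%:R / 2)) * (s `^ (- (n%:R / 2)) * s `^ (n%:R / 2)) *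
  ((pi / b) `^ (n%:R / 2) * (T `^ (- (n%:R / 2)) * expR (- b * euclid (x - y) ^+ 2 / T)))).
  by move: (expR _) => E; ring.
by rewrite er es !mul1r.
Qed.

Lemma integral_Hk_rsub_le t x : 0 < t ->
  (\int[leb R n]_z (Hk alpha t (x - z))%:E <= ((2 * (alpha / n%:R)^-1) ^+ n)%:E)%E.
Proof.
move=> t0; rewrite (@integral_rsub _ _ (fun z => (Hk alpha t z)%:E)).
  exact: integral_Hk_le.
by apply/measurable_EFinP; apply: measurable_Hk; mfun.
Qed.

Lemma measurable_rsub (x : rowB R n) d (T : measurableType d) (f : T -> rowB R n) :
  measurable_fun setT f -> measurable_fun setT (fun z : T => (x : 'rV[R]_n) - f z : rowB R n).
Proof. by move=> mf; apply: measurable_rowD; [mfun|exact: measurable_rowN]. Qed.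

Lemma measurable_rsubr (x : rowB R n) d (T : measurableType d) (f : T -> rowB R n) :
  measurable_fun setT f -> measurable_fun setT (fun z : T => (f z : 'rV[R]_n) - x : rowB R n).
Proof. by move=> mf; apply: measurable_rowD; mfun. Qed.

Lemma integral_Qk_conv b : 0 < b -> exists2 C, 0 <= C & forall a r s x y, 0 < r -> 0 < s ->
  th alpha a (r + s) <= 1 ->
  (\int[leb R n]_z (Qk alpha a b r (x - z) * Qk alpha a b s (z - y))%:E <=
   (C * Qk alpha a b (r + s) (x - y))%:E)%E.
Proof.
move=> b0; set CH := (2 * (alpha / n%:R)^-1) ^+ n.
have CH0 : 0 <= CH by rewrite exprn_ge0// mulr_ge0// invr_ge0 divr_ge0// ltW.
pose B := (2 : R) `^ p * (GH n b + GH n b + 1).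
have B0 : 0 <= B by rewrite mulr_ge0 ?powR_ge0// !addr_ge0 ?GH_ge0.
set Pb := (pi / b) `^ (n%:R / 2); have Pb0 : 0 <= Pb by exact: powR_ge0.
have CC0 := addr_ge0 CH0 CH0; have BC0 := mulr_ge0 B0 CC0.
exists (Pb + B * (CH + CH)); first exact: addr_ge0.
move=> a r s x y r0 s0 t1.
pose A := B * (th alpha a (r + s) * Hk alpha (r + s) (x - y)).
have A0 : 0 <= A by apply: mulr_ge0 => //; apply: mulr_ge0; [exact: th_ge0|exact: Hk_ge0].
have Q_le (z : rowB R n) : Qk alpha a b r (x - z) * Qk alpha a b s ((z : 'rV[R]_n) - y) <=
    Gk b r (x - z) * Gk b s ((z : 'rV[R]_n) - y) +
    A * (Hk alpha r (x - z) + Hk alpha s ((z : 'rV[R]_n) - y)).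
  have := Qk_mul_le al0 al2 (x - (z : 'rV[R]_n)) ((z : 'rV[R]_n) - y) b0 b0 r0 s0 t1.
  by rewrite addrA subrK.
have Q0 (z : rowB R n) : 0 <= Qk alpha a b r (x - z) * Qk alpha a b s ((z : 'rV[R]_n) - y).
  by apply: mulr_ge0; exact: Qk_ge0.
have msr : measurable_fun setT (fun z : rowB R n => x - z : rowB R n).
  by apply: measurable_rsub; exact: measurable_id.
have msl : measurable_fun setT (fun z : rowB R n => (z : 'rV[R]_n) - y : rowB R n).
  by apply: measurable_rsubr; exact: measurable_id.
have mr : measurable_fun setT (fun _ : rowB R n => r) := @measurable_cst _ _ _ _ setT r.
have ms : measurable_fun setT (fun _ : rowB R n => s) := @measurable_cst _ _ _ _ setT s.
have mHH := measurable_funD (measurable_Hk alpha mr msr) (measurable_Hk alpha ms msl).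
have mAH := measurable_funM (@measurable_cst _ _ (rowB R n) R setT A) mHH.
have mGG := measurable_funM (measurable_Gk b mr msr) (measurable_Gk b ms msl).
have mQQ := measurable_funM (measurable_Qk alpha a b mr msr) (measurable_Qk alpha a b ms msl).
apply: le_trans (int_le _ mQQ (measurable_funD mGG mAH) Q0 Q_le) _.
have GG0 (z : rowB R n) : 0 <= Gk b r (x - z) * Gk b s ((z : 'rV[R]_n) - y).
  by apply: mulr_ge0; exact: Gk_ge0.
have H0r (z : rowB R n) : 0 <= Hk alpha r (x - z) by exact: Hk_ge0.
have H0s (z : rowB R n) : 0 <= Hk alpha s ((z : 'rV[R]_n) - y) by exact: Hk_ge0.
have HH0 (z : rowB R n) := addr_ge0 (H0r z) (H0s z).
have AH0 (z : rowB R n) := mulr_ge0 A0 (HH0 z).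
rewrite (intD _ mGG mAH GG0 AH0) (intZ _ mHH HH0 A0).
rewrite (intD _ (measurable_Hk alpha mr msr) (measurable_Hk alpha ms msl) H0r H0s).
rewrite (integral_Gk_conv x y b0 r0 s0).
have E1 : (\int[leb R n]_z (Hk alpha r (x - z))%:E <= CH%:E)%E := integral_Hk_rsub_le x r0.
have E2 : (\int[leb R n]_z (Hk alpha s ((z : 'rV[R]_n) - y))%:E <= CH%:E)%E.
  under eq_integral do rewrite -HkN opprB.
  exact: integral_Hk_rsub_le.
apply: (@le_trans _ _ ((Pb * Gk b (r + s) (x - y) + A * (CH + CH))%:E)).
  rewrite EFinD EFinM [(A * _)%:E]EFinM; apply: leeD2l; apply: lee_wpmul2l; first by rewrite lee_fin.
  exact: leeD E1 E2.
rewrite lee_fin /Qk /A.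
have h1 : 0 <= B * (CH + CH) * Gk b (r + s) (x - y) 
  by apply: mulr_ge0; [exact: BC0|exact: Gk_ge0].
have h2 : 0 <= Pb * (th alpha a (r + s) * Hk alpha (r + s) (x - y)).
  by apply: mulr_ge0 => //; apply: mulr_ge0; [exact: th_ge0|exact: Hk_ge0].
move: h1 h2; clear => h1 h2; lra.
Qed.
End GaussConv.

Section Tonelli.
Context d1 d2 (T1 : measurableType d1) (T2 : measurableType d2) (R : realType).
Variable m1 : {sigma_finite_measure set T1 -> \bar R}.
Variable m2 : {sigma_finite_measure set T2 -> \bar R}.

Lemma tonelli1 (f : T1 * T2 -> R) : measurable_fun setT f -> (forall x, 0 <= f x) ->
  (\int[m1]_x \int[m2]_y (f (x, y))%:E = \int[sprod m1 m2]_z (f z)%:E)%E.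
Proof.
move=> mf f0; rewrite /sprod (@fubini_tonelli1 _ _ T1 T2 R m1 m2 (EFin \o f))//.
exact/measurable_EFinP.
Qed.

Lemma tonelli2 (f : T1 * T2 -> R) : measurable_fun setT f -> (forall x, 0 <= f x) ->
  (\int[m2]_y \int[m1]_x (f (x, y))%:E = \int[sprod m1 m2]_z (f z)%:E)%E.
Proof.
move=> mf f0; rewrite -tonelli1//; apply/esym.
apply: (@fubini_tonelli _ _ T1 T2 R m1 m2 (EFin \o f)).
  exact/measurable_EFinP.
by move=> x; rewrite lee_fin.
Qed.

End Tonelli.

Section Kato.
Variables (R : realType) (n : nat) (alpha : R).
Hypothesis n1 : (1 < n)%N.
Hypothesis al0 : 0 < alpha.
Hypothesis al2 : alpha < 2.
Local Notation leb1 := (@lebesgue_measure R).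
Local Notation p := (n%:R + alpha).
Local Notation n0 := (ltnW n1).
Implicit Types (u v w x y : 'rV[R]_n) (a b c r s t : R).

Definition nearK r u : R := if euclid u < r then euclid u `^ (1 - n%:R) else 0.

Lemma nearK_ge0 r u : 0 <= nearK r u.
Proof. by rewrite /nearK; case: ifP => // _; exact: powR_ge0. Qed.

Lemma measurable_nearK r d (T : measurableType d) (f : T -> rowB R n) :
  measurable_fun setT f -> measurable_fun setT (fun z => nearK r (f z)).
Proof.
move=> mf; have me := measurable_euclid mf.
apply: measurable_fun_ifT; last 2 first.
- by mfun.
- exact: measurable_cst.
by apply: measurable_fun_ltr => //; exact: measurable_cst.
Qed.

Variable f : rowB R n -> R.
Hypothesis mf : measurable_fun setT f.
Hypothesis f0 : forall z, 0 <= f z.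

(** The three factors come from moving the argument of [Hk] within a cube, from the volume (r/n)^n
    of that cube, and from [integral_Hk_le]. *)
Definition CK : R := 2 `^ p * n%:R ^+ n * (2 * (alpha / n%:R)^-1) ^+ n.

Lemma CH_ge0 : 0 <= (2 * (alpha / n%:R)^-1 : R) ^+ n.
Proof. by rewrite exprn_ge0// mulr_ge0// invr_ge0 divr_ge0// ltW. Qed.

Lemma CK_ge0 : 0 <= CK.
Proof.
by apply: mulr_ge0; [apply: mulr_ge0; [exact: powR_ge0|exact: exprn_ge0]|exact: CH_ge0].
Qed.

(** The bound of [integral_time_Hk_le] with r = sqrt t, up to its constant: the Kato kernel
    |u|^(1-n), damped beyond distance r. *)
Definition Wk r u : R := euclid u `^ (1 - n%:R) * (r / (r + euclid u)) `^ (1 + alpha).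

Lemma Wk_ge0 r u : 0 <= Wk r u.
Proof. by apply: mulr_ge0; exact: powR_ge0. Qed.

Lemma measurable_Wk r d (T : measurableType d) (g : T -> rowB R n) :
  measurable_fun setT g -> measurable_fun setT (fun z => Wk r (g z)).
Proof. by move=> mg; have me := measurable_euclid mg; rewrite /Wk; mfun. Qed.

Lemma sqrt_HkE t u : 0 < t -> Num.sqrt t * Hk alpha t u =
  (Num.sqrt t + euclid u) `^ (1 - n%:R) * (Num.sqrt t / (Num.sqrt t + euclid u)) `^ (1 + alpha).
Proof.
move=> t0; have q0 : 0 < Num.sqrt t by rewrite sqrtr_gt0.
have qv : 0 < Num.sqrt t + euclid u by exact: sqrtDeuclid_gt0.
have qi : 0 <= (Num.sqrt t + euclid u)^-1 by rewrite invr_ge0 ltW.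
rewrite /Hk (powRM _ (ltW q0) qi) -(powR_inv1 (ltW qv)) -powRrM.
rewrite [LHS]mulrA [RHS]mulrCA; congr (_ * _).
  have -> : Num.sqrt t `^ (1 + alpha) = Num.sqrt t `^ 1 * Num.sqrt t `^ alpha.
    by rewrite -powRD//; apply/implyP => _; rewrite gt_eqF.
  rewrite (powRr1 (ltW q0)); congr (_ * _).
  by rewrite -(powR12_sqrt (ltW t0)) -powRrM; congr (_ `^ _); field.
rewrite -powRD; first by congr (_ `^ _); ring.
by apply/implyP => _; rewrite gt_eqF.
Qed.

(** Within distance sqrt t the damping factor is at most 1. Beyond it sqrt t + |u| <= 2 |u|, which
    costs 2^(n-1) and leaves sqrt t times [Hk]. *)
Lemma Wk_le t u : 0 < t ->
  Wk (Num.sqrt t) u <= nearK (Num.sqrt t) u + 2 ^+ n.-1 * (Num.sqrt t * Hk alpha t u).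
Proof.
move=> t0; have q0 : 0 < Num.sqrt t by rewrite sqrtr_gt0.
have a1 : 0 <= 1 + alpha by rewrite addr_ge0// ltW.
have v0 := euclid_ge0 u.
have qv : 0 < Num.sqrt t + euclid u by rewrite ltr_pwDl.
have H0 : 0 <= 2 ^+ n.-1 * (Num.sqrt t * Hk alpha t u).
  by apply: mulr_ge0; [exact: exprn_ge0|apply: mulr_ge0; [exact: ltW|exact: Hk_ge0]].
rewrite /nearK; case: ifPn => h.
  apply: (@le_trans _ _ (euclid u `^ (1 - n%:R))); last by rewrite lerDl.
  rewrite /Wk -[leRHS]mulr1; apply: ler_wpM2l; first exact: powR_ge0.
  have : (Num.sqrt t / (Num.sqrt t + euclid u)) `^ (1 + alpha) <= 1 `^ (1 + alpha).
    apply: ge0_ler_powR => //; rewrite ?nnegrE ?divr_ge0 ?(ltW q0) ?(ltW qv)//.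
    by rewrite ler_pdivrMr// mul1r lerDl.
  by rewrite powR1.
rewrite -leNgt in h; rewrite add0r sqrt_HkE// mulrA /Wk.
apply: ler_wpM2r; first exact: powR_ge0.
have -> : 2 ^+ n.-1 * (Num.sqrt t + euclid u) `^ (1 - n%:R) =
    ((Num.sqrt t + euclid u) / 2) `^ (1 - n%:R).
  rewrite (powRM (1 - n%:R) (ltW qv)) ?invr_ge0// mulrC; congr (_ * _).
  rewrite -powR_inv1// -powRrM -powR_mulrn//; congr (_ `^ _).
  by rewrite -subn1 natrB ?n0//; ring.
rewrite -opprB; apply: powR_antitone; [by rewrite subr_ge0 ler1n n0|by rewrite divr_gt0|].
by rewrite ler_pdivrMr// mulr_natr mulr2n lerD2r.
Qed.

Section Fixed.
Variables (t K : R).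
Hypothesis t0 : 0 < t.
Hypothesis hK : forall x, (\int[leb R n]_z (nearK (Num.sqrt t) (x - z) * f z)%:E <= K%:E)%E.
Local Notation r := (Num.sqrt t).

Let r0 : 0 < r. Proof. by rewrite sqrtr_gt0. Qed.

Lemma K_ge0 : 0 <= K.
Proof.
rewrite -lee_fin; apply: le_trans (hK 0); apply: integral_ge0 => z _.
by rewrite lee_fin mulr_ge0// nearK_ge0.
Qed.

Let nR : 0 < n%:R :> R. Proof. by rewrite ltr0n n0. Qed.
(** Half the side of the cube: with r/(2n) in each coordinate, the Euclidean norm on the cube is at
    most r/2. *)
Let c : R := r / (2 * n%:R).
Let c0 : 0 < c. Proof. by rewrite divr_gt0// mulr_gt0. Qed.
Let ind : R -> R := \1_(`](- c), c[%classic).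
Let cube (u : rowB R n) : R := \prod_(i < n) ind (u 0 i).

Let mind : measurable_fun setT ind.
Proof. by apply: measurable_indic. Qed.

Let cube_ge0 u : 0 <= cube u. Proof. by apply: prodr_ge0. Qed.

Let mcube : measurable_fun setT cube.
Proof. by rewrite /cube; mfun; apply: (measurableT_comp mind); exact: measurable_coord. Qed.

Let int_cube (w : 'rV[R]_n) :
  (\int[leb R n]_z (cube (w - z))%:E = ((r / n%:R) ^+ n)%:E)%E.
Proof.
rewrite (@integral_rsub _ _ (fun z => (cube z)%:E)); last exact/measurable_EFinP.
apply: (@integral_prod _ _ ind) => //.
have L : lebesgue_measure (`](- c), c[%classic : set R) = (r / n%:R)%:E.
  rewrite lebesgue_measure_itv/= lte_fin gtrN// -EFinB.
  by congr EFin; rewrite opprK /c; field; rewrite gt_eqF.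
by rewrite integral_indic// setIT; exact: L.
Qed.

(** On the cube |u| <= r/2, so moving the argument by [u] costs 2^p, and r^(n-1) |u|^(1-n) >= 1 lets
    the cube be replaced by [nearK]. At u = 0 this would fail, because 0 to the power 1 - n is 0 by
    convention. *)
Let cube_le u x : u != 0 ->
  cube u * Hk alpha t (x - u) <= 2 `^ p * r ^+ n.-1 * Hk alpha t x * nearK r u.
Proof.
move=> u0; have p0 := p_gt0 n al0.
have nK0 := nearK_ge0 r u.
have P0 : 0 <= (2 : R) `^ p := powR_ge0 2 p.
have R0 : 0 <= r ^+ n.-1 by rewrite exprn_ge0// ltW.
have H0 := Hk_ge0 alpha t x.
case: (pselect (forall i, `|u 0 i| < c)) => [h|/existsNP[i hi]]; last first.
  rewrite /cube (bigD1 i)//= {1}/ind indicE memNset ?mul0r ?mul0r; last first.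
    by rewrite /= in_itv/= -ltr_norml.
  by rewrite mulr_ge0// mulr_ge0// mulr_ge0.
have ur : euclid u <= r / 2.
  apply: le_trans (euclid_le_sum u) _.
  apply: (@le_trans _ _ (\sum_(i < n) c)); first by apply: ler_sum => i _; exact: ltW.
  rewrite sumr_const card_ord -mulr_natr /c; rewrite le_eqVlt; apply/orP; left; apply/eqP.
  by field; rewrite gt_eqF.
have ur' : euclid u < r by apply: le_lt_trans ur _; rewrite ltr_pdivrMr// mulr_natr mulr2n ltrDl.
have e1 : cube u <= 1.
  by apply: prodr_ile1 => i; rewrite /ind indicE ler0n lern1 leq_b1.
have e2 : Hk alpha t (x - u) <= 2 `^ p * Hk alpha t x.
  rewrite /Hk [leRHS]mulrCA; apply: ler_wpM2l; first exact: powR_ge0.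
  have qx : 0 < r + euclid x by exact: sqrtDeuclid_gt0.
  have -> : 2 `^ p * (r + euclid x) `^ (- p) = ((r + euclid x) / 2) `^ (- p).
    rewrite (powRM _ (ltW qx)) ?invr_ge0// mulrC; congr (_ * _).
    by rewrite -powR_inv1// -powRrM; congr (_ `^ _); ring.
  apply: powR_antitone; [exact: ltW|by rewrite divr_gt0|].
  rewrite ler_pdivrMr//; have := euclidD (x - u) u; rewrite subrK.
  move=> /(lerD (lexx r)) h'; apply: le_trans h' _.
  rewrite mulr_natr mulr2n addrA lerD2l; apply: le_trans (ltW ur') _.
  by rewrite lerDl euclid_ge0.
have e3 : 1 <= r ^+ n.-1 * nearK r u.
  rewrite /nearK ur'.
  apply: (@le_trans _ _ (r ^+ n.-1 * r `^ (1 - n%:R))).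
    rewrite -powR_mulrn ?(ltW r0)// -powRD; last by apply/implyP => _; rewrite gt_eqF.
    by rewrite -subn1 natrB ?n0// addrA subrK subrr powRr0.
  apply: ler_wpM2l => //; rewrite -opprB; apply: powR_antitone; last exact: ltW.
    by rewrite subr_ge0 ler1n n0.
  exact: euclid_gt0.
have -> : 2 `^ p * r ^+ n.-1 * Hk alpha t x * nearK r u =
  (2 `^ p * Hk alpha t x) * (r ^+ n.-1 * nearK r u) by ring.
apply: (@le_trans _ _ (1 * (2 `^ p * Hk alpha t x))).
  by apply: ler_pM; [exact: cube_ge0|exact: Hk_ge0|exact: e1|exact: e2].
rewrite mulrC; apply: ler_wpM2l; [exact: mulr_ge0|exact: e3].
Qed.

Lemma nearKN (s : R) u : nearK s (- u) = nearK s u.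
Proof. by rewrite /nearK euclidN. Qed.

Let mrsub (x : 'rV[R]_n) : measurable_fun setT (fun z : rowB R n => x - z : rowB R n).
Proof. by apply: measurable_rsub; exact: measurable_id. Qed.

Let mct : measurable_fun setT (fun _ : rowB R n => t).
Proof. exact: measurable_cst. Qed.

Let mHx x : measurable_fun setT (fun z : rowB R n => Hk alpha t (x - z)).
Proof. exact: (measurable_Hk alpha mct (mrsub x)). Qed.

Let mnear x : measurable_fun setT (fun z : rowB R n => nearK r (x - z)).
Proof. exact: (measurable_nearK r (mrsub x)). Qed.

(* Averaging the kernel over the cube of side [r / n] around [z]. *)
Lemma integral_Hk_f_le x :
  (\int[leb R n]_z (r * (Hk alpha t (x - z) * f z))%:E <= (CK * K)%:E)%E.
Proof.
have Hf0 (z : rowB R n) : 0 <= Hk alpha t (x - z) * f z by apply: mulr_ge0 => //; exact: Hk_ge0.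
have mHf := measurable_funM (mHx x) mf.
rewrite (intZ _ mHf Hf0 (ltW r0)).
pose V : R := (r / n%:R) ^+ n.
have V0 : 0 < V by rewrite exprn_gt0// divr_gt0.
pose g (q : rowB R n * rowB R n) : R :=
  Hk alpha t (x - q.1) * f q.1 * cube ((q.1 : 'rV[R]_n) - q.2).
have g0 q : 0 <= g q by apply: mulr_ge0.
have md : measurable_fun setT (fun q : rowB R n * rowB R n => (q.1 : 'rV[R]_n) - q.2 : rowB R n).
  by apply: measurable_rowD; [exact: measurable_fst|apply: measurable_rowN; exact: measurable_snd].
have mg : measurable_fun setT g.
  apply: measurable_funM; last exact: (measurableT_comp mcube md).
  exact: (measurableT_comp mHf (@measurable_fst _ _ _ _)).
have key : (V%:E * \int[leb R n]_z (Hk alpha t (x - z) * f z)%:E <=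
    (2 `^ p * r ^+ n.-1 * K * (2 * (alpha / n%:R)^-1) ^+ n)%:E)%E.
  rewrite -(intZ _ mHf Hf0 (ltW V0)).
  have -> : (\int[leb R n]_z (V * (Hk alpha t (x - z) * f z))%:E =
      \int[leb R n]_z \int[leb R n]_w (g (z, w))%:E)%E.
    apply: eq_integral => z _; rewrite /g/=.
    rewrite intZ; [|exact: (measurableT_comp mcube (mrsub z))|by move=> w|exact: Hf0].
    by rewrite int_cube -EFinM mulrC.
  rewrite tonelli1// -tonelli2//.
  pose D : R := 2 `^ p * r ^+ n.-1.
  have D0 : 0 <= D by rewrite mulr_ge0 ?powR_ge0// exprn_ge0// ltW.
  have K0 := K_ge0.
  apply: (@le_trans _ _ (\int[leb R n]_w (D * K * Hk alpha t (x - w))%:E)%E).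
    apply: ge0_le_integral => //.
    - by move=> w _; apply: integral_ge0 => z _; rewrite lee_fin.
    - apply: (@measurable_fun_fubini_tonelli_G _ _ (rowB R n) (rowB R n) R (leb R n) (EFin \o g)).
        exact/measurable_EFinP.
      by move=> q; rewrite lee_fin.
    - by apply/measurable_EFinP; apply: measurable_funM; [exact: measurable_cst|exact: mHx].
    - move=> w _; have DH0 : 0 <= D * Hk alpha t (x - w) by apply: mulr_ge0 => //; exact: Hk_ge0.
      have nf0 (z : rowB R n) : 0 <= nearK r (w - z) * f z by apply: mulr_ge0 => //; exact: nearK_ge0.
      have mnf := measurable_funM (mnear w) mf.
      apply: (@le_trans _ _ (\int[leb R n]_z ((D * Hk alpha t (x - w)) * (nearK r (w - z) * f z))%:E)%E).
        apply: (@ae_int_le _ _ w) => //.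
        - exact: n0.
        - apply: (measurableT_comp mg); apply: measurable_fun_pair; [exact: measurable_id|exact: measurable_cst].
        - by apply: measurable_funM; [exact: measurable_cst|exact: mnf].
        - by move=> z; apply: mulr_ge0.
        - move=> z zw; rewrite /g/=.
          have zw0 : (z : 'rV[R]_n) - w != 0 by rewrite subr_eq0.
          have := cube_le (x - w) zw0; rewrite opprB addrA subrK -nearKN opprB -/D => h.
          have := ler_wpM2r (f0 z) h; rewrite [cube _ * _]mulrC => h'.
          by rewrite mulrAC mulrA.
      rewrite (intZ _ mnf nf0 DH0).
      apply: le_trans (lee_wpmul2l _ (hK w)) _; first by rewrite lee_fin.
      by rewrite -EFinM lee_fin mulrAC.
  rewrite (intZ _ (mHx x)); [|by move=> z; exact: Hk_ge0|by rewrite mulr_ge0].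
  apply: le_trans (lee_wpmul2l _ (integral_Hk_rsub_le n0 al0 x t0)) _; first by rewrite lee_fin mulr_ge0.
  by rewrite -EFinM.
move: key; rewrite -lee_pdivlMl// => key.
apply: le_trans (lee_wpmul2l _ key) _; first by rewrite lee_fin ltW.
rewrite -!EFinM lee_fin le_eqVlt; apply/orP; left; apply/eqP.
have rn : r ^+ n = r * r ^+ n.-1 by rewrite -exprS prednK// n0.
rewrite /CK /V expr_div_n rn; field.
by rewrite !gt_eqF// exprn_gt0.
Qed.

Lemma integral_Wk_f_le x :
  (\int[leb R n]_z (Wk r (x - z) * f z)%:E <= ((1 + 2 ^+ n.-1 * CK) * K)%:E)%E.
Proof.
have Hf0 (z : rowB R n) : 0 <= r * (Hk alpha t (x - z) * f z).
  by apply: mulr_ge0; [exact: ltW|apply: mulr_ge0 => //; exact: Hk_ge0].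
have nf0 (z : rowB R n) : 0 <= nearK r (x - z) * f z by apply: mulr_ge0 => //; exact: nearK_ge0.
have mnf := measurable_funM (mnear x) mf.
have mHf : measurable_fun setT (fun z : rowB R n => r * (Hk alpha t (x - z) * f z)).
  by apply: measurable_funM; [exact: measurable_cst|exact: measurable_funM (mHx x) mf].
have P0 : 0 <= (2 : R) ^+ n.-1 by exact: exprn_ge0.
have mPH : measurable_fun setT (fun z : rowB R n => 2 ^+ n.-1 * (r * (Hk alpha t (x - z) * f z))).
  by apply: measurable_funM; [exact: measurable_cst|exact: mHf].
apply: (@le_trans _ _ (\int[leb R n]_z (nearK r (x - z) * f z +
    2 ^+ n.-1 * (r * (Hk alpha t (x - z) * f z)))%:E)%E).
  apply: int_le.
  - by apply: measurable_funM; [exact: (measurable_Wk r (mrsub x))|exact: mf].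
  - exact: measurable_funD mnf mPH.
  - by move=> z; apply: mulr_ge0; [exact: Wk_ge0|exact: f0].
  - move=> z; apply: le_trans (ler_wpM2r (f0 z) (Wk_le (x - z) t0)) _.
    by rewrite mulrDl !mulrA.
rewrite (intD _ mnf mPH nf0); last by move=> z; exact: mulr_ge0.
rewrite (intZ _ mHf Hf0 P0).
apply: le_trans (leeD (hK x) (lee_wpmul2l _ (integral_Hk_f_le x))) _; first by rewrite lee_fin.
by rewrite -EFinM -EFinD lee_fin mulrDl mul1r mulrA.
Qed.

End Fixed.
End Kato.

(** * Space-time integral of the perturbation kernel *)

Lemma quarter_le (R : realType) (s t : R) : 0 < t - s -> s < t - s -> t / 4 <= t - s.
Proof. by move=> *; lra. Qed.

Section Arithmetic.
Variable R : realType.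
Implicit Types A CQ P q f i j w : R.

Lemma kerST_arith0 (X a b c : R) CQ f i : 0 * X <= CQ * (f * (0 * a + b * (0 * i) + 0 * c)).
Proof. by rewrite !mul0r mulr0 !addr0 !mulr0. Qed.

(** The algebra behind the pointwise bound of [kerST] by [gST]: [f] is the drift size at z, [i] and
    [j] are s^(-1/2) and (t-s)^(-1/2), [h1], [h2] and [H] are the values of [Hk] at (t-s, x-z), (s,
    z-y) and (t, x-z). *)
Lemma kerST_arith1 (Q1 Q2 h1 h2 H : R) f i j P CQ : 0 <= f -> 0 <= i -> 0 <= CQ ->
  Q1 * Q2 <= CQ * (h1 + h2) -> i * h1 <= j * h1 + P * (i * H) ->
  1 * (Q1 * (f * (i * Q2))) <= CQ * (f * (1 * (j * h1) + P * H * (1 * i) + 1 * (i * h2))).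
Proof.
move=> f0 i0 C0 hQ hi.
apply: (@le_trans _ _ ((f * i) * (CQ * (h1 + h2)))).
  have -> : 1 * (Q1 * (f * (i * Q2))) = (f * i) * (Q1 * Q2) by ring.
  by apply: ler_wpM2l => //; exact: mulr_ge0.
have -> : f * i * (CQ * (h1 + h2)) = CQ * (f * (i * h1 + i * h2)) by ring.
have -> : 1 * (j * h1) + P * H * (1 * i) + 1 * (i * h2) =
  j * h1 + P * (i * H) + i * h2 by ring.
by apply: ler_wpM2l => //; apply: ler_wpM2l => //; rewrite lerD2r.
Qed.

Lemma time_arith (w1 w2 H : R) f A P q : f * (A * w1 + P * H * (2 * q) + A * w2) =
  A * (w1 * f) + P * 2 * (q * (H * f)) + A * (w2 * f).
Proof. ring. Qed.

End Arithmetic.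

Section TimeIntegrals.
Variables (R : realType) (n : nat) (alpha : R).
Hypothesis n1 : (1 < n)%N.
Hypothesis al0 : 0 < alpha.
Hypothesis al2 : alpha < 2.
Local Notation leb1 := (@lebesgue_measure R).
Local Notation p := (n%:R + alpha).
Local Notation n0 := (ltnW n1).
Implicit Types (u v w x y : 'rV[R]_n) (a b c r s t : R).

(** The time restriction is kept as a factor, so that space-time integrals run over the whole
    product space. *)
Definition indt t (s : R) : R := \1_(`]0%R, t[%classic) s.

Lemma indt_ge0 t s : 0 <= indt t s.
Proof. by rewrite /indt indicE. Qed.

Lemma indtE t s : indt t s = ((0 < s) && (s < t))%:R.
Proof. by rewrite /indt indicE mem_setE in_itv. Qed.

Lemma indt_sub t s : indt t (t - s) = indt t s.
Proof. by rewrite !indtE subr_gt0 ltrBlDr ltrDl andbC. Qed.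

Lemma measurable_indt t d (T : measurableType d) (g : T -> R) : measurable_fun setT g ->
  measurable_fun setT (fun x : T => indt t (g x)).
Proof.
move=> mg; apply: (measurableT_comp _ mg).
by apply: measurable_indic; exact: measurable_itv.
Qed.

Lemma integral_indt t (h : R -> R) :
  (\int[leb1]_(s in `]0%R, t[) (h s)%:E = \int[leb1]_s (indt t s * h s)%:E)%E.
Proof.
rewrite integral_mkcond; apply: eq_integral => s _; rewrite patchE /indt indicE.
by case: ifPn => _; rewrite ?mul1r ?mul0r.
Qed.

Lemma measurable_rsqrt d (T : measurableType d) (g : T -> R) : measurable_fun setT g ->
  measurable_fun setT (fun x : T => (Num.sqrt (g x))^-1).
Proof.
move=> mg; apply: (measurableT_comp (@measurable_invr R setT)).
exact: (measurableT_comp (@measurable_sqrt R setT) mg).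
Qed.

Lemma integral_indt_rsqrt_le t : 0 < t ->
  (\int[leb1]_s (indt t s * (Num.sqrt s)^-1)%:E <= (2 * Num.sqrt t)%:E)%E.
Proof.
move=> t0; rewrite -integral_indt.
pose f (s : R) := s `^ (- 2^-1); pose F (s : R) := 2 * s `^ 2^-1.
apply: (@le_trans _ _ (\int[leb1]_(s in `]0%R, t[) (f s)%:E)%E).
  rewrite le_eqVlt; apply/orP; left; apply/eqP; apply: eq_integral => s.
  rewrite inE/= in_itv/= => /andP[s0 _]; congr EFin.
  by rewrite /f powRN powR12_sqrt// ltW.
have -> : 2 * Num.sqrt t = F t - 0 by rewrite subr0 /F powR12_sqrt// ltW.
apply: (@ge0_FTC_oo_le _ f F).
- exact: t0.
- move=> s s0 _; rewrite /F; eder; first exact: s0.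
  rewrite /= /f (_ : 2^-1 - 1 = - 2^-1); last by field.
  by field.
- move=> s s0 _; have [df Hf] : {df | is_derive s 1 f df}.
    by eexists; rewrite /f; der.
  exact: derivable_continuous Hf.
- exact: measurable_powR.
- by move=> s _ _; exact: powR_ge0.
- move=> s s0 st; rewrite /F mulr_ge0 ?powR_ge0//=; apply: ler_wpM2l => //.
  by apply: ge0_ler_powR; rewrite ?nnegrE ?(ltW s0) ?(ltW t0) ?invr_ge0// ltW.
Qed.

Let A : R := 2 / (1 + alpha).

Let A_ge0 : 0 <= A. Proof. by rewrite divr_ge0// addr_ge0// ltW. Qed.

Lemma measurable_rsqrt_Hk u : measurable_fun setT (fun s : R => (Num.sqrt s)^-1 * Hk alpha s u).
Proof.
apply: measurable_funM; first exact: measurable_rsqrt.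
by apply: (@measurable_Hk _ _ _ _ (measurableTypeR R)); [exact: measurable_id|exact: measurable_cst].
Qed.

Lemma integral_indt_Hk_le t u : 0 < t -> u != 0 ->
  (\int[leb1]_s (indt t s * ((Num.sqrt s)^-1 * Hk alpha s u))%:E <= (A * Wk alpha (Num.sqrt t) u)%:E)%E.
Proof. by move=> t0 u0; rewrite -integral_indt; exact: integral_time_Hk_le. Qed.

Lemma integral_indt_Hk_sub_le t u : 0 < t -> u != 0 ->
  (\int[leb1]_s (indt t s * ((Num.sqrt (t - s))^-1 * Hk alpha (t - s) u))%:E <=
   (A * Wk alpha (Num.sqrt t) u)%:E)%E.
Proof.
move=> t0 u0; apply: le_trans (integral_indt_Hk_le t0 u0).
pose F (s : R) := (indt t s * ((Num.sqrt s)^-1 * Hk alpha s u))%:E.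
have mF : measurable_fun setT F.
  apply/measurable_EFinP; apply: measurable_funM; first exact: (@measurable_indt t _ (measurableTypeR R)).
  exact: measurable_rsqrt_Hk.
have F0 s : (0 <= F s)%E.
  rewrite lee_fin; apply: mulr_ge0; first exact: indt_ge0.
  by apply: mulr_ge0; [rewrite invr_ge0 sqrtr_ge0|exact: Hk_ge0].
have mFt : measurable_fun setT (fun s : R => F (s + t)).
  by apply: (measurableT_comp mF); exact: measurable_funD.
rewrite -[leRHS](@ge0_integral_shift1 R F t mF F0).
rewrite -(@ge0_integral_opp1 R (fun s => F (s + t)) mFt (fun s => F0 _)).
rewrite le_eqVlt; apply/orP; left; apply/eqP; apply: eq_integral => s _.
by rewrite /F [- s + t]addrC indt_sub.
Qed.

(** The factor s^(-1/2) and the kernel at time t - s are singular at opposite ends. If s >= t/2,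
    then s^(-1/2) <= (t-s)^(-1/2), which restores the form of [integral_time_Hk_le]; if s < t/2, the
    kernel is comparable to its value at time t. *)
Lemma rsqrt_Hk_sub_le t s u : 0 < s -> s < t ->
  (Num.sqrt s)^-1 * Hk alpha (t - s) u <=
  (Num.sqrt (t - s))^-1 * Hk alpha (t - s) u + 2 `^ p * ((Num.sqrt s)^-1 * Hk alpha t u).
Proof.
move=> s0 st; have t0 := lt_trans s0 st; have ts : 0 < t - s by rewrite subr_gt0.
have p0 := p_gt0 n al0.
have i0 : 0 <= (Num.sqrt s)^-1 by rewrite invr_ge0 sqrtr_ge0.
have j0 : 0 <= (Num.sqrt (t - s))^-1 by rewrite invr_ge0 sqrtr_ge0.
have [h|h] := leP (t - s) s.
  apply: (@le_trans _ _ ((Num.sqrt (t - s))^-1 * Hk alpha (t - s) u)).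
    apply: ler_wpM2r; first exact: Hk_ge0.
    by rewrite lef_pV2 ?posrE ?sqrtr_gt0// ler_wsqrtr.
  rewrite lerDl; apply: mulr_ge0; first exact: powR_ge0.
  by apply: mulr_ge0 => //; exact: Hk_ge0.
apply: (@le_trans _ _ (2 `^ p * ((Num.sqrt s)^-1 * Hk alpha t u))); last first.
  by rewrite lerDr; apply: mulr_ge0 => //; exact: Hk_ge0.
rewrite [leRHS]mulrCA; apply: ler_wpM2l => //.
rewrite /Hk [leRHS]mulrCA; apply: ler_pM; rewrite ?powR_ge0//.
  apply: ge0_ler_powR; rewrite ?nnegrE ?(ltW ts) ?(ltW t0)//.
    by rewrite divr_ge0// ltW.
  by rewrite lerBlDr lerDl ltW.
have qt : 0 < Num.sqrt t + euclid u by exact: sqrtDeuclid_gt0.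
have -> : 2 `^ p * (Num.sqrt t + euclid u) `^ (- p) = ((Num.sqrt t + euclid u) / 2) `^ (- p).
  rewrite (powRM _ (ltW qt)) ?invr_ge0// mulrC; congr (_ * _).
  by rewrite -powR_inv1// -powRrM; congr (_ `^ _); ring.
apply: powR_antitone; [exact: ltW|by rewrite divr_gt0|].
rewrite mulrDl; apply: lerD; last by rewrite ler_pdivrMr// mulr_natr mulr2n lerDl euclid_ge0.
have -> : Num.sqrt t / 2 = Num.sqrt (t / 4).
  have e4 : (4 : R)^-1 = (2^-1) ^+ 2 by rewrite exprVn; congr (_^-1); ring.
  by rewrite sqrtrM ?(ltW t0)// e4 sqrtr_sqr ger0_norm// invr_ge0.
by apply: ler_wsqrtr; exact: quarter_le.
Qed.

Section SpaceTime.
Variable f : rowB R n -> R.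
Hypothesis mf : measurable_fun setT f.
Hypothesis f0 : forall z, 0 <= f z.

Definition kerST a b b' t x y (q : R * rowB R n) : R :=
  indt t q.1 * (Qk alpha a b (t - q.1) (x - q.2) *
    (f q.2 * ((Num.sqrt q.1)^-1 * Qk alpha a b' q.1 ((q.2 : 'rV[R]_n) - y)))).

Lemma kerST_ge0 a b b' t x y q : 0 <= kerST a b b' t x y q.
Proof.
apply: mulr_ge0; first exact: indt_ge0.
apply: mulr_ge0; first exact: Qk_ge0.
apply: mulr_ge0; first exact: f0.
by apply: mulr_ge0; [rewrite invr_ge0 sqrtr_ge0|exact: Qk_ge0].
Qed.

Let mS : measurable_fun setT (fun q : measurableTypeR R * rowB R n => q.1 : R).
Proof. exact: measurable_fst. Qed.
Let mZ : measurable_fun setT (fun q : measurableTypeR R * rowB R n => q.2).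
Proof. exact: measurable_snd. Qed.
Let mtS t : measurable_fun setT (fun q : measurableTypeR R * rowB R n => t - q.1 : R).
Proof. by apply: measurable_funB; [exact: measurable_cst|exact: mS]. Qed.
Let mxZ x : measurable_fun setT (fun q : measurableTypeR R * rowB R n => x - q.2 : rowB R n).
Proof. by apply: measurable_rsub; exact: mZ. Qed.
Let mZy y : measurable_fun setT (fun q : measurableTypeR R * rowB R n => (q.2 : 'rV[R]_n) - y : rowB R n).
Proof. by apply: measurable_rsubr; exact: mZ. Qed.

Lemma measurable_kerST a b b' t x y :
  measurable_fun setT (kerST a b b' t x y : measurableTypeR R * rowB R n -> R).
Proof.
apply: measurable_funM; first exact: measurable_indt.
apply: measurable_funM; first exact: measurable_Qk.
apply: measurable_funM; first exact: (measurableT_comp mf mZ).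
apply: measurable_funM; first exact: measurable_rsqrt.
exact: measurable_Qk.
Qed.

Let CW : R := (1 + 2 ^+ n.-1 * CK n alpha).

(** What remains of [kerST] once the three-point inequality has taken out a multiple of [Qk] at (t,
    x - y). The first two terms are the two cases of [rsqrt_Hk_sub_le]. *)
Definition gST t x y (q : measurableTypeR R * rowB R n) : R := f q.2 * (
  indt t q.1 * ((Num.sqrt (t - q.1))^-1 * Hk alpha (t - q.1) (x - q.2)) +
  2 `^ p * Hk alpha t (x - q.2) * (indt t q.1 * (Num.sqrt q.1)^-1) +
  indt t q.1 * ((Num.sqrt q.1)^-1 * Hk alpha q.1 ((q.2 : 'rV[R]_n) - y))).

Let isq_ge0 (s : R) : 0 <= (Num.sqrt s)^-1. Proof. by rewrite invr_ge0 sqrtr_ge0. Qed.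
Let t1_ge0 t s r u : 0 <= indt t s * ((Num.sqrt r)^-1 * Hk alpha r u).
Proof. by apply: mulr_ge0; [exact: indt_ge0|apply: mulr_ge0; [exact: isq_ge0|exact: Hk_ge0]]. Qed.
Let t2_ge0 t s u : 0 <= 2 `^ p * Hk alpha t u * (indt t s * (Num.sqrt s)^-1).
Proof.
by apply: mulr_ge0; apply: mulr_ge0; [exact: powR_ge0|exact: Hk_ge0|exact: indt_ge0|exact: isq_ge0].
Qed.

Lemma gST_ge0 t x y q : 0 <= gST t x y q.
Proof.
apply: mulr_ge0; first exact: f0.
by apply: addr_ge0; [apply: addr_ge0; [exact: t1_ge0|exact: t2_ge0]|exact: t1_ge0].
Qed.

Lemma measurable_gST t x y : measurable_fun setT (gST t x y).
Proof.
apply: measurable_funM; first exact: (measurableT_comp mf mZ).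
apply: measurable_funD; first apply: measurable_funD.
- apply: measurable_funM; first exact: measurable_indt.
  by apply: measurable_funM; [exact: measurable_rsqrt|exact: measurable_Hk].
- apply: measurable_funM; last first.
    by apply: measurable_funM; [exact: measurable_indt|exact: measurable_rsqrt].
  apply: measurable_funM; first exact: measurable_cst.
  by apply: measurable_Hk; [exact: measurable_cst|exact: mxZ].
- apply: measurable_funM; first exact: measurable_indt.
  by apply: measurable_funM; [exact: measurable_rsqrt|exact: measurable_Hk].
Qed.

Lemma integral_time_g_le t x y (z : rowB R n) : 0 < t -> (z : 'rV[R]_n) != x -> (z : 'rV[R]_n) != y ->
  (\int[leb1]_s (gST t x y (s, z))%:E <=
   (A * (Wk alpha (Num.sqrt t) (x - z) * f z) +
    2 `^ p * 2 * (Num.sqrt t * (Hk alpha t (x - z) * f z)) +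
    A * (Wk alpha (Num.sqrt t) (y - z) * f z))%:E)%E.
Proof.
move=> t0 zx zy.
have xz0 : x - (z : 'rV[R]_n) != 0 by rewrite subr_eq0 eq_sym.
have zy0 : (z : 'rV[R]_n) - y != 0 by rewrite subr_eq0.
have mi : measurable_fun setT (fun s : measurableTypeR R => indt t s) by exact: measurable_indt.
have mts : measurable_fun setT (fun s : measurableTypeR R => t - s : R).
  by apply: measurable_funB; [exact: measurable_cst|exact: measurable_id].
have m1 : measurable_fun setT (fun s : measurableTypeR R =>
    indt t s * ((Num.sqrt (t - s))^-1 * Hk alpha (t - s) (x - z))).
  apply: measurable_funM; first exact: mi.
  apply: measurable_funM; first exact: measurable_rsqrt.
  by apply: measurable_Hk; [exact: mts|exact: measurable_cst].
have m2' : measurable_fun setT (fun s : measurableTypeR R => indt t s * (Num.sqrt s)^-1).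
  by apply: measurable_funM; [exact: mi|exact: measurable_rsqrt].
have m2 : measurable_fun setT (fun s : measurableTypeR R =>
    2 `^ p * Hk alpha t (x - z) * (indt t s * (Num.sqrt s)^-1)).
  by apply: measurable_funM; [exact: measurable_cst|exact: m2'].
have m3 : measurable_fun setT (fun s : measurableTypeR R =>
    indt t s * ((Num.sqrt s)^-1 * Hk alpha s ((z : 'rV[R]_n) - y))).
  by apply: measurable_funM; [exact: mi|exact: measurable_rsqrt_Hk].
have m12 := measurable_funD m1 m2.
have K0 : 0 <= 2 `^ p * Hk alpha t (x - z) by apply: mulr_ge0; [exact: powR_ge0|exact: Hk_ge0].
rewrite /gST /=.
rewrite (@intZ _ (measurableTypeR R) R leb1 (f z) _ (measurable_funD m12 m3)); last 2 first.
- by move=> s; apply: addr_ge0; [apply: addr_ge0; [exact: t1_ge0|exact: t2_ge0]|exact: t1_ge0].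
- exact: f0.
rewrite (@intD _ (measurableTypeR R) R leb1 _ _ m12 m3); last 2 first.
- by move=> s; apply: addr_ge0; [exact: t1_ge0|exact: t2_ge0].
- by move=> s; exact: t1_ge0.
rewrite (@intD _ (measurableTypeR R) R leb1 _ _ m1 m2); last 2 first.
- by move=> s; exact: t1_ge0.
- by move=> s; exact: t2_ge0.
rewrite (@intZ _ (measurableTypeR R) R leb1 _ _ m2'); last 2 first.
- by move=> s; apply: mulr_ge0; [exact: indt_ge0|exact: isq_ge0].
- exact: K0.
have e3 := integral_indt_Hk_le t0 zy0.
have WE : Wk alpha (Num.sqrt t) ((z : 'rV[R]_n) - y) = Wk alpha (Num.sqrt t) (y - z).
  by rewrite /Wk -opprB euclidN.
rewrite WE in e3.
have K0e : (0 <= (2 `^ p * Hk alpha t (x - z))%:E)%E by rewrite lee_fin.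
have f0e : (0 <= (f z)%:E)%E by rewrite lee_fin.
have h := leeD (leeD (integral_indt_Hk_sub_le t0 xz0)
  (lee_wpmul2l K0e (integral_indt_rsqrt_le t0))) e3.
by apply: le_trans (lee_wpmul2l f0e h) _; rewrite -time_arith.
Qed.

Lemma integral_g_le t K x y : 0 < t ->
  (forall x, (\int[leb R n]_z (nearK (Num.sqrt t) (x - z) * f z)%:E <= K%:E)%E) ->
  (\int[sprod leb1 (leb R n)]_q (gST t x y q)%:E <=
   ((A * CW + 2 `^ p * 2 * CK n alpha + A * CW) * K)%:E)%E.
Proof.
move=> t0 hK; have q0 : 0 <= Num.sqrt t by exact: sqrtr_ge0.
(* Time is integrated first: this produces the kernels [Wk] and sqrt t times [Hk], whose integrals
   against the drift are controlled by the Kato bound. It is done for z different from x and y, that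
   is almost everywhere. *)
rewrite -(@tonelli2 _ _ (measurableTypeR R) (rowB R n) R leb1 (leb R n) _ (measurable_gST t x y) (gST_ge0 t x y)).
have mrsub (x' : 'rV[R]_n) : measurable_fun setT (fun z : rowB R n => x' - z : rowB R n).
  by apply: measurable_rsub; exact: measurable_id.
have mW x' : measurable_fun setT (fun z : rowB R n => Wk alpha (Num.sqrt t) (x' - z) * f z).
  by apply: measurable_funM; [exact: measurable_Wk|exact: mf].
have mHf : measurable_fun setT (fun z : rowB R n => Num.sqrt t * (Hk alpha t (x - z) * f z)).
  apply: measurable_funM; first exact: measurable_cst.
  apply: measurable_funM; last exact: mf.
  by apply: measurable_Hk; [exact: measurable_cst|exact: mrsub].
have W0 x' (z : rowB R n) : 0 <= Wk alpha (Num.sqrt t) (x' - z) * f z.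
  by apply: mulr_ge0; [exact: Wk_ge0|exact: f0].
have H0 (z : rowB R n) : 0 <= Num.sqrt t * (Hk alpha t (x - z) * f z).
  by apply: mulr_ge0 => //; apply: mulr_ge0; [exact: Hk_ge0|exact: f0].
have P0 : 0 <= (2 : R) `^ p * 2 by rewrite mulr_ge0// powR_ge0.
have mAW x' := measurable_funM (@measurable_cst _ _ (rowB R n) R setT A) (mW x').
have mPH := measurable_funM (@measurable_cst _ _ (rowB R n) R setT (2 `^ p * 2)) mHf.
have AW0 x' (z : rowB R n) := mulr_ge0 A_ge0 (W0 x' z).
have PH0 (z : rowB R n) := mulr_ge0 P0 (H0 z).
have m12 := measurable_funD (mAW x) mPH.
have s12 (z : rowB R n) := addr_ge0 (AW0 x z) (PH0 z).
apply: (@le_trans _ _ (\int[leb R n]_z (A * (Wk alpha (Num.sqrt t) (x - z) * f z) +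
    2 `^ p * 2 * (Num.sqrt t * (Hk alpha t (x - z) * f z)) +
    A * (Wk alpha (Num.sqrt t) (y - z) * f z))%:E)%E).
  apply: ae_ge0_le_integral.
  - exact: measurableT.
  - by move=> z _; apply: integral_ge0 => s _; rewrite lee_fin; exact: gST_ge0.
  - apply: (@measurable_fun_fubini_tonelli_G _ _ (measurableTypeR R) (rowB R n) R leb1 (EFin \o gST t x y)).
      by apply/measurable_EFinP; exact: measurable_gST.
    by move=> q; rewrite lee_fin; exact: gST_ge0.
  - by move=> z _; rewrite lee_fin; apply: addr_ge0; [exact: s12|exact: AW0].
  - by apply/measurable_EFinP; exact: measurable_funD m12 (mAW y).
  - have h1 := ae_neq0 x n0; have h2 := ae_neq0 y n0.
    by apply: filterS2 h1 h2 => z zx zy _; exact: integral_time_g_le.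
rewrite (intD _ m12 (mAW y) s12 (AW0 y)) (intD _ (mAW x) mPH (AW0 x) PH0).
rewrite (intZ _ (mW x) (W0 x) A_ge0) (intZ _ (mW y) (W0 y) A_ge0) (intZ _ mHf H0 P0).
have EW x' := integral_Wk_f_le n1 al0 mf f0 t0 hK x'.
have EH := integral_Hk_f_le n1 al0 mf f0 t0 hK x.
have h := leeD (leeD (lee_wpmul2l (_ : 0 <= A%:E)%E (EW x))
  (lee_wpmul2l (_ : 0 <= (2 `^ p * 2)%:E)%E EH)) (lee_wpmul2l (_ : 0 <= A%:E)%E (EW y)).
apply: le_trans (h _ _ _) _; rewrite ?lee_fin//.
rewrite le_eqVlt; apply/orP; left; apply/eqP; rewrite /CW; ring.
Qed.

End SpaceTime.

(** The constant depends only on the dimension, alpha and the two exponents. The drift enters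
    through the Kato bound [K] alone, and a through [th] <= 1, so smallness can later be arranged
    uniformly in a. *)
Lemma integral_kerST_le b b' : 0 < b -> b < b' -> exists2 C, 0 <= C &
  forall (f : rowB R n -> R) a t K x y, measurable_fun setT f -> (forall z, 0 <= f z) ->
  0 < t -> th alpha a t <= 1 ->
  (forall x, (\int[leb R n]_z (nearK (Num.sqrt t) (x - z) * f z)%:E <= K%:E)%E) ->
  (\int[sprod leb1 (leb R n)]_q (kerST f a b b' t x y q)%:E <= (C * K * Qk alpha a b t (x - y))%:E)%E.
Proof.
move=> b0 bb; have [C1 C10 H] := Qk_3P n al0 al2 b0 bb.
have CK0 := CK_ge0 n al0.
pose D := (A * (1 + 2 ^+ n.-1 * CK n alpha) + 2 `^ p * 2 * CK n alpha + A * (1 + 2 ^+ n.-1 * CK n alpha)).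
have D0 : 0 <= D.
  have h : 0 <= A * (1 + 2 ^+ n.-1 * CK n alpha).
    by apply: mulr_ge0 => //; apply: addr_ge0 => //; apply: mulr_ge0 => //; exact: exprn_ge0.
  have h2 : 0 <= 2 `^ p * 2 * CK n alpha by apply: mulr_ge0 => //; rewrite mulr_ge0// powR_ge0.
  by apply: addr_ge0 => //; exact: addr_ge0.
exists (C1 * D); first exact: mulr_ge0.
move=> f a t K x y mf f0 t0 th1 hK.
have Q0 : 0 <= C1 * Qk alpha a b t (x - y) by apply: mulr_ge0 => //; exact: Qk_ge0.
have I := integral_g_le mf f0 x y t0 hK.
have -> : C1 * D * K * Qk alpha a b t (x - y) = (C1 * Qk alpha a b t (x - y)) * (D * K) by ring.
apply: (@le_trans _ _ (\int[sprod leb1 (leb R n)]_q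
    ((C1 * Qk alpha a b t (x - y)) * gST f t x y q)%:E)%E).
  apply: int_le.
  - exact: measurable_kerST.
  - by apply: measurable_funM; [exact: measurable_cst|exact: measurable_gST].
  - by move=> q; exact: kerST_ge0.
  - move=> [s z]; rewrite /kerST /gST /=.
    case: (boolP ((0 < s) && (s < t))) => [/andP[s0 st]|h]; last first.
      have -> : indt t s = 0 by rewrite indtE (negbTE h).
      exact: kerST_arith0.
    have -> : indt t s = 1 by rewrite indtE s0 st.
    have ts : 0 < t - s by rewrite subr_gt0.
    have := H a (t - s) s (x - z) ((z : 'rV[R]_n) - y) ts s0.
    rewrite subrK addrA subrK => /(_ th1) h.
    have i0 : 0 <= (Num.sqrt s)^-1 by rewrite invr_ge0 sqrtr_ge0.
    exact: (kerST_arith1 (f0 z) i0 Q0 h (rsqrt_Hk_sub_le (x - z) s0 st)).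
rewrite (intZ _ (measurable_gST mf t x y) (gST_ge0 f0 t x y) Q0).
apply: le_trans (lee_wpmul2l _ I) _; first by rewrite lee_fin.
by rewrite -EFinM.
Qed.

End TimeIntegrals.

Lemma addr_half (R : realType) (t : R) : t / 2 + t / 2 = t.
Proof. by field. Qed.

(** * Duhamel's equation *)

Section SpaceTimeTools.
Variables (R : realType) (n : nat).
Local Notation leb1 := (@lebesgue_measure R : {sigma_finite_measure set (measurableTypeR R) -> \bar R}).
Local Notation Tm := (measurableTypeR R).
Local Notation X := (rowB R n).
Local Notation leb := (leb R n).

Lemma measurable_indt2 d (T : measurableType d) (f g : T -> R) :
  measurable_fun setT f -> measurable_fun setT g ->
  measurable_fun setT (fun u => indt (f u) (g u)).
Proof.
move=> mf mg.
have -> : (fun u => indt (f u) (g u)) = (fun u => if 0 < g u then (if g u < f u then 1 else 0) else 0).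
  by apply/funext => u; rewrite indtE; case: (0 < g u); case: (g u < f u).
have m1 : measurable_fun setT (fun u : T => 0 < g u).
  by apply: measurable_fun_ltr => //; exact: measurable_cst.
have m2 : measurable_fun setT (fun u : T => g u < f u) by exact: measurable_fun_ltr.
apply: measurable_fun_ifT; [exact: m1| |exact: measurable_cst].
by apply: measurable_fun_ifT; [exact: m2|exact: measurable_cst|exact: measurable_cst].
Qed.

Lemma Rint_swap d1 d2 (T1 : measurableType d1) (T2 : measurableType d2)
    (m1 : {sigma_finite_measure set T1 -> \bar R}) (m2 : {sigma_finite_measure set T2 -> \bar R})
    (H K : T1 * T2 -> R) :
  measurable_fun setT H -> measurable_fun setT K -> (forall u, 0 <= K u) ->
  (forall u, `|H u| <= K u) ->
  (\int[m1]_x \int[m2]_y (K (x, y))%:E < +oo)%E ->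
  \int[m1]_x \int[m2]_y H (x, y) = \int[m2]_y \int[m1]_x H (x, y).
Proof.
move=> mH mK K0 HK fin.
have iK : (sprod m1 m2).-integrable setT (EFin \o K).
  by apply: ge0_integrable => //; rewrite -tonelli1.
have iH := integrable_dom mH HK iK.
by rewrite Rintegral_sprod1// Rintegral_sprod2.
Qed.

Lemma Rint_shift1 (f : R -> R) (c : R) : measurable_fun setT f ->
  \int[leb1]_s f (s + c) = \int[leb1]_s f s.
Proof.
move=> mf; congr fine; rewrite integralE [RHS]integralE; congr (_ - _)%E.
  rewrite -[RHS](@ge0_integral_shift1 R _ c); [|apply: measurable_funepos; exact/measurable_EFinP|by []].
  by apply: eq_integral => s _; rewrite !funeposE.
rewrite -[RHS](@ge0_integral_shift1 R _ c); [|apply: measurable_funeneg; exact/measurable_EFinP|by []].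
by apply: eq_integral => s _; rewrite !funenegE.
Qed.

Lemma Rint_sprod_shift (F : Tm * X -> R) (c : R) :
  (sprod leb1 leb).-integrable setT (EFin \o F) ->
  \int[sprod leb1 leb]_q F (q.1 + c, q.2) = \int[sprod leb1 leb]_q F q.
Proof.
move=> iF.
have mF : measurable_fun setT F by apply/measurable_EFinP; exact: measurable_int iF.
have msh : measurable_fun setT (fun q : Tm * X => (q.1 + c : Tm, q.2)).
  apply: measurable_fun_pair; last exact: measurable_snd.
  by apply: (@measurable_funD _ _ R); [exact: measurable_fst|exact: measurable_cst].
have mF' := measurableT_comp mF msh.
have iF' : (sprod leb1 leb).-integrable setT (EFin \o (fun q => F (q.1 + c, q.2))).
  apply/integrableP; split; first exact/measurable_EFinP.
  case/integrableP: (iF) => _; apply: le_lt_trans.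
  have mN (G : Tm * X -> R) : measurable_fun setT G -> measurable_fun setT (fun q => `|G q|).
    by move=> mG; apply: (measurableT_comp (@normr_measurable R setT)).
  have mFN := mN _ mF.
  have T1 := tonelli1 leb1 leb (mN _ mF') (fun q => normr_ge0 _).
  have T2 := tonelli1 leb1 leb mFN (fun q => normr_ge0 _).
  rewrite /= -T1 -T2 /=.
  pose g (s : R) : \bar R := (\int[leb]_y (`|F (s, y)|)%:E)%E.
  have mg : measurable_fun setT g.
    apply: (@measurable_fun_fubini_tonelli_F _ _ Tm X R leb (EFin \o (fun q => `|F q|))).
      exact/measurable_EFinP.
    by move=> q; rewrite lee_fin.
  have g0 s : (0 <= g s)%E by apply: integral_ge0 => y _; rewrite lee_fin.
  by rewrite -[leRHS](@ge0_integral_shift1 R g c mg g0).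
rewrite -(Rintegral_sprod1 iF') -(Rintegral_sprod1 iF) /=.
apply: (Rint_shift1 (f := fun s => \int[leb]_y F (s, y))).
exact: (@measurable_Rintegral _ _ Tm X R leb F mF).
Qed.

Lemma Rint_sprod_eq (F H : Tm * X -> R) (c : R) :
  (sprod leb1 leb).-integrable setT (EFin \o F) ->
  (sprod leb1 leb).-integrable setT (EFin \o H) ->
  (forall s z, s != c -> F (s, z) = H (s, z)) ->
  \int[sprod leb1 leb]_q F q = \int[sprod leb1 leb]_q H q.
Proof.
move=> iF iH FH; rewrite -(Rintegral_sprod1 iF) -(Rintegral_sprod1 iH); congr fine.
have mF : measurable_fun setT F by apply/measurable_EFinP; exact: measurable_int iF.
have mH : measurable_fun setT H by apply/measurable_EFinP; exact: measurable_int iH.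
apply: ae_eq_integral => //.
- by apply/measurable_EFinP; exact: (@measurable_Rintegral _ _ Tm X R leb F mF).
- by apply/measurable_EFinP; exact: (@measurable_Rintegral _ _ Tm X R leb H mH).
- exists [set c]; split; [exact: measurable_set1|exact: lebesgue_measure_set1|].
  move=> s /= h; apply: contrapT => sc; apply: h => _; congr EFin; apply: eq_Rintegral => z _.
  by apply: FH; apply/eqP.
Qed.

Lemma Rint_intRd (F : Tm * X -> R) : (sprod leb1 leb).-integrable setT (EFin \o F) ->
  \int[leb1]_s intRd (fun z => F (s, z)) = \int[sprod leb1 leb]_q F q.
Proof.
move=> iF; rewrite -(Rintegral_sprod1 iF); congr fine.
have mF : measurable_fun setT F by apply/measurable_EFinP; exact: measurable_int iF.
apply: ae_eq_integral => //.
- by apply/measurable_EFinP; exact: (@measurable_intRd R n _ Tm F mF).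
- by apply/measurable_EFinP; exact: (@measurable_Rintegral _ _ Tm X R leb F mF).
- have := ae_integrable1 iF.
  by apply: filterS => s /= h _; congr EFin; exact: (intRd_leb h).
Qed.

End SpaceTimeTools.

Section Duhamel.
Variables (R : realType) (n : nat).
Local Notation leb1 := (@lebesgue_measure R : {sigma_finite_measure set (measurableTypeR R) -> \bar R}).
Local Notation Tm := (measurableTypeR R).
Local Notation X := (rowB R n).
Local Notation leb := (leb R n).
Local Notation kernel := (R -> X -> X -> R).
Implicit Types (s t : R) (x y z w : X).

Definition jm (G : kernel) := measurable_fun setT (fun u : Tm * (X * X) => G u.1 u.2.1 u.2.2).

(** An abstract setting: [p] stands for p^a, [D] for the drift applied to its gradient, [Q] for the
    majorant, and [ker] for a space-time majorant of [Q] times |[D]|. The factor 1/2 in [int_ker]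
    makes the Duhamel operator a contraction for the weight [Q], and [int_QQ] makes
    Chapman-Kolmogorov products integrable. *)
Variables (p D Q : kernel) (ker : R -> X -> X -> Tm * X -> R) (t1 A0 CQ : R).
Hypothesis t1_gt0 : 0 < t1.
Hypothesis A0_ge0 : 0 <= A0.
Hypothesis CQ_ge0 : 0 <= CQ.
Hypothesis mp : jm p.
Hypothesis mD : jm D.
Hypothesis mQ : jm Q.
Hypothesis Q_ge0 : forall t x y, 0 <= Q t x y.
Hypothesis mker : forall t,
  measurable_fun setT (fun u : (X * X) * (Tm * X) => ker t u.1.1 u.1.2 u.2).
Hypothesis ker_ge0 : forall t x y q, 0 <= ker t x y q.
Hypothesis p_le : forall t x y, 0 < t -> t <= t1 -> `|p t x y| <= A0 * Q t x y.
Hypothesis D_ker : forall t s x w y, 0 < s -> s < t -> t <= t1 ->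
  Q (t - s) x w * `|D s w y| <= ker t x y (s, w).
Hypothesis int_ker : forall t x y, 0 < t -> t <= t1 ->
  (\int[sprod leb1 leb]_q (ker t x y q)%:E <= (2^-1 * Q t x y)%:E)%E.
Hypothesis int_QQ : forall r s x y, 0 < r -> 0 < s -> r + s <= t1 ->
  (\int[leb]_z (Q r x z * Q s z y)%:E <= (CQ * Q (r + s) x y)%:E)%E.
Hypothesis p_conv : forall s t x y, 0 < s -> 0 < t ->
  \int[leb]_z (p s x z * p t z y) = p (s + t) x y.
Hypothesis integrable_Dp : forall s t w y, 0 < s -> 0 < t ->
  leb.-integrable setT (EFin \o (fun z => D s w z * p t z y)).
Hypothesis D_conv : forall s t w y, 0 < s -> 0 < t ->
  \int[leb]_z (D s w z * p t z y) = D (s + t) w y.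

Definition STk (G : kernel) t x y (q : Tm * X) : R :=
  indt t q.1 * (G (t - q.1) x q.2 * D q.1 q.2 y).
(** The Duhamel operator, as one integral over space-time so that Fubini applies at once;
    [Rint_intRd] identifies it with the iterated integral used in [pk]. *)
Definition TD (G : kernel) : kernel := fun t x y => \int[sprod leb1 leb]_q STk G t x y q.
Definition bd (G : kernel) (B T : R) := forall t x y, 0 < t -> t <= T -> `|G t x y| <= B * Q t x y.

Lemma jm_comp (G : kernel) d (T : measurableType d) (f : T -> R) (g h : T -> X) : jm G ->
  measurable_fun setT (f : T -> Tm) -> measurable_fun setT g -> measurable_fun setT h ->
  measurable_fun setT (fun u => G (f u) (g u) (h u)).
Proof.
move=> mG mf mg mh.
exact: (measurableT_comp mG (measurable_fun_pair mf (measurable_fun_pair mg mh))).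
Qed.

Lemma measurable_STk (G : kernel) d (T : measurableType d) (f h : T -> R) (x y w : T -> X) : jm G ->
  measurable_fun setT (f : T -> Tm) -> measurable_fun setT (h : T -> Tm) ->
  measurable_fun setT x -> measurable_fun setT y -> measurable_fun setT w ->
  measurable_fun setT (fun u => STk G (f u) (x u) (y u) (h u, w u)).
Proof.
move=> mG mf mh mx my mw; apply: measurable_funM; first exact: measurable_indt2.
apply: measurable_funM; last exact: (jm_comp mD mh mw my).
apply: (jm_comp mG _ mx mw).
exact: (@measurable_funB _ _ R).
Qed.

Lemma measurable_STk0 (G : kernel) t x y : jm G -> measurable_fun setT (STk G t x y).
Proof.
move=> mG; have := @measurable_STk G _ (Tm * X)%type (fun=> t) (fun q => q.1) (fun=> x) (fun=> y)
  (fun q => q.2) mG (measurable_cst _) measurable_fst (measurable_cst _) (measurable_cst _) measurable_snd.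
by congr measurable_fun; apply/funext => -[].
Qed.

Lemma jm_TD (G : kernel) : jm G -> jm (TD G).
Proof.
move=> mG; rewrite /jm /TD.
apply: (@measurable_Rintegral _ _ (Tm * (X * X))%type (Tm * X)%type R (sprod leb1 leb)
  (fun u => STk G u.1.1 u.1.2.1 u.1.2.2 u.2)).
have := @measurable_STk G _ ((Tm * (X * X)) * (Tm * X))%type (fun u => u.1.1) (fun u => u.2.1)
  (fun u => u.1.2.1) (fun u => u.1.2.2) (fun u => u.2.2) mG.
have -> : (fun u : (Tm * (X * X)) * (Tm * X) => STk G u.1.1 u.1.2.1 u.1.2.2 (u.2.1, u.2.2)) =
  (fun u => STk G u.1.1 u.1.2.1 u.1.2.2 u.2) by apply/funext => -[? []].
by apply; mfun.
Qed.

Lemma measurable_ker t x y : measurable_fun setT (ker t x y).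
Proof.
apply: (measurableT_comp (mker t) (_ : measurable_fun setT (fun q : Tm * X => ((x, y), q)))).
by apply: measurable_fun_pair; [exact: measurable_cst|exact: measurable_id].
Qed.

Lemma integrable_ker t x y : 0 < t -> t <= t1 ->
  (sprod leb1 leb).-integrable setT (EFin \o ker t x y).
Proof.
move=> t0 tt; apply: ge0_integrable; [exact: measurable_ker|exact: ker_ge0|].
exact: le_lt_trans (int_ker x y t0 tt) (ltry _).
Qed.

Lemma STk_le (G : kernel) B T t x y q : bd G B T -> T <= t1 -> 0 <= B -> 0 < t -> t <= T ->
  `|STk G t x y q| <= B * ker t x y q.
Proof.
move=> bG TT B0 t0 tT; rewrite /STk; case: q => s w /=; rewrite indtE.
case: (boolP (0 < s < t)) => [/andP[s0 st]|_]; last first.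
  by rewrite mul0r normr0; exact: mulr_ge0.
rewrite mul1r normrM.
have ts : 0 < t - s by rewrite subr_gt0.
have tsT : t - s <= T by rewrite lerBlDr; apply: le_trans tT _; rewrite lerDl ltW.
apply: le_trans (ler_wpM2r (normr_ge0 _) (bG _ x w ts tsT)) _.
rewrite -mulrA; apply: ler_wpM2l => //; apply: D_ker => //; exact: le_trans tT TT.
Qed.

Lemma integrable_STk (G : kernel) B T t x y : jm G -> bd G B T -> T <= t1 -> 0 <= B -> 0 < t -> t <= T ->
  (sprod leb1 leb).-integrable setT (EFin \o STk G t x y).
Proof.
move=> mG bG TT B0 t0 tT.
apply: (@integrable_dom _ _ _ _ _ (fun q => B * ker t x y q)).
- exact: measurable_STk0.
- by move=> q; exact: STk_le bG TT B0 t0 tT.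
- by apply: integrable_scale; apply: integrable_ker => //; exact: le_trans tT TT.
Qed.

Lemma bd_TD (G : kernel) B T : jm G -> bd G B T -> T <= t1 -> 0 <= B -> bd (TD G) (B / 2) T.
Proof.
move=> mG bG TT B0 t x y t0 tT; have tt := le_trans tT TT.
have iK := integrable_ker x y t0 tt.
apply: le_trans (norm_Rintegral_le (measurable_STk0 t x y mG)
  (fun q => STk_le x y q bG TT B0 t0 tT) (integrable_scale B iK)) _.
rewrite (RintZ B iK) -mulrA; apply: ler_wpM2l => //.
apply: Rintegral_le_fin; [exact: measurable_ker|exact: ker_ge0|exact: int_ker].
Qed.

Lemma eq_TD (G G' : kernel) T t x y : (forall t x y, 0 < t -> t <= T -> G t x y = G' t x y) ->
  t <= T -> TD G t x y = TD G' t x y.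
Proof.
move=> GG tT; apply: eq_Rintegral => -[s w] _; rewrite /STk /= indtE.
case: (boolP (0 < s < t)) => [/andP[s0 st]|_]; last by rewrite !mul0r.
by rewrite GG ?subr_gt0// lerBlDr; apply: le_trans tT _; rewrite lerDl ltW.
Qed.

Fixpoint pm k : kernel := if k is k'.+1 then TD (pm k') else p.
Definition Sm N : kernel := fun t x y => \sum_(0 <= k < N) pm k t x y.

Lemma jm_pm k : jm (pm k).
Proof. by elim: k => //= k ih; exact: jm_TD. Qed.

Lemma bd_pm k : bd (pm k) (A0 / 2 ^+ k) t1.
Proof.
elim: k => [|k ih] /=; first by rewrite divr1.
have -> : A0 / 2 ^+ k.+1 = A0 / 2 ^+ k / 2 by rewrite exprSr invfM mulrA.
by apply: bd_TD => //; [exact: jm_pm|rewrite divr_ge0// exprn_ge0].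
Qed.

Lemma jm_Sm N : jm (Sm N).
Proof. by rewrite /jm /Sm; apply: measurable_sum => k; exact: jm_pm. Qed.

Lemma bd_Sm N : bd (Sm N) (2 * A0) t1.
Proof.
move=> t x y t0 tt.
(* The exact value of the geometric sum, for the induction to close. *)
suff : `|Sm N t x y| <= (2 - 2 / 2 ^+ N) * A0 * Q t x y.
  move=> /le_trans; apply; apply: ler_wpM2r => //; apply: ler_wpM2r => //.
  by rewrite gerBl divr_ge0// exprn_ge0.
elim: N => [|N ih]; first by rewrite /Sm big_geq// normr0 expr0 divr1 subrr !mul0r.
rewrite /Sm big_nat_recr//=; apply: le_trans (ler_normD _ _) _.
apply: le_trans (lerD ih (bd_pm N x y t0 tt)) _.
rewrite -mulrDl; apply: ler_wpM2r => //; rewrite exprSr invfM.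
by rewrite le_eqVlt; apply/orP; left; apply/eqP; field; rewrite expf_neq0.
Qed.

Lemma Sm_rec N t x y : 0 < t -> t <= t1 -> Sm N.+1 t x y = p t x y + TD (Sm N) t x y.
Proof.
move=> t0 tt; rewrite /Sm big_nat_recl//=; congr (_ + _).
elim: N => [|N ih].
  rewrite big_geq// /TD; apply/esym; rewrite (_ : STk _ t x y = fun=> 0).
    by rewrite Rintegral_cst ?mul0r.
  by apply/funext => q; rewrite /STk /Sm big_geq// mul0r mulr0.
rewrite big_nat_recr//= ih /TD.
have iS := integrable_STk x y (jm_Sm N) (bd_Sm N) (lexx t1) (mulr_ge0 (ler0n _ 2) A0_ge0) t0 tt.
have iP := integrable_STk x y (jm_pm N) (bd_pm N) (lexx t1)
  (divr_ge0 A0_ge0 (exprn_ge0 _ (ler0n _ 2))) t0 tt.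
rewrite -RintegralD//; apply: eq_Rintegral => q _.
by rewrite /STk /Sm big_nat_recr//= mulrDl mulrDr.
Qed.

Variable pab : kernel.
Hypothesis CK : forall t s x y, 0 < t -> 0 < s ->
  pab (t + s) x y = intRd (fun z => pab t x z * pab s z y).

(** The invariant that is propagated in [T]. The representative [G] supplies joint measurability on
    the whole space, which Chapman-Kolmogorov for [pab] does not, and agrees with [pab] at the times
    in question. *)
Definition good T := exists G : kernel, [/\ jm G,
  forall t x y, 0 < t -> t <= T -> G t x y = pab t x y, bd G (2 * A0) T &
  forall t x y, 0 < t -> t <= T -> G t x y = p t x y + TD G t x y].

Lemma good_series T : 0 < T -> T <= t1 ->
  (forall t x y, 0 < t -> t <= T -> Sm N t x y @[N --> \oo] --> pab t x y) -> good T.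
Proof.
move=> T0 TT cv.
(* Cut off outside ]0, T], the partial sums converge at every point, so the limit is jointly
   measurable on the whole space. *)
pose cut (G : kernel) : kernel := fun t x y => if 0 < t then (if t <= T then G t x y else 0) else 0.
have cutE G t x y : 0 < t -> t <= T -> cut G t x y = G t x y by move=> t0 tT; rewrite /cut t0 tT.
have mcut G : jm G -> jm (cut G).
  move=> mG; rewrite /jm /cut.
  have mt : measurable_fun setT (fun u : Tm * (X * X) => u.1 : R) by exact: measurable_fst.
  have b1 : measurable_fun setT (fun u : Tm * (X * X) => 0 < (u.1 : R)).
    by apply: measurable_fun_ltr => //; exact: measurable_cst.
  have b2 : measurable_fun setT (fun u : Tm * (X * X) => (u.1 : R) <= T).
    by apply: measurable_fun_ler => //; exact: measurable_cst.
  apply: measurable_fun_ifT; [exact: b1| |exact: measurable_cst].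
  by apply: measurable_fun_ifT; [exact: b2|exact: mG|exact: measurable_cst].
have ccut t x y : cut (Sm N) t x y @[N --> \oo] --> cut pab t x y.
  rewrite /cut; case: ifP => t0; last exact: cvg_cst.
  by case: ifP => tT; [exact: cv|exact: cvg_cst].
have mG : jm (cut pab).
  rewrite /jm; apply: (@measurable_fun_cvg _ _ _ _ (fun N (u : Tm * (X * X)) => cut (Sm N) u.1 u.2.1 u.2.2)).
    by move=> N; exact: (mcut _ (jm_Sm N)).
  by move=> u _; exact: ccut.
have A2 : 0 <= 2 * A0 by exact: mulr_ge0.
have bS N : bd (cut (Sm N)) (2 * A0) T.
  by move=> t x y t0 tT; rewrite cutE//; apply: bd_Sm => //; exact: le_trans tT TT.
have bG : bd (cut pab) (2 * A0) T.
  move=> t x y t0 tT.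
  have c : `|cut (Sm N) t x y| @[N --> \oo] --> `|cut pab t x y| by apply: cvg_norm; exact: ccut.
  rewrite -(cvg_lim _ c)//; apply: limr_le; first by apply/cvg_ex; eexists; exact: c.
  by apply: nearW => N; exact: bS.
exists (cut pab); split => // t x y t0 tT; first exact: cutE.
have tt := le_trans tT TT.
have c1 : Sm N.+1 t x y @[N --> \oo] --> cut pab t x y.
  rewrite cutE//; have := cv t x y t0 tT.
  by rewrite -(@cvg_shiftS _ (fun N => Sm N t x y)).
have c2 : (p t x y + TD (cut (Sm N)) t x y) @[N --> \oo] --> p t x y + TD (cut pab) t x y.
  apply: cvgD; first exact: cvg_cst.
  apply: (@Rintegral_dcvg _ _ _ _ _ _ (fun q => 2 * A0 * ker t x y q)).
  - by move=> N; apply: measurable_STk0; exact: (mcut _ (jm_Sm N)).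
  - exact: measurable_STk0.
  - move=> q; apply: cvgM; first exact: cvg_cst.
    by apply: cvgM; [exact: ccut|exact: cvg_cst].
  - by apply: integrable_scale; exact: integrable_ker.
  - by move=> N q; exact: (STk_le x y q (bS N) TT A2 t0 tT).
have E : (fun N => Sm N.+1 t x y) = (fun N => p t x y + TD (cut (Sm N)) t x y).
  apply/funext => N; rewrite Sm_rec//; congr (_ + _).
  by apply: (@eq_TD _ _ T) => // *; rewrite cutE.
rewrite E in c1; exact: (cvg_unique _ c1 c2).
Qed.

(* Iterating [|G| <= B Q ==> |G| <= (A0 + B / 2) Q] leads to the fixed point [2 A0]. *)
Lemma contraction (G : kernel) B T : jm G -> T <= t1 -> 0 <= B -> bd G B T ->
  (forall t x y, 0 < t -> t <= T -> G t x y = p t x y + TD G t x y) -> bd G (2 * A0) T.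
Proof.
move=> mG TT B0 bG GE.
have step k : bd G (2 * A0 + B / 2 ^+ k) T.
  elim: k => [|k ih].
    move=> t x y t0 tT; apply: le_trans (bG t x y t0 tT) _; apply: ler_wpM2r => //.
    by rewrite expr0 divr1 lerDr mulr_ge0.
  move=> t x y t0 tT; rewrite GE//; apply: le_trans (ler_normD _ _) _.
  have b0 : 0 <= 2 * A0 + B / 2 ^+ k.
    by rewrite addr_ge0 ?mulr_ge0// ?invr_ge0 exprn_ge0.
  have h := bd_TD mG ih TT b0 x y t0 tT.
  apply: le_trans (lerD (p_le x y t0 (le_trans tT TT)) h) _.
  rewrite -mulrDl; apply: ler_wpM2r => //; rewrite exprSr invfM.
  by rewrite le_eqVlt; apply/orP; left; apply/eqP; field; rewrite expf_neq0.
move=> t x y t0 tT; apply/ler_addgt0Pr => e e0.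
pose k := (Num.truncn (B * Q t x y / e)).+1.
apply: le_trans (step k t x y t0 tT) _; rewrite mulrDl lerD2l.
have k0 : 0 < 2 ^+ k :> R by exact: exprn_gt0.
rewrite mulrAC ler_pdivrMr// [leRHS]mulrC -ler_pdivrMr//.
apply: le_trans (ltW (truncnS_gt _)) _; rewrite -/k -natrX ler_nat.
exact/ltnW/ltn_expl.
Qed.

(** With h = t/2 and products denoting integration over the middle point, G(h) G(h) = p(h) p(h) + TD
    G(h) p(h) + G(h) TD G(h), where Duhamel's equation is applied to the second factor and then to
    the first. The first term is p(t). In the third, G(h) G(h - s) is G(t - s), giving the times s <
    h. In the second, D(s) p(h) = D(s + h), giving the times between h and t. *)
Lemma good_double T T' : 0 < T -> good T -> T' <= 2 * T -> T' <= t1 -> good T'.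
Proof.
move=> T0 [G [mG GE bG GD]] T2 TT'.
case: (leP T' T) => [T'T|TT].
  exists G; split=> // t x y t0 tT; have tT' := le_trans tT T'T.
  - exact: GE.
  - exact: bG.
  - exact: GD.
have Tt1 : T <= t1 := le_trans (ltW TT) TT'.
have B10 : 0 <= 2 * A0 by exact: mulr_ge0.
set B1 := 2 * A0 in B10 bG.
have mc : forall x : X, measurable_fun setT (fun z : X => x) by move=> x; exact: measurable_cst.
have mt : forall t : R, measurable_fun setT (fun z : X => t : Tm) by move=> t; exact: measurable_cst.
have mi : measurable_fun setT (fun z : X => z) by exact: measurable_id.
have mGl t x : measurable_fun setT (fun z => G t x z) by exact: (jm_comp mG (mt t) (mc x) mi).
have mGr t y : measurable_fun setT (fun z => G t z y) by exact: (jm_comp mG (mt t) mi (mc y)).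
have mQl t x : measurable_fun setT (fun z => Q t x z) by exact: (jm_comp mQ (mt t) (mc x) mi).
have mQr t y : measurable_fun setT (fun z => Q t z y) by exact: (jm_comp mQ (mt t) mi (mc y)).
have mpl t x : measurable_fun setT (fun z => p t x z) by exact: (jm_comp mp (mt t) (mc x) mi).
have mpr t y : measurable_fun setT (fun z => p t z y) by exact: (jm_comp mp (mt t) mi (mc y)).
have iQQ r s x y : 0 < r -> 0 < s -> r + s <= t1 ->
    leb.-integrable setT (EFin \o (fun z => Q r x z * Q s z y)).
  move=> r0 s0 rs; apply: ge0_integrable; [exact: measurable_funM|by move=> z; exact: mulr_ge0|].
  exact: le_lt_trans (int_QQ x y r0 s0 rs) (ltry _).
have dom (u v : X -> R) K L r s x y : 0 < r -> 0 < s -> r + s <= t1 ->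
    measurable_fun setT u -> measurable_fun setT v -> 0 <= K -> 0 <= L ->
    (forall z, `|u z| <= K * Q r x z) -> (forall z, `|v z| <= L * Q s z y) ->
    leb.-integrable setT (EFin \o (fun z => u z * v z)) /\
    `|\int[leb]_z (u z * v z)| <= K * L * CQ * Q (r + s) x y.
  move=> r0 s0 rs mu mv K0 L0 hu hv.
  have hle z : `|u z * v z| <= K * L * (Q r x z * Q s z y).
    by rewrite normrM mulrACA; apply: ler_pM.
  have iK := integrable_scale (K * L) (iQQ r s x y r0 s0 rs).
  split; first exact: integrable_dom (measurable_funM mu mv) hle iK.
  apply: le_trans (norm_Rintegral_le (measurable_funM mu mv) hle iK) _.
  rewrite (RintZ _ (iQQ r s x y r0 s0 rs)) -mulrA; apply: ler_wpM2l; first exact: mulr_ge0.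
  apply: Rintegral_le_fin; [exact: measurable_funM|by move=> z; exact: mulr_ge0|exact: int_QQ].
have GG r s x y : 0 < r -> 0 < s -> r <= T -> s <= T -> r + s <= t1 ->
    \int[leb]_z (G r x z * G s z y) = pab (r + s) x y.
  move=> r0 s0 rT sT rs.
  have [i _] := dom _ _ B1 B1 r s x y r0 s0 rs (mGl r x) (mGr s y) B10 B10
    (fun z => bG r x z r0 rT) (fun z => bG s z y s0 sT).
  rewrite CK// -(intRd_leb i); congr intRd; apply/funext => z.
  by rewrite !GE.
(* Chapman-Kolmogorov at half times, as a formula in t, so that joint measurability is inherited
   from [G]. *)
pose G2 : kernel := fun t x y => \int[leb]_z (G (t / 2) x z * G (t / 2) z y).
have mG2 : jm G2.
  apply: (@measurable_Rintegral _ _ (Tm * (X * X))%type X R leb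
    (fun u => G (u.1.1 / 2) u.1.2.1 u.2 * G (u.1.1 / 2) u.2 u.1.2.2)).
  have mh : measurable_fun setT (fun u : (Tm * (X * X)) * X => u.1.1 / 2 : Tm).
    by apply: (@measurable_funM _ _ R); [mfun|exact: measurable_cst].
  by apply: measurable_funM; apply: jm_comp => //; mfun.
have halfE (t : R) : t / 2 + t / 2 = t := addr_half t.
have half t : 0 < t -> t <= T' -> [/\ 0 < t / 2, t / 2 <= T & t <= t1].
  move=> t0 tT; split; [by rewrite divr_gt0| |exact: le_trans tT TT'].
  by rewrite ler_pdivrMr// mulrC; exact: le_trans tT T2.
have G2E t x y : 0 < t -> t <= T' -> G2 t x y = pab t x y.
  move=> t0 tT; have [h0 hT ht] := half t t0 tT.
  by rewrite /G2 GG ?halfE.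
have bG2 : bd G2 (B1 * B1 * CQ) T'.
  move=> t x y t0 tT; have [h0 hT ht] := half t t0 tT.
  have hh : t / 2 + t / 2 <= t1 by rewrite halfE.
  have [_] := dom _ _ B1 B1 _ _ x y h0 h0 hh (mGl _ x) (mGr _ y) B10 B10
    (fun z => bG _ x z h0 hT) (fun z => bG _ z y h0 hT).
  by rewrite halfE.
have BB0 : 0 <= B1 * B1 * CQ by rewrite !mulr_ge0.
suff G2D t x y : 0 < t -> t <= T' -> G2 t x y = p t x y + TD G2 t x y.
  exists G2; split => //; exact: (contraction mG2 TT' BB0 bG2 G2D).
move=> t'0 t'T; have [t0 tT t't1] := half t t'0 t'T.
set h := t / 2 in t0 tT; have hh : h + h = t by exact: halfE.
have hh1 : h + h <= t1 by rewrite hh.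
have ht1 : h <= t1 := le_trans tT Tt1.
have B12 : 0 <= B1 / 2 by rewrite divr_ge0.
have mTDG := jm_TD mG.
have bTD := bd_TD mG bG Tt1 B10.
have mTl : measurable_fun setT (fun z => TD G h x z) by exact: (jm_comp mTDG (mt h) (mc x) mi).
have mTr : measurable_fun setT (fun z => TD G h z y) by exact: (jm_comp mTDG (mt h) mi (mc y)).
have [i1 _] := dom _ _ A0 A0 h h x y t0 t0 hh1 (mpl h x) (mpr h y) A0_ge0 A0_ge0
  (fun z => p_le x z t0 ht1) (fun z => p_le z y t0 ht1).
have [i2 _] := dom _ _ (B1 / 2) A0 h h x y t0 t0 hh1 mTl (mpr h y) B12 A0_ge0
  (fun z => bTD h x z t0 tT) (fun z => p_le z y t0 ht1).
have [i3 _] := dom _ _ B1 (B1 / 2) h h x y t0 t0 hh1 (mGl h x) mTr B10 B12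
  (fun z => bG h x z t0 tT) (fun z => bTD h z y t0 tT).
have -> : G2 t x y = \int[leb]_z (p h x z * p h z y) +
    (\int[leb]_z (TD G h x z * p h z y) + \int[leb]_z (G h x z * TD G h z y)).
  rewrite -RintegralD// -RintegralD//; last exact: integrable_add i2 i3.
  apply: eq_Rintegral => z _.
  transitivity (G h x z * (p h z y + TD G h z y)); first by rewrite -(GD h z y t0 tT).
  by rewrite mulrDr {1}(GD h x z t0 tT) mulrDl addrA.
rewrite p_conv// hh; congr (_ + _).
pose Y (q : Tm * X) : R := G2 (t - q.1) x q.2 * D q.1 q.2 y.
have mfst1 : measurable_fun setT (fun q : Tm * X => q.1 : Tm) by exact: measurable_fst.
have mY : measurable_fun setT Y.
  have msnd1 : measurable_fun setT (fun q : Tm * X => q.2) by exact: measurable_snd.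
  apply: measurable_funM.
    apply: (jm_comp mG2); [|exact: measurable_cst|exact: msnd1].
    by apply: (@measurable_funB _ _ R); [exact: measurable_cst|exact: mfst1].
  by apply: (jm_comp mD); [exact: mfst1|exact: msnd1|exact: measurable_cst].
have iST := integrable_STk x y mG2 bG2 TT' BB0 t'0 t'T.
have indlt (c : R -> R) : (forall s, c s = 0 \/ (c s = 1 /\ indt t s = 1)) ->
    measurable_fun setT (fun q : Tm * X => c q.1) ->
    (sprod leb1 leb).-integrable setT (EFin \o (fun q => c q.1 * Y q)).
  move=> hc mc'; apply: (@integrable_dom _ _ _ _ _ (fun q => `|STk G2 t x y q|)).
  - exact: measurable_funM mc' mY.
  - move=> q; rewrite /STk -/(Y q).
    by case: (hc q.1) => [->|[-> ->]]; rewrite ?mul0r ?normr0.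
  - exact: (integrable_abse iST).
have i0 (s : R) : indt h s = 0 \/ indt h s = 1 by rewrite indtE; case: (_ && _); [right|left].
have iF1 : (sprod leb1 leb).-integrable setT (EFin \o (fun q : Tm * X => indt h q.1 * Y q)).
  apply: indlt; last by apply: measurable_indt2 => //; exact: measurable_cst.
  move=> s; rewrite !indtE -hh; case: (boolP (0 < s < h)) => [/andP[s0 sh]|_]; last by left.
  by right; rewrite s0 (lt_trans sh) ?ltrDl.
have iF2 : (sprod leb1 leb).-integrable setT (EFin \o (fun q : Tm * X => indt h (q.1 - h) * Y q)).
  apply: (indlt (fun s => indt h (s - h))).
    move=> s; rewrite !indtE -hh subr_gt0 ltrBlDr; case: (boolP (h < s < h + h)) => [/andP[s0 sh]|_]; last by left.
    by right; rewrite sh (lt_trans t0 s0).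
  apply: measurable_indt2; first exact: measurable_cst.
  by apply: (@measurable_funB _ _ R) => //; exact: measurable_cst.
have mX3 : measurable_fun setT (fun u : X * (Tm * X) => u.1) by exact: measurable_fst.
have mS3 : measurable_fun setT (fun u : X * (Tm * X) => u.2.1 : Tm) by mfun.
have mW3 : measurable_fun setT (fun u : X * (Tm * X) => u.2.2) by mfun.
have mh3 : measurable_fun setT (fun u : X * (Tm * X) => h : Tm) by exact: measurable_cst.
have mc3 (v : X) : measurable_fun setT (fun u : X * (Tm * X) => v) by exact: measurable_cst.
have mq3 : measurable_fun setT (fun u : X * (Tm * X) => u.2) by exact: measurable_snd.
(* With [h = t / 2], Chapman-Kolmogorov turns the space-time integral into its parts over the
   times ]0, h[ (E1) and ]h, t[ (E2). *)
have E1 : \int[leb]_z (G h x z * TD G h z y) = \int[sprod leb1 leb]_q (indt h q.1 * Y q).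
  pose H (u : X * (Tm * X)) : R := G h x u.1 * STk G h u.1 y (u.2.1, u.2.2).
  pose K (u : X * (Tm * X)) : R := B1 * B1 * (Q h x u.1 * ker h u.1 y u.2).
  have mH : measurable_fun setT H.
    apply: measurable_funM; first exact: (jm_comp mG mh3 (mc3 x) mX3).
    exact: (measurable_STk mG mh3 mS3 mX3 (mc3 y) mW3).
  have mK : measurable_fun setT K.
    apply: measurable_funM; first exact: measurable_cst.
    apply: measurable_funM; first exact: (jm_comp mQ mh3 (mc3 x) mX3).
    exact: (measurableT_comp (mker h) (measurable_fun_pair (measurable_fun_pair mX3 (mc3 y)) mq3)).
  have K0 u : 0 <= K u by rewrite mulr_ge0 ?mulr_ge0.
  have HK u : `|H u| <= K u.
    rewrite /H /K normrM mulrACA; case: u => z [s w] /=; apply: ler_pM => //.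
      exact: bG.
    exact: (STk_le z y (s, w) bG Tt1 B10 t0 tT).
  have fin : (\int[leb]_z \int[sprod leb1 leb]_q (K (z, q))%:E < +oo)%E.
    apply: (@le_lt_trans _ _ (\int[leb]_z (B1 * B1 / 2 * (Q h x z * Q h z y))%:E)%E).
      apply: ge0_le_integral => //.
      - by move=> z _; apply: integral_ge0 => q _; rewrite lee_fin.
      - apply: (@measurable_fun_fubini_tonelli_F _ _ X (Tm * X)%type R (sprod leb1 leb) (EFin \o K)) => //.
        exact/measurable_EFinP.
      - apply/measurable_EFinP; apply: measurable_funM; first exact: measurable_cst.
        exact: measurable_funM.
      - move=> z _; rewrite /K /=.
        have BQ0 : 0 <= B1 * B1 * Q h x z by rewrite !mulr_ge0.
        under eq_integral do rewrite mulrA.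
        rewrite (intZ _ (measurable_ker h z y) (ker_ge0 h z y) BQ0).
        apply: le_trans (lee_wpmul2l _ (int_ker z y t0 ht1)) _; first by rewrite lee_fin.
        by rewrite -EFinM lee_fin le_eqVlt; apply/orP; left; apply/eqP; ring.
    have BB2 : 0 <= B1 * B1 / 2 by rewrite divr_ge0// mulr_ge0.
    rewrite intZ//; [|exact: measurable_funM|by move=> z; exact: mulr_ge0].
    apply: le_lt_trans (lee_wpmul2l _ (int_QQ x y t0 t0 hh1)) _; first by rewrite lee_fin.
    by rewrite -EFinM ltry.
  transitivity (\int[leb]_z \int[sprod leb1 leb]_q H (z, q)).
    apply: eq_Rintegral => z _.
    rewrite /TD -RintZ; last exact: (integrable_STk z y mG bG Tt1 B10 t0 tT).
    by apply: eq_Rintegral => -[s w] _.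
  rewrite (Rint_swap mH mK K0 HK fin); apply: eq_Rintegral => -[s w] _; rewrite /H /Y /STk /=.
  rewrite indtE; case: (boolP (0 < s < h)) => [/andP[s0 sh]|_]; last first.
    by under eq_Rintegral do rewrite mul0r mulr0; rewrite Rintegral_cst ?mul0r// mul0r.
  have hs0 : 0 < h - s by rewrite subr_gt0.
  have hsT : h - s <= T by rewrite lerBlDr; apply: le_trans tT _; rewrite lerDl ltW.
  have hs1 : h + (h - s) <= t1 by rewrite addrA hh lerBlDr; apply: le_trans t't1 _; rewrite lerDl ltW.
  have [iGG _] := dom _ _ B1 B1 h (h - s) x w t0 hs0 hs1 (mGl h x) (mGr (h - s) w) B10 B10
    (fun z => bG h x z t0 tT) (fun z => bG (h - s) z w hs0 hsT).
  rewrite (_ : true%:R = 1 :> R)//.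
  transitivity (\int[leb]_z (D s w y * (G h x z * G (h - s) z w))).
    by apply: eq_Rintegral => z _; ring.
  rewrite (RintZ _ iGG) GG// addrA hh mul1r G2E 1?mulrC//.
    by rewrite -hh -addrA addr_gt0.
  by rewrite lerBlDr; apply: le_trans t'T _; rewrite lerDl ltW.
have E2 : \int[leb]_z (TD G h x z * p h z y) = \int[sprod leb1 leb]_q (indt h (q.1 - h) * Y q).
  pose H (u : X * (Tm * X)) : R := p h u.1 y * STk G h x u.1 (u.2.1, u.2.2).
  pose K (u : X * (Tm * X)) : R := A0 * B1 * (Q h u.1 y * ker h x u.1 u.2).
  have mH : measurable_fun setT H.
    apply: measurable_funM; first exact: (jm_comp mp mh3 mX3 (mc3 y)).
    exact: (measurable_STk mG mh3 mS3 (mc3 x) mX3 mW3).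
  have mK : measurable_fun setT K.
    apply: measurable_funM; first exact: measurable_cst.
    apply: measurable_funM; first exact: (jm_comp mQ mh3 mX3 (mc3 y)).
    exact: (measurableT_comp (mker h) (measurable_fun_pair (measurable_fun_pair (mc3 x) mX3) mq3)).
  have K0 u : 0 <= K u by rewrite mulr_ge0 ?mulr_ge0.
  have HK u : `|H u| <= K u.
    rewrite /H /K normrM mulrACA; case: u => z [s w] /=; apply: ler_pM => //.
      exact: p_le.
    exact: (STk_le x z (s, w) bG Tt1 B10 t0 tT).
  have fin : (\int[leb]_z \int[sprod leb1 leb]_q (K (z, q))%:E < +oo)%E.
    apply: (@le_lt_trans _ _ (\int[leb]_z (A0 * B1 / 2 * (Q h x z * Q h z y))%:E)%E).
      apply: ge0_le_integral => //.
      - by move=> z _; apply: integral_ge0 => q _; rewrite lee_fin.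
      - apply: (@measurable_fun_fubini_tonelli_F _ _ X (Tm * X)%type R (sprod leb1 leb) (EFin \o K)) => //.
        exact/measurable_EFinP.
      - apply/measurable_EFinP; apply: measurable_funM; first exact: measurable_cst.
        exact: measurable_funM.
      - move=> z _; rewrite /K /=.
        have BQ0 : 0 <= A0 * B1 * Q h z y by rewrite !mulr_ge0.
        under eq_integral do rewrite mulrA.
        rewrite (intZ _ (measurable_ker h x z) (ker_ge0 h x z) BQ0).
        apply: le_trans (lee_wpmul2l _ (int_ker x z t0 ht1)) _; first by rewrite lee_fin.
        by rewrite -EFinM lee_fin le_eqVlt; apply/orP; left; apply/eqP; ring.
    have BB2 : 0 <= A0 * B1 / 2 by rewrite divr_ge0// mulr_ge0.
    rewrite intZ//; [|exact: measurable_funM|by move=> z; exact: mulr_ge0].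
    apply: le_lt_trans (lee_wpmul2l _ (int_QQ x y t0 t0 hh1)) _; first by rewrite lee_fin.
    by rewrite -EFinM ltry.
  transitivity (\int[leb]_z \int[sprod leb1 leb]_q H (z, q)).
    apply: eq_Rintegral => z _.
    rewrite mulrC /TD -RintZ; last exact: (integrable_STk x z mG bG Tt1 B10 t0 tT).
    by apply: eq_Rintegral => -[s w] _.
  (* The times between h and t are shifted down to ]0, h[. There [Y] at s + h is [G2] at h - s times
     [D] at s + h, and [D_conv] recovers the latter from the integral over z. *)
  rewrite (Rint_swap mH mK K0 HK fin) -(Rint_sprod_shift h iF2).
  apply: eq_Rintegral => -[s w] _; rewrite /H /Y /STk /= addrK.
  rewrite indtE; case: (boolP (0 < s < h)) => [/andP[s0 sh]|_]; last first.
    by under eq_Rintegral do rewrite mul0r mulr0; rewrite Rintegral_cst ?mul0r// mul0r.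
  have hs0 : 0 < h - s by rewrite subr_gt0.
  have hsT : h - s <= T by rewrite lerBlDr; apply: le_trans tT _; rewrite lerDl ltW.
  rewrite (_ : true%:R = 1 :> R)//.
  transitivity (\int[leb]_z (G (h - s) x w * (D s w z * p h z y))).
    by apply: eq_Rintegral => z _; ring.
  rewrite (RintZ _ (integrable_Dp w y s0 t0)) D_conv// mul1r; congr (_ * _).
  have -> : t - (s + h) = h - s by rewrite -hh; ring.
  by rewrite GE// G2E//; exact: le_trans hsT (ltW TT).
rewrite E1 E2 addrC -RintegralD//.
(* The two time ranges together miss only the instant s = h. *)
apply: (Rint_sprod_eq (c := h)) => //.
  exact: integrable_add iF1 iF2.
move=> s z sh; rewrite -mulrDl /STk -/(Y (s, z)) /=; congr (_ * _).
rewrite !indtE subr_gt0 ltrBlDr hh.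
have ht : h < t by rewrite -hh ltrDl.
case: (ltgtP s h) sh => // sh _; rewrite ?andbF ?addr0 ?add0r ?andbT.
  by rewrite (lt_trans sh ht) andbT.
by rewrite (lt_trans t0 sh).
Qed.

(** Doubling from [T] reaches [t1] in finitely many steps. Each step restores the same constant 2
    [A0], so the number of steps, and with it [T], leaves no trace in the bound. *)
Theorem duhamel_bound T : 0 < T -> T <= t1 ->
  (forall t x y, 0 < t -> t <= T -> Sm N t x y @[N --> \oo] --> pab t x y) -> good t1.
Proof.
move=> T0 TT /(good_series T0 TT) gT.
have H k : good (Num.min (2 ^+ k * T) t1).
  elim: k => [|k ih]; first by rewrite expr0 mul1r min_l.
  apply: (good_double _ ih).
  - by rewrite lt_min t1_gt0 mulr_gt0// exprn_gt0.
  - rewrite exprS -mulrA; case: (leP (2 ^+ k * T) t1) => h.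
      by rewrite ge_min lexx.
    by rewrite ge_min; apply/orP; right; rewrite mulr_natl mulr2n lerDl ltW.
  - by rewrite ge_min lexx orbT.
pose k := (Num.truncn (t1 / T)).+1.
suff h : t1 <= 2 ^+ k * T by have := H k; rewrite min_r.
rewrite -ler_pdivrMr//; apply: le_trans (ltW (truncnS_gt _)) _.
by rewrite -/k -natrX ler_nat; exact/ltnW/ltn_expl.
Qed.

End Duhamel.

(** * Application to the heat kernel and iteration in time *)

Section Prelim.
Variables (R : realType) (n : nat).
Local Notation leb1 := (@lebesgue_measure R : {sigma_finite_measure set (measurableTypeR R) -> \bar R}).
Local Notation Tm := (measurableTypeR R).
Local Notation X := (rowB R n).
Local Notation leb := (leb R n).

Lemma measurable_rowB_sub d (T : measurableType d) (f g : T -> X) :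
  measurable_fun setT f -> measurable_fun setT g ->
  measurable_fun setT (fun u : T => (f u : 'rV[R]_n) - g u : X).
Proof. by move=> mf mg; apply: measurable_rowD => //; exact: measurable_rowN. Qed.

Lemma Rintegral_shift_row (g : X -> R) (y : 'rV[R]_n) : measurable_fun setT g ->
  \int[leb]_z g ((z : 'rV[R]_n) - y) = \int[leb]_z g z.
Proof.
move=> mg; have mN : measurable_fun setT (fun z : X => g (- (z : 'rV[R]_n))).
  by apply: (measurableT_comp mg); apply: measurable_rowN; exact: measurable_id.
transitivity (\int[leb]_z g (- (y - (z : 'rV[R]_n)))).
  by apply: eq_Rintegral => z _; rewrite opprB.
rewrite (Rintegral_rsub y mN) -[RHS](Rintegral_rsub 0 mg).
by apply: eq_Rintegral => z _; rewrite sub0r.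
Qed.

Lemma integrable_shift_row (g : X -> R) (y : 'rV[R]_n) :
  leb.-integrable setT (EFin \o g) ->
  leb.-integrable setT (EFin \o (fun z : X => g ((z : 'rV[R]_n) - y))).
Proof.
move=> ig; have h := integrable_rsub 0 ig; have := integrable_rsub y h.
apply: eq_integrable => //.
by move=> z _; rewrite /= sub0r opprB.
Qed.

Lemma integrable_Rint_sum (I : Type) (s : seq I) (c v : I -> R) (g : I -> X -> R) (h : X -> R) :
  (forall i, leb.-integrable setT (EFin \o (fun z => g i z * h z))) ->
  (forall i, \int[leb]_z (g i z * h z) = v i) ->
  leb.-integrable setT (EFin \o (fun z => (\sum_(i <- s) c i * g i z) * h z)) /\
  \int[leb]_z ((\sum_(i <- s) c i * g i z) * h z) = \sum_(i <- s) c i * v i.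
Proof.
move=> ig iv; elim: s => [|i s [ih1 ih2]].
  have E : (fun z => (\sum_(i <- [::]) c i * g i z) * h z) = (fun=> 0).
    by apply/funext => z; rewrite big_nil mul0r.
  rewrite E big_nil; split; last by rewrite Rintegral_cst ?mul0r.
  exact: integrable0.
have E : (fun z => (\sum_(j <- i :: s) c j * g j z) * h z) =
    (fun z => c i * (g i z * h z) + (\sum_(j <- s) c j * g j z) * h z).
  by apply/funext => z; rewrite big_cons mulrDl mulrA.
have ic := integrable_scale (c i) (ig i).
rewrite E big_cons; split; first exact: integrable_add ic ih1.
by rewrite RintegralD// RintZ// iv ih2.
Qed.

Lemma intRd0 : intRd (fun _ : 'rV[R]_n => 0 : R) = 0.
Proof. by rewrite (intRd_leb (f := fun=> 0)) ?Rintegral_cst ?mul0r//; exact: integrable0. Qed.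

Lemma measurable_borel_Rd (b : 'rV[R]_n -> 'rV[R]_n) : borel_Rd b ->
  measurable_fun setT (b : X -> X).
Proof.
move=> hb; apply: measurable_rowP => i.
apply: (measurability (@RGenOpens.G R)); first exact: (@RGenOpens.measurableE R).
by move=> _ [_ [x [y ->]] <-]; rewrite setTI; apply: hb; exact: interval_open.
Qed.

Lemma nearK_Kato (b : 'rV[R]_n -> 'rV[R]_n) (r : R) (x : 'rV[R]_n) : borel_Rd b ->
  (\int[leb]_z (nearK r (x - z) * euclid (b z))%:E <= Kato_M b r)%E.
Proof.
move=> hb; have mb := measurable_borel_Rd hb.
have mf : measurable_fun setT (fun z : X => euclid (b z)) by exact: measurable_euclid.
have mk : measurable_fun setT (fun z : X => nearK r (x - z)).
  by apply: measurable_nearK; apply: measurable_rsub; exact: measurable_id.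
rewrite -intRdE_leb; last 2 first.
- by apply/measurable_EFinP; exact: measurable_funM.
- by move=> z; rewrite lee_fin mulr_ge0 ?nearK_ge0 ?euclid_ge0.
apply: ereal_sup_ubound; exists x => //; congr intRdE; apply/funext => z.
by rewrite /nearK; case: ifP => _; rewrite ?mul0r// mulrC.
Qed.

End Prelim.

Section Bounds.
Variables (R : realType) (n : nat) (alpha : R).
Hypothesis al0 : 0 < alpha.
Hypothesis al2 : alpha < 2.
Implicit Types (z : 'rV[R]_n) (a b t : R).

Lemma Gk_antitone a b b' t z : 0 < t -> b <= b' -> Gk b' t z <= Gk b t z.
Proof.
move=> t0 bb; rewrite /Gk; apply: ler_wpM2l; first exact: powR_ge0.
rewrite ler_expR !mulNr lerN2; apply: ler_wpM2r; first by rewrite invr_ge0 ltW.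
by apply: ler_wpM2r => //; exact: sqr_ge0.
Qed.

Lemma Qk_antitone a b b' t z : 0 < t -> b <= b' -> Qk alpha a b' t z <= Qk alpha a b t z.
Proof. by move=> t0 bb; rewrite /Qk lerD2r; exact: Gk_antitone. Qed.

Lemma qfun_le_powR a b t z : 0 < b -> 0 < t -> qfun alpha a b t z <= 2 * t `^ (- (n%:R / 2)).
Proof.
move=> b0 t0; rewrite qfunE mulrDl !mul1r; apply: lerD.
  rewrite /Gk -[leRHS]mulr1; apply: ler_wpM2l; first exact: powR_ge0.
  rewrite expR_le1 !mulNr oppr_le0; apply: divr_ge0; last exact: ltW.
  by apply: mulr_ge0; [exact: ltW|exact: sqr_ge0].
by rewrite /Jk; case: ifP => // _; rewrite ge_min lexx.
Qed.

(** The time at which M^alpha t^(1 - alpha/2) equals 1; it is positive because alpha < 2 makes the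
    exponent of t positive. *)
Lemma th_le1 (M : R) : 0 < M -> exists2 t0, 0 < t0 & forall a t, 0 < a -> a <= M -> 0 < t -> t <= t0 ->
  th alpha a t <= 1.
Proof.
move=> M0; have e0 : 0 < 1 - alpha / 2 by rewrite subr_gt0 ltr_pdivrMr// mul1r.
exists ((M `^ (- alpha)) `^ (1 - alpha / 2)^-1); first by rewrite !powR_gt0.
move=> a t a0 aM t0 tt; apply: le_trans (th_le al2 a t0 tt) _; rewrite /th -powRrM mulVf ?gt_eqF//.
rewrite powRr1 ?powR_ge0// powRN ler_pdivrMr ?powR_gt0// mul1r.
by apply: ge0_ler_powR; rewrite ?nnegrE ?(ltW al0) ?(ltW a0) ?(ltW M0).
Qed.

End Bounds.

Section Main.
Variables (R : realType) (n : nat) (alpha : R).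
Variables (pa : R -> R -> 'rV[R]_n -> R) (betaL betaU : R).
Hypothesis n1 : (1 < n)%N.
Hypothesis al0 : 0 < alpha.
Hypothesis al2 : alpha < 2.
Hypothesis hpa : is_pa alpha pa.
Hypothesis bL0 : 0 < betaL.
Hypothesis bU0 : 0 < betaU.
Hypothesis heat : forall M T : R, 0 < M -> 0 < T ->
  exists CL CU : R, [/\ 0 < CL, 0 < CU &
    forall a t (z : 'rV[R]_n), 0 < a -> a <= M -> 0 < t -> t <= T ->
      CL * qfun alpha a betaL t z <= pa a t z /\
      pa a t z <= CU * qfun alpha a betaU t z].
Local Notation leb1 := (@lebesgue_measure R : {sigma_finite_measure set (measurableTypeR R) -> \bar R}).
Local Notation Tm := (measurableTypeR R).
Local Notation X := (rowB R n).
Local Notation leb := (leb R n).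
Local Notation p := (n%:R + alpha).
(** The value betaU / 2 is the exponent that the time change of the theorem converts into betaL.
    Contracting z by 9/10 multiplies the exponent by 81/100, which still exceeds 1/2. *)
Local Notation be := (betaU / 2).
Local Notation be' := (betaU * (9 / 10) ^+ 2).
Implicit Types (a s t M : R) (z : 'rV[R]_n).

Let be0 : 0 < be. Proof. by rewrite divr_gt0. Qed.
Let bebe' : be < be'. Proof. by move: bU0; lra. Qed.
Let beU : be <= betaU. Proof. by move: bU0; lra. Qed.

(** Positivity is not part of [is_pa]; it is read off from the lower heat kernel bound. *)
Lemma pa_ge0 a t z : 0 < a -> 0 < t -> 0 <= pa a t z.
Proof.
move=> a0 t0; have [CL [CU [CL0 _ H]]] := heat a0 t0.
have [h _] := H a t z a0 (lexx a) t0 (lexx t); apply: le_trans h.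
by apply: mulr_ge0; [exact: ltW|exact: qfun_ge0].
Qed.

Lemma pa_bounded a t : 0 < a -> 0 < t -> exists B, forall z, `|pa a t z| <= B.
Proof.
move=> a0 t0; have [CL [CU [_ CU0 H]]] := heat a0 t0.
exists (CU * (2 * t `^ (- (n%:R / 2)))) => z; rewrite ger0_norm ?pa_ge0//.
have [_ h] := H a t z a0 (lexx a) t0 (lexx t); apply: le_trans h _.
by apply: ler_wpM2l; [exact: ltW|exact: qfun_le_powR].
Qed.

Lemma pa_fsp a t z : 0 < a -> 0 < t -> pa a t z = fsp alpha a t z.
Proof. exact: (paE hpa pa_bounded). Qed.

Lemma measurable_pa a t : 0 < a -> 0 < t -> measurable_fun setT (pa a t : X -> R).
Proof.
by move=> a0 t0; apply/measurable_EFinP; exact: measurable_int (integrable_pa hpa a0 t0).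
Qed.

Lemma Rintegral_pa_conv a s t (x y : 'rV[R]_n) : 0 < a -> 0 < s -> 0 < t ->
  \int[leb]_z (pa a s (x - z) * pa a t ((z : 'rV[R]_n) - y)) = pa a (s + t) (x - y).
Proof.
move=> a0 s0 t0; have ms := measurable_pa a0 s0; have mt := measurable_pa a0 t0.
have mr (w : 'rV[R]_n) : measurable_fun setT (fun z : X => w - z : X).
  by apply: measurable_rsub; exact: measurable_id.
pose g (u : X) : R := pa a t u * pa a s ((x - y) - u).
have mg : measurable_fun setT g.
  by apply: measurable_funM; [exact: mt|exact: (measurableT_comp ms (mr _))].
transitivity (\int[leb]_z g ((z : 'rV[R]_n) - y)).
  by apply: eq_Rintegral => z _; rewrite /g mulrC opprB addrA subrK.
rewrite (Rintegral_shift_row y mg) /g.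
under eq_Rintegral do rewrite (pa_fsp _ a0 s0).
by rewrite (fsp_conv hpa)// -pa_fsp// addr_gt0.
Qed.

Lemma pa_conv a s t (x y : 'rV[R]_n) : 0 < a -> 0 < s -> 0 < t ->
  leb.-integrable setT (EFin \o (fun z : X => pa a s (x - z) * pa a t ((z : 'rV[R]_n) - y))) /\
  \int[leb]_z (pa a s (x - z) * pa a t ((z : 'rV[R]_n) - y)) = pa a (s + t) (x - y).
Proof.
move=> a0 s0 t0; have ms := measurable_pa a0 s0; have mt := measurable_pa a0 t0.
have mr (w : 'rV[R]_n) : measurable_fun setT (fun z : X => w - z : X).
  by apply: measurable_rsub; exact: measurable_id.
have ml (w : 'rV[R]_n) : measurable_fun setT (fun z : X => (z : 'rV[R]_n) - w : X).
  by apply: measurable_rsubr; exact: measurable_id.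
have [B hB] := pa_bounded a0 s0.
split.
  apply: (@integrable_dom _ _ _ _ _ (fun z : X => B * `|pa a t ((z : 'rV[R]_n) - y)|)).
  - by apply: measurable_funM; [exact: (measurableT_comp ms (mr x))|exact: (measurableT_comp mt (ml y))].
  - by move=> z; rewrite normrM; apply: ler_wpM2r.
  - apply: integrable_scale.
    exact: (integrable_abse (integrable_shift_row y (integrable_pa hpa a0 t0))).
exact: Rintegral_pa_conv.
Qed.

Lemma upper_Qk M : 0 < M -> exists2 A, 0 <= A & forall a t z, 0 < a -> a <= M -> 0 < t -> t <= 1 ->
  pa a t z <= A * Qk alpha a betaU t z.
Proof.
move=> M0; have [CL [CU [_ CU0 H]]] := heat M0 ltr01.
exists (CU * (1 + expR betaU + 2 `^ p)).
  by rewrite mulr_ge0 ?(ltW CU0)// !addr_ge0 ?expR_ge0 ?powR_ge0.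
move=> a t z a0 aM t0 tt; have [_ h] := H a t z a0 aM t0 tt; apply: le_trans h _.
by rewrite -mulrA; apply: ler_wpM2l; [exact: ltW|exact: qfun_le_Qk].
Qed.

Lemma gradient_Qk M : 0 < M -> exists2 K, 0 <= K & forall i a t z, 0 < a -> a <= M -> 0 < t -> t <= 1 ->
  `|fspD alpha i a t z| <= K * ((Num.sqrt t)^-1 * Qk alpha a be' t z).
Proof.
move=> M0; have [A A0 H] := upper_Qk M0.
have k0 : (0 : R) < 9 / 10 by lra.
have k1 : (9 / 10 : R) < 1 by lra.
have c0 : 0 <= (1 - (9 / 10) ^+ 2 : R)^-1 by rewrite invr_ge0; lra.
have q0 : 0 <= (9 / 10 : R) `^ (- p) := powR_ge0 _ _.
exists ((1 - (9 / 10) ^+ 2)^-1 * (A * (9 / 10) `^ (- p))).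
  by rewrite mulr_ge0// mulr_ge0.
move=> i a t z a0 aM t0 tt.
apply: (@le_trans _ _ ((1 - (9 / 10) ^+ 2)^-1 * (Num.sqrt t)^-1 * fsp alpha a t ((9 / 10) *: z))).
  by apply: fspD_le => //; rewrite ?k0 ?k1 ?al0 ?al2.
rewrite [leRHS]mulrACA; apply: ler_wpM2l.
  by apply: mulr_ge0 => //; rewrite invr_ge0 sqrtr_ge0.
rewrite -pa_fsp//; apply: le_trans (H _ _ _ a0 aM t0 tt) _.
by rewrite -mulrA; apply: ler_wpM2l => //; apply: Qk_scale => //; exact: ltW.
Qed.

(** A crude bound at any fixed time, for the integrability of the product of the gradient with p^a
    in the convolution identity. *)
Lemma fspD_bounded a i t : 0 < a -> 0 < t -> exists B, forall z, `|fspD alpha i a t z| <= B.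
Proof.
move=> a0 t0; have [B hB] := pa_bounded a0 t0.
have k0 : (0 : R) < 9 / 10 by lra.
have k1 : (9 / 10 : R) < 1 by lra.
exists ((1 - (9 / 10) ^+ 2)^-1 * (Num.sqrt t)^-1 * B) => z.
apply: (@le_trans _ _ ((1 - (9 / 10) ^+ 2)^-1 * (Num.sqrt t)^-1 * fsp alpha a t ((9 / 10) *: z))).
  by apply: fspD_le => //; rewrite ?k0 ?k1 ?al0 ?al2.
apply: ler_wpM2l.
  by apply: mulr_ge0; rewrite invr_ge0 ?sqrtr_ge0//; lra.
by rewrite -pa_fsp//; apply: le_trans (hB _); exact: ler_norm.
Qed.

Lemma drift_le (K W : R) (v g : 'I_n -> R) (F : R) :
  (forall i, `|v i| <= F) -> (forall i, `|g i| <= K * W) ->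
  `|\sum_(i < n) v i * g i| <= n%:R * K * (F * W).
Proof.
move=> hv hg; apply: le_trans (ler_norm_sum _ _ _) _.
apply: (@le_trans _ _ (\sum_(i < n) F * (K * W))).
  by apply: ler_sum => i _; rewrite normrM; apply: ler_pM.
by rewrite sumr_const card_ord -mulr_natl le_eqVlt; apply/orP; left; apply/eqP; ring.
Qed.

(** With c = 2 betaL / betaU: [Qk] is at most q^a with exponent betaU / 2 at time t, hence at most a
    multiple of q^a with exponent betaL at time c t, where the lower heat kernel bound applies. *)
Lemma Qk_le_pa M : 0 < M -> exists2 A, 0 <= A & forall a t z, 0 < a -> a <= M -> 0 < t -> t <= 1 ->
  th alpha a t <= 1 -> Qk alpha a be t z <= A * pa a (2 * betaL * t / betaU) z.
Proof.
move=> M0; pose c := 2 * betaL / betaU; have c0 : 0 < c by rewrite divr_gt0// mulr_gt0.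
have ci0 : 0 < c^-1 by rewrite invr_gt0.
have [CL [CU [CL0 _ H]]] := heat M0 c0.
set k := (c^-1 `^ (- (n%:R / 2)) + c^-1).
have k0 : 0 <= k by rewrite addr_ge0 ?powR_ge0// ltW.
exists (k / CL); first by rewrite divr_ge0// ltW.
move=> a t z a0 aM t0 tt th1.
have -> : 2 * betaL * t / betaU = c * t by rewrite /c; field; rewrite gt_eqF.
have ct0 : 0 < c * t by rewrite mulr_gt0.
have ct : c * t <= c by rewrite -[leRHS]mulr1 ler_pM2l.
have [h _] := H a (c * t) z a0 aM ct0 ct.
apply: le_trans (Qk_le_qfun al0 be z t0 th1) _.
have := qfun_scale alpha a be z ci0 ct0; rewrite mulKf ?gt_eqF// -/k => /le_trans; apply.
have -> : be / c^-1 = betaL by rewrite /c; field; rewrite !gt_eqF.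
by rewrite -(mulrA k); apply: ler_wpM2l => //; rewrite ler_pdivlMl.
Qed.

Section Fixed.
Variables (a : R) (b : 'rV[R]_n -> 'rV[R]_n) (t1 A0 KD CQ e : R).
Hypothesis a0 : 0 < a.
Hypothesis hb : borel_Rd b.
Hypothesis t10 : 0 < t1.
Hypothesis A00 : 0 <= A0.
Hypothesis KD0 : 0 <= KD.
Hypothesis CQ0 : 0 <= CQ.
Hypothesis hA : forall t z, 0 < t -> t <= t1 -> pa a t z <= A0 * Qk alpha a be t z.
Hypothesis hD : forall i t z, 0 < t -> t <= t1 ->
  `|fspD alpha i a t z| <= KD * ((Num.sqrt t)^-1 * Qk alpha a be' t z).
Hypothesis hDb : forall i t, 0 < t -> exists B, forall z, `|fspD alpha i a t z| <= B.
Hypothesis he : n%:R * KD * e <= 2^-1.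
Let f : X -> R := fun z => euclid (b z).
Hypothesis hker : forall t (x y : 'rV[R]_n), 0 < t -> t <= t1 ->
  (\int[sprod leb1 leb]_q (kerST alpha f a be be' t x y q)%:E <= (e * Qk alpha a be t (x - y))%:E)%E.
Hypothesis hQQ : forall r s (x y : 'rV[R]_n), 0 < r -> 0 < s -> r + s <= t1 ->
  (\int[leb]_z (Qk alpha a be r (x - z) * Qk alpha a be s ((z : 'rV[R]_n) - y))%:E <=
   (CQ * Qk alpha a be (r + s) (x - y))%:E)%E.

Let pp : R -> X -> X -> R := fun t x y => fsp alpha a t ((x : 'rV[R]_n) - y).
Let DD : R -> X -> X -> R := fun s z y =>
  \sum_(i < n) b z 0 i * fspD alpha i a s ((z : 'rV[R]_n) - y).
Let QQ : R -> X -> X -> R := fun t x y => Qk alpha a be t ((x : 'rV[R]_n) - y).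
Let kk : R -> X -> X -> Tm * X -> R := fun t x y q => n%:R * KD * kerST alpha f a be be' t x y q.

Let mb : measurable_fun setT (b : X -> X). Proof. exact: measurable_borel_Rd. Qed.
Let mf : measurable_fun setT f. Proof. exact: measurable_euclid. Qed.
Let f0 z : 0 <= f z. Proof. exact: euclid_ge0. Qed.
Let nK0 : 0 <= n%:R * KD. Proof. by rewrite mulr_ge0. Qed.

Let mu1 : measurable_fun setT (fun u : Tm * (X * X) => u.1 : R). Proof. exact: measurable_fst. Qed.
Let mu21 : measurable_fun setT (fun u : Tm * (X * X) => u.2.1). Proof. by mfun. Qed.
Let mu2 : measurable_fun setT (fun u : Tm * (X * X) => (u.2.1 : 'rV[R]_n) - u.2.2 : X).
Proof. by apply: measurable_rowB_sub; mfun. Qed.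

Let mpp : jm pp. Proof. exact: measurable_fsp. Qed.
Let mQQ : jm QQ. Proof. exact: measurable_Qk. Qed.
Let mDD : jm DD.
Proof.
apply: measurable_sum => i; apply: measurable_funM; last exact: measurable_fspD.
by apply: (measurableT_comp (measurable_coord i)); exact: (measurableT_comp mb mu21).
Qed.

Let mkk t : measurable_fun setT (fun u : (X * X) * (Tm * X) => kk t u.1.1 u.1.2 u.2).
Proof.
have m1 : measurable_fun setT (fun u : (X * X) * (Tm * X) => u.2.1 : R) by mfun.
have m2 : measurable_fun setT (fun u : (X * X) * (Tm * X) => u.2.2) by mfun.
have mt : measurable_fun setT (fun u : (X * X) * (Tm * X) => t : R) by exact: measurable_cst.
have mts := measurable_funB mt m1.
have m3 : measurable_fun setT (fun u : (X * X) * (Tm * X) => (u.1.1 : 'rV[R]_n) - u.2.2 : X).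
  by apply: measurable_rowB_sub; mfun.
have m4 : measurable_fun setT (fun u : (X * X) * (Tm * X) => (u.2.2 : 'rV[R]_n) - u.1.2 : X).
  by apply: measurable_rowB_sub; mfun.
apply: measurable_funM; first exact: measurable_cst.
apply: measurable_funM; first exact: measurable_indt2.
apply: measurable_funM; first exact: (measurable_Qk alpha a be mts m3).
apply: measurable_funM; first exact: (measurableT_comp mf m2).
apply: measurable_funM; first exact: measurable_rsqrt.
exact: (measurable_Qk alpha a be' m1 m4).
Qed.

Let kk0 t x y q : 0 <= kk t x y q.
Proof. by apply: mulr_ge0 => //; exact: kerST_ge0. Qed.

Let pp_le t x y : 0 < t -> t <= t1 -> `|pp t x y| <= A0 * QQ t x y.
Proof. by move=> t0 tt; rewrite /pp -pa_fsp// ger0_norm ?pa_ge0//; exact: hA. Qed.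

Let DD_le s z y : 0 < s -> s <= t1 ->
  `|DD s z y| <= n%:R * KD * (f z * ((Num.sqrt s)^-1 * Qk alpha a be' s ((z : 'rV[R]_n) - y))).
Proof.
move=> s0 ss; apply: drift_le => i; first exact: coord_le_euclid.
exact: hD.
Qed.

Let DD_kk t s x w y : 0 < s -> s < t -> t <= t1 -> QQ (t - s) x w * `|DD s w y| <= kk t x y (s, w).
Proof.
move=> s0 st tt; have h := DD_le w y s0 (le_trans (ltW st) tt).
have Q0 : 0 <= QQ (t - s) x w by exact: Qk_ge0.
apply: le_trans (ler_wpM2l Q0 h) _; rewrite /kk /kerST /= indtE s0 st /= mul1r /QQ.
by rewrite mulrCA.
Qed.

Let int_kk t x y : 0 < t -> t <= t1 ->
  (\int[sprod leb1 leb]_q (kk t x y q)%:E <= (2^-1 * QQ t x y)%:E)%E.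
Proof.
move=> t0 tt.
have k0 q : 0 <= kerST alpha f a be be' t x y q by exact: kerST_ge0.
have mk := measurable_kerST alpha mf a be be' t x y.
rewrite /kk (intZ _ mk k0 nK0).
apply: le_trans (lee_wpmul2l _ (hker x y t0 tt)) _; first by rewrite lee_fin.
by rewrite -EFinM lee_fin mulrA; apply: ler_wpM2r => //; exact: Qk_ge0.
Qed.

Let pp_conv s t x y : 0 < s -> 0 < t -> \int[leb]_z (pp s x z * pp t z y) = pp (s + t) x y.
Proof.
move=> s0 t0; rewrite /pp -pa_fsp ?addr_gt0// -(Rintegral_pa_conv x y a0 s0 t0).
by apply: eq_Rintegral => z _; rewrite !pa_fsp.
Qed.

Let Dp i s t (w y : X) : 0 < s -> 0 < t ->
  leb.-integrable setT (EFin \o (fun z : X => fspD alpha i a s ((w : 'rV[R]_n) - z) * pp t z y)) /\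
  \int[leb]_z (fspD alpha i a s ((w : 'rV[R]_n) - z) * pp t z y) =
    fspD alpha i a (s + t) ((w : 'rV[R]_n) - y).
Proof.
move=> s0 t0; have mt := measurable_pa a0 t0.
have mr (v : 'rV[R]_n) : measurable_fun setT (fun z : X => v - z : X).
  by apply: measurable_rsub; exact: measurable_id.
have ml : measurable_fun setT (fun z : X => (z : 'rV[R]_n) - y : X).
  by apply: measurable_rsubr; exact: measurable_id.
have mF (v : 'rV[R]_n) : measurable_fun setT (fun z : X => fspD alpha i a s (v - z)).
  by apply: measurable_fspD; [exact: measurable_cst|exact: mr].
have [B hB] := hDb i s0.
have E : (fun z : X => fspD alpha i a s ((w : 'rV[R]_n) - z) * pp t z y) =
  (fun z : X => fspD alpha i a s ((w : 'rV[R]_n) - z) * pa a t ((z : 'rV[R]_n) - y)).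
  by apply/funext => z; rewrite /pp pa_fsp.
rewrite E; split.
  apply: (@integrable_dom _ _ _ _ _ (fun z : X => B * `|pa a t ((z : 'rV[R]_n) - y)|)).
  - by apply: measurable_funM; [exact: mF|exact: (measurableT_comp mt ml)].
  - by move=> z; rewrite normrM; apply: ler_wpM2r.
  - apply: integrable_scale.
    exact: (integrable_abse (integrable_shift_row y (integrable_pa hpa a0 t0))).
pose g (u : X) : R := pa a t u * fspD alpha i a s (((w : 'rV[R]_n) - y) - u).
have mg : measurable_fun setT g by apply: measurable_funM; [exact: mt|exact: mF].
transitivity (\int[leb]_z g ((z : 'rV[R]_n) - y)).
  by apply: eq_Rintegral => z _; rewrite /g mulrC opprB addrA subrK.
by rewrite (Rintegral_shift_row y mg) /g (fspD_conv hpa).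
Qed.

Let DDp s t w y : 0 < s -> 0 < t ->
  leb.-integrable setT (EFin \o (fun z => DD s w z * pp t z y)) /\
  \int[leb]_z (DD s w z * pp t z y) = DD (s + t) w y.
Proof.
move=> s0 t0; apply: integrable_Rint_sum => i; first exact: (Dp i w y s0 t0).1.
exact: (Dp i w y s0 t0).2.
Qed.

(** The iterates of the definition use nested integrals and formal derivatives of [pa]. The bound on
    the abstract iterates makes the space-time integrand integrable, so Fubini applies, and
    [derive_pa] identifies the derivatives. *)
Let pk_pm k t x y : 0 < t -> t <= t1 -> pk pa a b k t x y = pm pp DD k t x y.
Proof.
elim: k t x y => [|k ih] t x y t0 tt /=; first by rewrite pa_fsp.
have iS := integrable_STk mDD mkk kk0 DD_kk int_kk x y
  (jm_pm mpp mDD k) (bd_pm A00 mpp mDD mkk kk0 pp_le DD_kk int_kk k) (lexx t1)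
  (divr_ge0 A00 (exprn_ge0 k (ler0n R 2))) t0 tt.
transitivity (\int[leb1]_s intRd (fun z => STk DD (pm pp DD k) t x y (s, z))); last exact: (Rint_intRd iS).
rewrite [LHS]Rintegral_mkcond; apply: eq_Rintegral => s _; rewrite patchE; case: ifPn => hs.
  move: hs; rewrite inE /= in_itv /= => /andP[s0 st].
  congr intRd; apply/funext => z; rewrite /STk /= indtE s0 st /= mul1r ih ?subr_gt0//; last first.
    by rewrite lerBlDr; apply: le_trans tt _; rewrite lerDl ltW.
  congr (_ * _); apply: eq_bigr => i _; congr (_ * _).
  exact: (derive_pa hpa pa_bounded).
rewrite -[LHS](@intRd0 R n); congr intRd; apply/funext => z.
by rewrite /STk /= /indt indicE (negbTE hs) mul0r.
Qed.

Lemma pab_le (pab : R -> 'rV[R]_n -> 'rV[R]_n -> R) : is_pab pa a b pab ->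
  exists G : R -> X -> X -> R, [/\ jm G,
    forall t x y, 0 < t -> t <= t1 -> G t x y = pab t x y &
    forall t x y, 0 < t -> t <= t1 -> `|G t x y| <= 2 * A0 * Qk alpha a be t ((x : 'rV[R]_n) - y)].
Proof.
move=> [_ [ts ts0 hs] CK].
have T0 : 0 < Num.min ts t1 by rewrite lt_min ts0 t10.
have TT : Num.min ts t1 <= t1 by rewrite ge_min lexx orbT.
have ser t x y : 0 < t -> t <= Num.min ts t1 -> Sm pp DD N t x y @[N --> \oo] --> pab t x y.
  move=> t0; rewrite le_min => /andP[tts tt].
  have [_ h] := hs t x y t0 tts.
  have -> : (fun N => Sm pp DD N t x y) = (fun N => \sum_(0 <= k < N) pk pa a b k t x y).
    by apply/funext => N; apply: eq_bigr => k _; rewrite pk_pm.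
  exact: h.
have Q0 t x y : 0 <= QQ t x y by exact: Qk_ge0.
have iDp s t w y (s0 : 0 < s) (t0 : 0 < t) := (DDp w y s0 t0).1.
have cDp s t w y (s0 : 0 < s) (t0 : 0 < t) := (DDp w y s0 t0).2.
have [G [mG GE bG _]] := @duhamel_bound R n pp DD QQ kk t1 A0 CQ t10 A00 CQ0 mpp mDD mQQ Q0 mkk kk0
  pp_le DD_kk int_kk hQQ pp_conv iDp cDp pab CK _ T0 TT ser.
by exists G.
Qed.

End Fixed.
(** The order of quantifiers is the point: A' is chosen before the drift, and t1 before a. *)
Lemma small_time M : 0 < M -> exists2 A', 1 <= A' & forall b, borel_Rd b -> Kato_d1 b ->
  exists2 t1, 0 < t1 & forall a, 0 < a -> a <= M -> forall pab, is_pab pa a b pab ->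
  exists G : R -> X -> X -> R, [/\ jm G,
    forall t x y, 0 < t -> t <= t1 -> G t x y = pab t x y &
    forall t x y, 0 < t -> t <= t1 ->
      `|G t x y| <= A' * pa a (2 * betaL * t / betaU) ((x : 'rV[R]_n) - y)].
Proof.
move=> M0; have [A A0 HA] := upper_Qk M0; have [K K0 HK] := gradient_Qk M0.
have [C C0 HC] := integral_kerST_le n1 al0 al2 be0 bebe'.
have [CQ CQ0 HQ] := integral_Qk_conv (ltnW n1) al0 al2 be0.
have [A1 A10 H1] := Qk_le_pa M0.
have [tM tM0 hth] := th_le1 al0 al2 M0.
(* The summand 1 makes the logarithm of the constant nonnegative, as the iteration in time needs. *)
exists (1 + 2 * A * A1); first by rewrite lerDl !mulr_ge0.
move=> b hb hK.
pose L := n%:R * K * C; have L0 : 0 <= L by rewrite !mulr_ge0.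
(* The smallness asked of the Kato modulus: L e <= 1/2, also when L = 0. *)
pose e := 2^-1 / (L + 1); have L1 : 0 < L + 1 by rewrite ltr_wpDl.
have e0 : 0 < e by rewrite divr_gt0.
have [r0 r00 hr0] : exists2 r0, 0 < r0 & forall r, 0 < r -> r < r0 -> (Kato_M b r <= e%:E)%E.
  have /nbhs_ballP[r0 /= r00 h] : \forall r \near (0 : R)^'+, (Kato_M b r < e%:E)%E.
    have hN : nbhs (0%E : \bar R) [set y | (y < e%:E)%E].
      by apply: open_nbhs_nbhs; split; [exact: open_ereal_lt_ereal|rewrite /= lte_fin].
    exact: (hK _ hN).
  exists r0 => // r r_gt0 rr0; apply/ltW/h => //=.
  by rewrite -ball_normE /ball_ /= sub0r normrN gtr0_norm.
(* The three bounds serve, in order, the kernel estimates on ]0, 1], the condition [th] <= 1, and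
   sqrt t <= r0/2 < r0, where the Kato modulus is below [e]. *)
exists (Num.min 1 (Num.min tM ((r0 / 2) ^+ 2))).
  by rewrite !lt_min ltr01 tM0 exprn_gt0// divr_gt0.
set t1 := Num.min 1 _.
have t10 : 0 < t1 by rewrite !lt_min ltr01 tM0 exprn_gt0// divr_gt0.
have ht t : t <= t1 -> [/\ t <= 1, t <= tM & t <= (r0 / 2) ^+ 2].
  by rewrite !le_min => /andP[? /andP[? ?]].
move=> a a0 aM pab hpab.
have hA t z : 0 < t -> t <= t1 -> pa a t z <= A * Qk alpha a be t z.
  move=> t0 /ht[h1 _ _]; apply: le_trans (HA a t z a0 aM t0 h1) _.
  by apply: ler_wpM2l => //; exact: Qk_antitone.
have hD i t z : 0 < t -> t <= t1 ->
    `|fspD alpha i a t z| <= K * ((Num.sqrt t)^-1 * Qk alpha a be' t z).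
  by move=> t0 /ht[h1 _ _]; exact: HK.
have hth1 t : 0 < t -> t <= t1 -> th alpha a t <= 1 by move=> t0 /ht[_ h _]; exact: hth.
have he : n%:R * K * (C * e) <= 2^-1.
  rewrite mulrA -/L /e mulrCA -[leRHS]mulr1; apply: ler_wpM2l => //.
  by rewrite ler_pdivrMr// mul1r lerDl.
have hker t (x y : 'rV[R]_n) : 0 < t -> t <= t1 ->
    (\int[sprod leb1 leb]_q (kerST alpha (fun z : X => euclid (b z)) a be be' t x y q)%:E <=
     (C * e * Qk alpha a be t (x - y))%:E)%E.
  move=> t0 tt; have [_ _ tr] := ht t tt.
  apply: HC => //.
  - by apply: measurable_euclid; exact: measurable_borel_Rd.
  - by move=> z; exact: euclid_ge0.
  - exact: hth1.
  - move=> x'; apply: le_trans (nearK_Kato (Num.sqrt t) x' hb) _.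
    apply: hr0; first by rewrite sqrtr_gt0.
    apply: (@le_lt_trans _ _ (r0 / 2)); last by rewrite ltr_pdivrMr// mulr_natr mulr2n ltrDl.
    have r20 : 0 <= r0 / 2 by rewrite divr_ge0// ltW.
    by rewrite -(ger0_norm r20) -sqrtr_sqr; exact: ler_wsqrtr.
have hQQ r s (x y : 'rV[R]_n) : 0 < r -> 0 < s -> r + s <= t1 ->
  (\int[leb]_z (Qk alpha a be r (x - z) * Qk alpha a be s ((z : 'rV[R]_n) - y))%:E <=
   (CQ * Qk alpha a be (r + s) (x - y))%:E)%E.
  by move=> r_gt0 s0 rs; apply: HQ => //; apply: hth1 => //; rewrite addr_gt0.
have hDb i t : 0 < t -> exists B, forall z, `|fspD alpha i a t z| <= B.
  by move=> t0; exact: fspD_bounded.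
have [G [mG GE bG]] : exists G : R -> X -> X -> R, [/\ jm G,
    forall t x y, 0 < t -> t <= t1 -> G t x y = pab t x y &
    forall t x y, 0 < t -> t <= t1 -> `|G t x y| <= 2 * A * Qk alpha a be t ((x : 'rV[R]_n) - y)].
  exact: (@pab_le a b t1 A K CQ (C * e) a0 hb t10 A0 K0 CQ0 hA hD hDb he hker hQQ pab hpab).
exists G; split => // t x y t0 tt; have [h1 _ _] := ht t tt.
apply: le_trans (bG t x y t0 tt) _.
have c0 : 0 < 2 * betaL * t / betaU by rewrite divr_gt0// !mulr_gt0.
apply: (@le_trans _ _ (2 * A * A1 * pa a (2 * betaL * t / betaU) ((x : 'rV[R]_n) - y))).
  rewrite -(mulrA (2 * A)); apply: ler_wpM2l; first exact: mulr_ge0.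
  by apply: H1 => //; exact: hth1.
by apply: ler_wpM2r; [exact: pa_ge0|rewrite lerDr].
Qed.

(** The time change is linear, so p^a at the changed times is again a semigroup and each step costs
    exactly one factor A'. Measurability in y belongs to the induction, since [G] represents [pab]
    only up to time t1. *)
Lemma chapman_kolmogorov_iterate a b A' t1 pab (G : R -> X -> X -> R) :
  0 < a -> 1 <= A' -> is_pab pa a b pab -> jm G ->
  (forall t x y, 0 < t -> t <= t1 -> G t x y = pab t x y) ->
  (forall t x y, 0 < t -> t <= t1 ->
     `|G t x y| <= A' * pa a (2 * betaL * t / betaU) ((x : 'rV[R]_n) - y)) ->
  forall tau k (x : X), 0 < tau -> tau <= t1 ->
  measurable_fun setT (fun y : X => pab (k.+1%:R * tau) x y) /\
  forall y, `|pab (k.+1%:R * tau) x y| <= A' ^+ k.+1 * pa a (2 * betaL * (k.+1%:R * tau) / betaU) (x - y).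
Proof.
move=> a0 A1 [_ _ CK] mG GE bG tau k x tau0 taut.
have A0 : 0 <= A' by exact: le_trans A1.
have mGy z : measurable_fun setT (fun y : X => G tau z y).
  by apply: (jm_comp mG); [exact: measurable_cst|exact: measurable_cst|exact: measurable_id].
have mGz y : measurable_fun setT (fun z : X => G tau z y).
  by apply: (jm_comp mG); [exact: measurable_cst|exact: measurable_id|exact: measurable_cst].
have cpos (s : R) : 0 < s -> 0 < 2 * betaL * s / betaU.
  by move=> s0; rewrite divr_gt0// !mulr_gt0.
elim: k => [|k [ihm ih]].
  rewrite mul1r; split; last by move=> y; rewrite expr1 -GE//; exact: bG.
  have -> : (fun y : X => pab tau x y) = (fun y => G tau x y) by apply/funext => y; rewrite GE.
  exact: mGy.
set s := k.+1%:R * tau in ihm ih; have s0 : 0 < s by rewrite mulr_gt0.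
have -> : k.+2%:R * tau = s + tau by rewrite /s -natr1 mulrDl mul1r.
pose w y (z : X) := pa a (2 * betaL * s / betaU) (x - z) * pa a (2 * betaL * tau / betaU) ((z : 'rV[R]_n) - y).
have [iw wE] : (forall y, leb.-integrable setT (EFin \o w y)) /\
    (forall y, \int[leb]_z w y z = pa a (2 * betaL * (s + tau) / betaU) (x - y)).
  have cE : 2 * betaL * (s + tau) / betaU = 2 * betaL * s / betaU + 2 * betaL * tau / betaU.
    by rewrite mulrDr mulrDl.
  split=> y; first exact: (pa_conv x y a0 (cpos _ s0) (cpos _ tau0)).1.
  by rewrite cE; exact: (pa_conv x y a0 (cpos _ s0) (cpos _ tau0)).2.
have mv y : measurable_fun setT (fun z : X => pab s x z * G tau z y).
  by apply: measurable_funM; [exact: ihm|exact: mGz].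
have vw y z : `|pab s x z * G tau z y| <= A' ^+ k.+2 * w y z.
  rewrite normrM exprSr /w mulrACA.
  by apply: ler_pM; [exact: normr_ge0|exact: normr_ge0|exact: ih|exact: bG].
have E y : pab (s + tau) x y = \int[leb]_z (pab s x z * G tau z y).
  rewrite CK// -(intRd_leb (integrable_dom (mv y) (vw y) (integrable_scale _ (iw y)))).
  by congr intRd; apply/funext => z; rewrite GE.
split.
  have -> : (fun y : X => pab (s + tau) x y) = (fun y => \int[leb]_z (pab s x z * G tau z y)).
    by apply/funext => y; exact: E.
  apply: (@measurable_Rintegral _ _ X X R leb (fun u => pab s x u.2 * G tau u.2 u.1)).
  apply: measurable_funM; first exact: (measurableT_comp ihm measurable_snd).
  by apply: (jm_comp mG); [exact: measurable_cst|exact: measurable_snd|exact: measurable_fst].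
move=> y; rewrite E; apply: le_trans (norm_Rintegral_le (mv y) (vw y) (integrable_scale _ (iw y))) _.
by rewrite (RintZ _ (iw y)) wE.
Qed.

End Main.

Theorem theorem4p1 (R : realType) (d : nat) (alpha : R)
  (pa : R -> R -> 'rV[R]_d -> R) (betaL betaU : R) :
  (2 <= d)%N -> 0 < alpha < 2 ->
  is_pa alpha pa ->
  0 < betaL -> 0 < betaU ->
  (forall M T : R, 0 < M -> 0 < T ->
     exists CL CU : R, [/\ 0 < CL, 0 < CU &
       forall a t (z : 'rV[R]_d), 0 < a -> a <= M -> 0 < t -> t <= T ->
         CL * qfun alpha a betaL t z <= pa a t z /\
         pa a t z <= CU * qfun alpha a betaU t z]) ->
  forall M : R, 0 < M ->
  exists (C : R) (C2 : R -> R),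
  forall b : 'rV[R]_d -> 'rV[R]_d, borel_Rd b -> Kato_d1 b ->
  exists C' : R,
  forall a : R, 0 < a -> a <= M ->
  forall pab : R -> 'rV[R]_d -> 'rV[R]_d -> R, is_pab pa a b pab ->
    (forall t x y, 0 < t ->
       `|pab t x y| <= C * expR (C' * t) * pa a (2 * betaL * t / betaU) (x - y)) /\
    (forall T : R, 0 < T -> forall t x y, 0 < t -> t <= T ->
       `|pab t x y| <= C2 T * expR (C' * t) *
                       qfun alpha a (betaU ^+ 2 / (2 * betaL)) t (x - y)).
Proof.
move=> d2 /andP[al0 al2] hpa bL0 bU0 heat M M0.
have [A' A1 small] := small_time d2 al0 al2 hpa bL0 bU0 heat M0.
have A0 : 0 < A' by exact: lt_le_trans A1.
pose c := 2 * betaL / betaU; have c0 : 0 < c by rewrite divr_gt0// mulr_gt0.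
have cE (t : R) : 2 * betaL * t / betaU = c * t by rewrite /c mulrAC.
(* The constant of the second bound is a function of T fixed before the drift, hence the choice
   function. The heat kernel bound is taken up to c T because p^a is evaluated at time c t. *)
have /choice[CU HCU] : forall T : R, exists CU : R, 0 < T -> 0 < CU /\
    forall a t (z : 'rV[R]_d), 0 < a -> a <= M -> 0 < t -> t <= c * T ->
      pa a t z <= CU * qfun alpha a betaU t z.
  move=> T; case: (ltP 0 T) => [T0|_]; last by exists 0.
  have [CL [CU [_ CU0 H]]] := heat M (c * T) M0 (mulr_gt0 c0 T0).
  by exists CU => _; split => // a t z a0 aM t0 tT; case: (H a t z a0 aM t0 tT).
exists A', (fun T => A' * (CU T * (c `^ (- (d%:R / 2)) + c))) => b hb hK.
have [t1 t10 H] := small b hb hK.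
exists (ln A' / t1) => a a0 aM pab hpab.
have [G [mG GE bG]] := H a a0 aM pab hpab.
have bound t x y : 0 < t ->
    `|pab t x y| <= A' * expR (ln A' / t1 * t) * pa a (2 * betaL * t / betaU) (x - y).
  (* With k the integer part of t / t1, k + 1 equal steps have length at most t1, and A'^(k+1) <= A'
     exp(t ln A' / t1) because k <= t / t1 and A' >= 1. *)
  move=> t0; pose k := Num.truncn (t / t1).
  have k0 : 0 < k.+1%:R :> R by [].
  have tau0 : 0 < t / k.+1%:R by rewrite divr_gt0.
  have taut : t / k.+1%:R <= t1.
    by rewrite ler_pdivrMr// mulrC -ler_pdivrMr//; exact/ltW/truncnS_gt.
  have [_ h] := chapman_kolmogorov_iterate hpa bL0 bU0 heat a0 A1 hpab mG GE bG k x tau0 taut.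
  have tE : k.+1%:R * (t / k.+1%:R) = t by rewrite mulrC divfK// gt_eqF.
  have := h y; rewrite tE => /le_trans; apply; apply: ler_wpM2r.
    by eapply pa_ge0; first [exact: heat|exact: a0|by rewrite cE mulr_gt0].
  rewrite exprS; apply: ler_wpM2l; first exact: ltW.
  rewrite -[in leLHS](lnK A0) -expRM_natl ler_expR -mulrA mulrC; apply: ler_wpM2l; first exact: ln_ge0.
  by rewrite mulrC truncn_le// divr_ge0// ltW.
split=> [|T T0 t x y t0 tT]; first exact: bound.
apply: le_trans (bound t x y t0) _.
have ct0 : 0 < c * t by rewrite mulr_gt0.
have [CU0 HT] := HCU T T0.
rewrite cE; have h1 := HT a (c * t) (x - y) a0 aM ct0 (ler_wpM2l (ltW c0) tT).
have h2 := qfun_scale alpha a betaU (x - y) c0 t0.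
have bE : betaU / c = betaU ^+ 2 / (2 * betaL) by rewrite /c; field; rewrite !gt_eqF.
rewrite bE in h2.
have h3 := le_trans h1 (ler_wpM2l (ltW CU0) h2).
have AE0 : 0 <= A' * expR (ln A' / t1 * t) by rewrite mulr_ge0 ?expR_ge0// ltW.
apply: le_trans (ler_wpM2l AE0 h3) _.
by rewrite le_eqVlt; apply/orP; left; apply/eqP; ring.
Qed.
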